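(* Let $V$ be an irreducible difference variety over $\mathcal{F}$ of dimension $d$ and order $h$ (in the affine space with coordinates $y_1,\ldots,y_n$), and let $F(\mathbf{u}_0,\mathbf{u}_1,\ldots,\mathbf{u}_d)$ be its difference Chow form, where $\mathbf{u}_i=(u_{i0},u_{i1},\ldots,u_{in})$. Then: 1) There exist $r_0,\ldots,r_h\in\mathbb{N}_0$ such that for all $k=0,1,\ldots,h$ and all $\rho,\tau\in\{0,\ldots,d\}$, $$\sum_{j=0}^n u_{\tau j}^{(k)}\frac{\partial F}{\partial u_{\rho j}^{(k)}}=\begin{cases}0 & \text{if } \rho\neq\tau,\\ r_kF & \text{if } \rho=\tau.\end{cases}$$ 2) $F(\mathbf{u}_0,\ldots,\mathbf{u}_d)$ is transformally homogeneous in each $\mathbf{u}_i$ ($i=0,\ldots,d$).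
   Context: A difference field is a field $\mathcal{F}$ with an operation $\sigma$ such that $\sigma(a+b)=\sigma(a)+\sigma(b)$, $\sigma(ab)=\sigma(a)\sigma(b)$, and $\sigma(a)=0$ iff $a=0$. Write $a^{(k)}=\sigma^k(a)$. Throughout, $\mathcal{F}$ is a difference field. $\mathcal{F}\langle S\rangle$ is the smallest difference subfield (of a given difference overfield) containing $\mathcal{F}$ and $S$. A family is transformally independent over $\mathcal{F}$ (a family of difference indeterminates) if all transforms of its elements together are algebraically independent over $\mathcal{F}$; the transformal transcendence degree is the cardinality of a maximal transformally independent subset. $\mathcal{F}\{\mathbb{Y}\}=\mathcal{F}[y_j^{(k)}:1\le j\le n,\ k\ge0]$ with $\mathbb{Y}=\{y_1,\ldots,y_n\}$. A difference ideal is an ideal closed under $\sigma$; $[S]$ is the difference ideal generated by $S$; it is reflexive if $a^{(1)}\in\mathcal{I}$ implies $a\in\mathcal{I}$; prime difference ideals are assumed not to be the unit ideal. The universal system $\mathscr{U}$ of $\mathcal{F}$ is the set of all difference overfields of $\mathcal{F}$ defined over subfields of the algebraic closure of $\mathcal F(x_1,x_2,\ldots)$ with $x_i$ algebraically independent over the underlying field of $\mathcal{F}$. The difference variety of $S\subset\mathcal{F}\{\mathbb{Y}\}$ is the set of all difference solutions of $S$ with coordinates in some field of $\mathscr{U}$. It is irreducible if it is not the union of two proper subvarieties; $\mathbb{I}(V)$ is the set of difference polynomials vanishing on $V$, and $V$ is irreducible iff $\mathbb{I}(V)$ is a reflexive prime difference ideal. A generic zero $\eta$ of a reflexive prime difference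 ideal $\mathcal{I}$ satisfies: $P(\eta)=0$ iff $P\in\mathcal{I}$. $\dim(\mathcal{I})$ is the transformal transcendence degree of $\mathcal{F}\langle\eta\rangle/\mathcal{F}$, codimension is the number of indeterminates minus the dimension, and, if $\dim(\mathcal{I})=d$, the order is the integer $h\ge0$ with $\mathrm{tr.deg}\,\mathcal{F}(\eta_i^{(k)}:1\le i\le n,\ 0\le k\le t)/\mathcal{F}=d(t+1)+h$ for all large $t$. Dimension and order of $V$ are those of $\mathbb{I}(V)$. Characteristic sets: a ranking is a total order on the transforms of the indeterminates with $\sigma(\alpha)>\alpha$ and $\alpha>\beta\Rightarrow\sigma(\alpha)>\sigma(\beta)$. The leader of $f$ is the greatest transform $y_j^{(k)}$ occurring in it. $g$ is reduced with respect to $f$ with leader $y_j^{(k)}$ if $\deg(g,y_j^{(k+l)})<\deg(f,y_j^{(k)})$ for all $l\ge0$. $g$ is higher than $f$ if its leader is higher, or the leaders agree and $g$ has larger degree in it. An ascending chain is a finite sequence $A_1,\ldots,A_m$ of nonzero difference polynomials such that for $i<j$, $A_j$ is higher than $A_i$ and reduced with respect to $A_i$. A characteristic set of an ideal is an ascending chain contained in it such that the ideal contains no nonzero element reduced with respect to all members of the chain. Difference Chow form: let $\mathbb{P}_i=u_{i0}+u_{i1}y_1+\cdots+u_{in}y_n$ ($i=0,\ldots,d$), all $u_{ij}$ difference indeterminates. The ideal $[\mathbb{I}(V),\mathbb{P}_0,\ldots,\mathbb{P}_d]\cap\mathcal{F}\{\mathbf{u}_0,\ldots,\mathbf{u}_d\}$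 is the difference Chow ideal of $V$; it is a reflexive prime difference ideal of codimension one. For any reflexive prime difference ideal of codimension one, the first element of any characteristic set with respect to any ranking, when taken irreducible, is unique up to a factor in $\mathcal{F}$; for the difference Chow ideal this irreducible difference polynomial $F$ is the difference Chow form of $V$. Partial derivatives are formal, treating all $u_{ij}^{(k)}$ as independent variables. A difference polynomial $p\in\mathcal{F}\{y_0,\ldots,y_n\}$ is transformally homogeneous if for a new difference indeterminate $\lambda$, $p(\lambda y_0,\ldots,\lambda y_n)=M(\lambda)p(y_0,\ldots,y_n)$ for some difference monomial $M(\lambda)$ in $\lambda$. Transformally homogeneous in $\mathbf{u}_i$ means this holds with respect to the variables $\mathbf{u}_i$, the other $\mathbf{u}_l$ being held fixed. *)

(* Defs.v *)
From mathcomp Require Import all_boot all_order all_algebra.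
From mathcomp Require Import finmap.
From mathcomp.multinomials Require Import monalg.

Set Implicit Arguments.
Unset Strict Implicit.
Unset Printing Implicit Defensive.

Import GRing.Theory.
Local Open Scope ring_scope.

(* Polynomials over R in the (possibly infinitely many) variables Z are the
   monoid algebra {malg R[{cmonom Z}]}; peval c g is the evaluation that sends
   a coefficient a to c a and a variable z to g z. *)
Definition peval (R S : comNzRingType) (Z : choiceType) (c : R -> S)
    (g : Z -> S) (p : {malg R[{cmonom Z}]}) : S :=
  mmap c (fun m : {cmonom Z} => \prod_(z <- finsupp m) g z ^+ m z) p.

Definition pdeg (R : comNzRingType) (Z : choiceType)
    (p : {malg R[{cmonom Z}]}) (z : Z) : nat :=
  \max_(m <- msupp p) (m : {cmonom Z}) z.

Definition pderiv (R : comNzRingType) (Z : choiceType) (z : Z)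
    (p : {malg R[{cmonom Z}]}) : {malg R[{cmonom Z}]} :=
  \sum_(m <- msupp p) << p@_m *+ (m : {cmonom Z}) z *g divcm m (ucm z) >>.

Definition ring_unit (R : comNzRingType) (a : R) : Prop := exists b, a * b = 1.

Definition ring_irreducible (R : comNzRingType) (p : R) : Prop :=
  [/\ p <> 0, ~ ring_unit p &
      forall a b, p = a * b -> ring_unit a \/ ring_unit b].

Section FieldExtensions.
Variables (F L : fieldType) (c : {rmorphism F -> L}).

Definition is_subfield (E : L -> Prop) : Prop :=
  [/\ E 1, forall x y, E x -> E y -> E (x - y)
    & forall x y, E x -> E y -> E (x / y)].

Definition adjoin (S : L -> Prop) (x : L) : Prop :=
  forall E : L -> Prop, is_subfield E -> (forall a, E (c a)) ->
    (forall s, S s -> E s) -> E x.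

Definition algebraic_over (E : L -> Prop) (z : L) : Prop :=
  exists p : {poly L}, [/\ p <> 0, forall i, E p`_i & root p z].

Definition alg_indep (I : choiceType) (b : I -> L) : Prop :=
  forall p : {malg F[{cmonom I}]}, peval c b p = 0 -> p = 0.

Definition extend_family (I : Type) (b : I -> L) (x : L) (o : option I) : L :=
  if o is Some i then b i else x.

Definition trdeg_is (E : L -> Prop) (m : nat) : Prop :=
  exists b : 'I_m -> L,
    [/\ forall i, E (b i), alg_indep b
      & forall x, E x -> ~ alg_indep (extend_family b x)].

End FieldExtensions.

(* A unital ring endomorphism of a field is automatically injective; conversely
   an additive and multiplicative map with trivial zero set sends 1 to 1. *)
Record diffField := DiffField {
  df_field :> fieldType;
  sigma : {rmorphism df_field -> df_field} }.

Record diffExt (F : diffField) := DiffExt {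
  ext_field :> diffField;
  ext_emb : {rmorphism F -> ext_field};
  ext_sigma : forall a, ext_emb (sigma F a) = sigma ext_field (ext_emb a) }.

(* The variable (x, k) stands for the k-th transform of the indeterminate x. *)
Definition dpoly (F : diffField) (X : choiceType) : comNzRingType :=
  {malg F[{cmonom (X * nat)%type}]}.

Section DifferencePolynomials.
Variables (F : diffField) (X : choiceType).

Definition dconst (a : F) : dpoly F X := malgC a.

Definition dvar (x : X) (k : nat) : dpoly F X := << ucm (x, k) >>.

(* The formal partial derivative with respect to the k-th transform of x. *)
Definition dpartial (x : X) (k : nat) (p : dpoly F X) : dpoly F X :=
  pderiv (x, k) p.

Definition dshift : dpoly F X -> dpoly F X :=
  peval (fun a => dconst (sigma F a)) (fun v : X * nat => dvar v.1 v.2.+1).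

Definition deval (L : diffExt F) (eta : X -> L) : dpoly F X -> L :=
  peval (ext_emb L) (fun v : X * nat => iter v.2 (sigma L) (eta v.1)).

Definition difference_ideal (I : dpoly F X -> Prop) : Prop :=
  [/\ I 0, forall p q, I p -> I q -> I (p + q), forall p q, I q -> I (p * q)
    & forall p, I p -> I (dshift p)].

Definition dideal_gen (S : dpoly F X -> Prop) (p : dpoly F X) : Prop :=
  forall I, difference_ideal I -> (forall q, S q -> I q) -> I p.

Definition ranking (lt : rel (X * nat)) : Prop :=
  [/\ irreflexive lt /\ transitive lt,
      forall v w, v != w -> lt v w || lt w v,
      forall v, lt v (v.1, v.2.+1)
    & forall v w, lt w v -> lt (w.1, w.2.+1) (v.1, v.2.+1)].

Section Ranking.
Variable lt : rel (X * nat).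

Definition leader (f : dpoly F X) (v : X * nat) : Prop :=
  (0 < pdeg f v)%N /\ forall w, (0 < pdeg f w)%N -> w = v \/ lt w v.

(* Elements of F have no leader: nothing is reduced with respect to them, and
   they are lower than every polynomial outside F. *)
Definition reduced (g f : dpoly F X) : Prop :=
  exists v, leader f v /\ forall l, (pdeg g (v.1, v.2 + l)%N < pdeg f v)%N.

Definition higher (g f : dpoly F X) : Prop :=
  exists v, leader g v /\
    forall w, leader f w -> lt w v \/ (w = v /\ (pdeg f v < pdeg g v)%N).

Definition ascending_chain (A : seq (dpoly F X)) : Prop :=
  (forall p, p \in A -> p <> 0) /\
  forall i j, (i < j < size A)%N ->
    higher A`_j A`_i /\ reduced A`_j A`_i.

Definition characteristic_set (I : dpoly F X -> Prop)
    (A : seq (dpoly F X)) : Prop :=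
  [/\ ascending_chain A, forall p, p \in A -> I p
    & forall p, I p -> p <> 0 -> ~ (forall a, a \in A -> reduced p a)].

End Ranking.
End DifferencePolynomials.

(* The difference homomorphism over F sending the indeterminate x to f x. *)
Definition dsubst (F : diffField) (X Y : choiceType) (f : X -> dpoly F Y) :
    dpoly F X -> dpoly F Y :=
  peval (@dconst F Y) (fun v : X * nat => iter v.2 (@dshift F Y) (f v.1)).

Section Transformal.
Variables (F : diffField) (L : diffExt F).

Definition dadjoin (S : L -> Prop) (x : L) : Prop :=
  forall E : L -> Prop, is_subfield E -> (forall y, E y -> E (sigma L y)) ->
    (forall a, E (ext_emb L a)) -> (forall s, S s -> E s) -> E x.

Definition transformally_indep (I : choiceType) (b : I -> L) : Prop :=
  alg_indep (ext_emb L) (fun v : I * nat => iter v.2 (sigma L) (b v.1)).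

Definition transformal_trdeg_is (E : L -> Prop) (d : nat) : Prop :=
  exists b : 'I_d -> L,
    [/\ forall i, E (b i), transformally_indep b
      & forall x, E x -> ~ transformally_indep (extend_family b x)].

End Transformal.

Section DimensionOrder.
Variables (F : diffField) (n : nat) (I : dpoly F 'I_n -> Prop).

Definition generic_zero (L : diffExt F) (eta : 'I_n -> L) : Prop :=
  forall p, deval eta p = 0 <-> I p.

Definition ideal_dim (d : nat) : Prop :=
  exists (L : diffExt F) (eta : 'I_n -> L), generic_zero eta /\
    transformal_trdeg_is (dadjoin (fun x => exists i, x = eta i)) d.

Definition transforms_upto (L : diffExt F) (eta : 'I_n -> L) (t : nat)
    (x : L) : Prop :=
  exists i k, (k <= t)%N /\ x = iter k (sigma L) (eta i).

Definition ideal_order (h : nat) : Prop :=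
  exists (d : nat) (L : diffExt F) (eta : 'I_n -> L),
    [/\ ideal_dim d, generic_zero eta
      & exists t0, forall t, (t0 <= t)%N ->
          trdeg_is (ext_emb L) (adjoin (ext_emb L) (transforms_upto eta t))
            (d * t.+1 + h)].

End DimensionOrder.

(* An algebraic closure of F(x_0, x_1, ...). *)
Record univ_domain (F : fieldType) := UnivDomain {
  ud_field :> closedFieldType;
  ud_emb : {rmorphism F -> ud_field};
  ud_var : nat -> ud_field;
  ud_indep : alg_indep ud_emb ud_var;
  ud_algebraic : forall z,
    algebraic_over (adjoin ud_emb (fun x => exists i, x = ud_var i)) z }.

(* A member of the universal system: a difference overfield of F whose
   underlying field is given with an F-embedding into U, that is, a difference
   field structure transported from a subfield of U. *)
Record univ_member (F : diffField) (U : univ_domain F) := UnivMember {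
  um_ext :> diffExt F;
  um_emb : {rmorphism um_ext -> U};
  um_embE : forall a, um_emb (ext_emb um_ext a) = ud_emb U a }.

Record dpoint (F : diffField) (U : univ_domain F) (n : nat) := DPoint {
  dp_field : univ_member U;
  dp_coord : 'I_n -> dp_field }.

Section Varieties.
Variables (F : diffField) (U : univ_domain F) (n : nat).
Implicit Types (V W : dpoint U n -> Prop) (x : dpoint U n).

Definition zeros (S : dpoly F 'I_n -> Prop) x : Prop :=
  forall p, S p -> deval (@dp_coord _ _ _ x) p = 0.

Definition difference_variety V : Prop :=
  exists S, forall x, V x <-> zeros S x.

Definition proper_subvariety W V : Prop :=
  [/\ difference_variety W, forall x, W x -> V x & exists x, V x /\ ~ W x].

Definition irreducible_variety V : Prop :=
  [/\ difference_variety V, exists x, V x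
    & ~ exists W1 W2, [/\ proper_subvariety W1 V, proper_subvariety W2 V
                        & forall x, V x <-> W1 x \/ W2 x]].

Definition vanishing_ideal V (p : dpoly F 'I_n) : Prop :=
  forall x, V x -> deval (@dp_coord _ _ _ x) p = 0.

Definition variety_dim V := ideal_dim (vanishing_ideal V).
Definition variety_order V := ideal_order (vanishing_ideal V).

End Varieties.

(* The coefficient u_ij is the indeterminate (i, j) : 'I_d.+1 * 'I_n.+1; in
   F{Y, u} the indeterminate y_j is inl (j - 1) and u_ij is inr (i, j). *)
Section ChowForm.
Variables (F : diffField) (U : univ_domain F) (n : nat).
Variables (V : dpoint U n -> Prop) (d : nat).

Definition Xu : choiceType := ('I_d.+1 * 'I_n.+1)%type.
Definition XYu : choiceType := ('I_n + Xu)%type.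

Definition generic_hyperplane (i : 'I_d.+1) : dpoly F XYu :=
  dvar F (inr (i, ord0) : XYu) 0 +
  \sum_(j < n) dvar F (inr (i, lift ord0 j) : XYu) 0 *
               dvar F (inl j : XYu) 0.

Definition chow_generators (p : dpoly F XYu) : Prop :=
  (exists2 q, vanishing_ideal V q &
     p = dsubst (fun j => dvar F (inl j : XYu) 0) q) \/
  (exists i, p = generic_hyperplane i).

Definition chow_ideal (p : dpoly F Xu) : Prop :=
  dideal_gen chow_generators (dsubst (fun u => dvar F (inr u : XYu) 0) p).

Definition is_chow_form (G : dpoly F Xu) : Prop :=
  ring_irreducible G /\
  exists (lt : rel (Xu * nat)) (A : seq (dpoly F Xu)),
    ranking lt /\ characteristic_set lt chow_ideal (G :: A).

End ChowForm.

(* The new indeterminate lambda is None; e lists the exponents of the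
   transforms of lambda in the difference monomial M(lambda). *)
Definition transformally_homogeneous (F : diffField) (X : choiceType)
    (B : pred X) (p : dpoly F X) : Prop :=
  let lambda k := dvar F (None : option X) k in
  let y x := dvar F (Some x : option X) 0 in
  exists e : seq nat,
    dsubst (fun x => if B x then lambda 0%N * y x else y x) p =
    (\prod_(k < size e) lambda k ^+ nth 0%N e k) * dsubst y p.

(* Main.v *)
(* Let eta be a generic zero of I(V).  Modulo the hyperplanes P_i one may
   substitute - Sum_j u_ij eta_j for u_i0, so the Chow ideal is the kernel of a
   difference homomorphism eps from F{u} to polynomials over F<eta>.  Let G be
   the Chow form.  By the choice of G in a characteristic set, compared with a
   kernel element of minimal order in u_00 by elimination and a count of
   transcendence degrees, a kernel element whose order in some indeterminate y
   of G is at most that of G is a multiple of G.  Now eps commutes with the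
   grading by the degree in the block u_i0^(k), ..., u_in^(k), so every
   homogeneous component of G is a multiple of G and G is homogeneous in each
   block; Euler's relation and transformal homogeneity follow.  For rho <> tau
   the polarization Sum_j u_tau,j^(k) dG/du_rho,j^(k) is again in the kernel,
   because eps intertwines the substitutions u_rho^(k) -> u_rho^(k) + t u_tau^(k);
   it is a multiple of G of smaller degree in the block of u_rho^(k), hence 0.
   Finally, the commutator of the two opposite polarizations is the difference of
   the Euler operators of the two blocks, so that r_k does not depend on the
   block. *)

(* The ranking in the definition of the Chow form is arbitrary, so the leader of G says nothing
   about its order in an indeterminate fixed beforehand. An auxiliary kernel element g, irreducible
   and of minimal order in u_00, makes up for this. Every nonzero kernel element involves u_00, and
   here the dimension enters: d coordinates of eta are transformally independent, and moving the
   u_ij with j >= 1 towards -1 or 0 turns the u_i0 with i >= 1 into these coordinates. Minimality of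
   the order then passes from u_00 to every indeterminate y of g, because the transforms of g trade
   transforms of u_00 for transforms of y. Comparing leaders shows that g divides G, so the two
   agree up to a unit. Divisibility rests on unique factorization: if an irreducible g containing a
   variable z does not divide p, a nonzero combination of g and p is free of z; when z is the
   highest transform of y in g, the order of that combination in y is too small. The degrees of
   different blocks are compared only as multiples of G, since Euler operators see them modulo the
   characteristic. *)
From HB Require Import structures.
Require Import Defs.
From mathcomp Require Import all_boot all_order all_algebra.
From mathcomp Require Import finmap boolp zify ring.
From mathcomp.multinomials Require Import monalg.

Set Implicit Arguments.
Unset Strict Implicit.
Unset Printing Implicit Defensive.

Import GRing.Theory.
Local Open Scope ring_scope.

(** * Polynomials in infinitely many variables *)

(* The ring operations of {malg R[K]} are transparent, and failed unification
   problems that unfold them do not terminate in reasonable time; mpol is an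
   isomorphic copy whose operations are locked. *)
Record mpol (R : comNzRingType) (Z : choiceType) :=
  Mpol { mpol_val : {malg R[{cmonom Z}]} }.

Section MpolRing.
Variables (R : comNzRingType) (Z : choiceType).
Implicit Types p q r : mpol R Z.

HB.instance Definition _ := [isNew for @mpol_val R Z].
HB.instance Definition _ := [Choice of mpol R Z by <:].

Lemma mpol_val_inj : injective (@mpol_val R Z).
Proof. exact: val_inj. Qed.
End MpolRing.

HB.lock Definition mpol_zero R Z : mpol R Z := Mpol 0.
HB.lock Definition mpol_one R Z : mpol R Z := Mpol 1.
HB.lock Definition mpol_opp R Z (p : mpol R Z) := Mpol (- mpol_val p).
HB.lock Definition mpol_add R Z (p q : mpol R Z) := Mpol (mpol_val p + mpol_val q).
HB.lock Definition mpol_mul R Z (p q : mpol R Z) := Mpol (mpol_val p * mpol_val q).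

Section MpolRingInstances.
Variables (R : comNzRingType) (Z : choiceType).
Implicit Types p q r : mpol R Z.

Lemma mpol_val0 : mpol_val (mpol_zero R Z) = 0.
Proof. by rewrite mpol_zero.unlock. Qed.
Lemma mpol_val1 : mpol_val (mpol_one R Z) = 1.
Proof. by rewrite mpol_one.unlock. Qed.
Lemma mpol_valN p : mpol_val (mpol_opp p) = - mpol_val p.
Proof. by rewrite mpol_opp.unlock. Qed.
Lemma mpol_valD p q : mpol_val (mpol_add p q) = mpol_val p + mpol_val q.
Proof. by rewrite mpol_add.unlock. Qed.
Lemma mpol_valM p q : mpol_val (mpol_mul p q) = mpol_val p * mpol_val q.
Proof. by rewrite mpol_mul.unlock. Qed.

Let valE := (mpol_val0, mpol_val1, mpol_valN, mpol_valD, mpol_valM).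

Fact mpol_addA : associative (@mpol_add R Z).
Proof. by move=> p q r; apply: mpol_val_inj; rewrite !valE addrA. Qed.
Fact mpol_addC : commutative (@mpol_add R Z).
Proof. by move=> p q; apply: mpol_val_inj; rewrite !valE addrC. Qed.
Fact mpol_add0 : left_id (mpol_zero R Z) (@mpol_add R Z).
Proof. by move=> p; apply: mpol_val_inj; rewrite !valE add0r. Qed.
Fact mpol_addN : left_inverse (mpol_zero R Z) (@mpol_opp R Z) (@mpol_add R Z).
Proof. by move=> p; apply: mpol_val_inj; rewrite !valE addNr. Qed.
HB.instance Definition _ :=
  GRing.isZmodule.Build (mpol R Z) mpol_addA mpol_addC mpol_add0 mpol_addN.

Fact mpol_mulA : associative (@mpol_mul R Z).
Proof. by move=> p q r; apply: mpol_val_inj; rewrite !valE mulrA. Qed.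
Fact mpol_mulC : commutative (@mpol_mul R Z).
Proof. by move=> p q; apply: mpol_val_inj; rewrite !valE mulrC. Qed.
Fact mpol_mul1 : left_id (mpol_one R Z) (@mpol_mul R Z).
Proof. by move=> p; apply: mpol_val_inj; rewrite !valE mul1r. Qed.
Fact mpol_mulD : left_distributive (@mpol_mul R Z) (@mpol_add R Z).
Proof. by move=> p q r; apply: mpol_val_inj; rewrite !valE mulrDl. Qed.
Fact mpol_oner_neq0 : mpol_one R Z != mpol_zero R Z.
Proof. by rewrite -(inj_eq (@mpol_val_inj R Z)) !valE oner_neq0. Qed.
HB.instance Definition _ := GRing.Zmodule_isComNzRing.Build (mpol R Z)
  mpol_mulA mpol_mulC mpol_mul1 mpol_mulD mpol_oner_neq0.

Fact mpol_val_zmod : zmod_morphism (@mpol_val R Z).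
Proof.
move=> p q; rewrite -mpol_valN -mpol_valD.
by [].
Qed.
HB.instance Definition _ :=
  GRing.isZmodMorphism.Build (mpol R Z) {malg R[{cmonom Z}]} (@mpol_val R Z)
    mpol_val_zmod.

Fact mpol_val_monoid : monoid_morphism (@mpol_val R Z).
Proof. by split=> [|p q]; [exact: mpol_val1|exact: mpol_valM]. Qed.
HB.instance Definition _ :=
  GRing.isMonoidMorphism.Build (mpol R Z) {malg R[{cmonom Z}]} (@mpol_val R Z)
    mpol_val_monoid.

Fact Mpol_zmod : zmod_morphism (@Mpol R Z).
Proof. by move=> p q; apply: mpol_val_inj; rewrite rmorphB. Qed.
HB.instance Definition _ :=
  GRing.isZmodMorphism.Build {malg R[{cmonom Z}]} (mpol R Z) (@Mpol R Z) Mpol_zmod.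

Fact Mpol_monoid : monoid_morphism (@Mpol R Z).
Proof. by split=> [|p q]; apply: mpol_val_inj; rewrite ?rmorph1 ?rmorphM. Qed.
HB.instance Definition _ :=
  GRing.isMonoidMorphism.Build {malg R[{cmonom Z}]} (mpol R Z) (@Mpol R Z)
    Mpol_monoid.
End MpolRingInstances.

HB.lock Definition mU (R : comNzRingType) (Z : choiceType) (m : {cmonom Z}) :
  mpol R Z := Mpol << m >>.
Arguments mU {R Z} m.

HB.lock Definition mX (R : comNzRingType) (Z : choiceType) (z : Z) : mpol R Z :=
  mU (ucm z).
Arguments mX {R Z} z.

HB.lock Definition mC (R : comNzRingType) (Z : choiceType) :
  {rmorphism R -> mpol R Z} := @Mpol R Z \o @malgC {cmonom Z} R.
Arguments mC {R Z}.

HB.lock Definition occurs (R : comNzRingType) (Z : choiceType)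
  (p : mpol R Z) (z : Z) : bool := (0 < pdeg (mpol_val p) z)%N.
Arguments occurs {R Z} p z.

Section Eval.
Variables (R : comNzRingType) (Z : choiceType).
Implicit Types (p q : mpol R Z) (m k l : {cmonom Z}).

Lemma occursP p z :
  reflect (exists2 m, m \in msupp (mpol_val p) & (m : {cmonom Z}) z != 0%N)
          (occurs p z).
Proof.
rewrite occurs.unlock /pdeg; apply: (iffP idP) => [|[m mp mz]].
  rewrite lt0n; apply: contraNP => np; apply/eqP.
  apply: big1_seq => m /= mp; apply/eqP/negPn/negP => mz; apply: np.
  by exists m.
by rewrite (leq_trans _ (leq_bigmax_seq _ mp _)) // lt0n.
Qed.

Lemma mCE a : mC a = Mpol (malgC a) :> mpol R Z.
Proof. by rewrite mC.unlock. Qed.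

Lemma mU_mul k l : mU k * mU l = mU (mmul k l) :> mpol R Z.
Proof.
rewrite !mU.unlock -rmorphM; congr Mpol; rewrite malgM_def fgmulUU.
by congr (mkmalgU _ _); apply: mulr1.
Qed.

Lemma mU1 : mU mone = 1 :> mpol R Z.
Proof. by rewrite mU.unlock; exact: (rmorph1 (@Mpol R Z)). Qed.

Lemma msupp_mU k : msupp (mpol_val (mU k : mpol R Z)) = [fset k]%fset.
Proof. by rewrite mU.unlock /= msuppU1. Qed.

Lemma mX_monom m : \prod_(z <- finsupp m) mX z ^+ m z = mU m :> mpol R Z.
Proof.
have E z n : exists2 k : {cmonom Z}, mX z ^+ n = mU k :> mpol R Z &
    forall i, k i = ((z == i) * n)%N.
  elim: n => [|n [k IH kE]].
    by exists mone => [|i]; rewrite ?expr0 ?mU1 // cm1 muln0.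
  exists (mmul (ucm z) k) => [|i].
    by rewrite exprS IH mX.unlock mU_mul.
  by rewrite cmM cmU kE mulnS.
suff [k -> kE] : exists2 k : {cmonom Z},
    \prod_(z <- finsupp m) mX z ^+ m z = mU k :> mpol R Z &
    forall i, k i = (\sum_(z <- finsupp m) ((z == i) * m z))%N.
  congr mU; apply/eqP/cmP => i; rewrite kE.
  case: (boolP (i \in finsupp m)) => im.
    rewrite (big_fsetD1 i) //= eqxx mul1n big1_seq ?addn0 // => z.
    by rewrite !inE => /andP[_ /andP[/negbTE-> _]].
  rewrite big1_seq; first by apply/esym/eqP; rewrite cmE_eq0.
  move=> z /andP[_ zm]; case: eqP => // zi; by rewrite -zi zm in im.
elim: (enum_fset (finsupp m)) => [|z s [k IH kE]].
  by exists mone => [|i]; rewrite ?big_nil ?mU1 // cm1.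
have [l lE lE'] := E z (m z).
exists (mmul l k) => [|i]; first by rewrite big_cons IH lE mU_mul.
by rewrite big_cons cmM lE' kE.
Qed.

Lemma mpolE p : p = \sum_(m <- msupp (mpol_val p)) mC ((mpol_val p)@_m) * mU m.
Proof.
have -> : p = Mpol (mpol_val p) by case: p.
rewrite {1}(monalgE (mpol_val p)) rmorph_sum /=; apply: eq_bigr => m _.
rewrite mCE mU.unlock -rmorphM; congr Mpol.
by rewrite malgM_def fgmulUU mul1m; congr (mkmalgU _ _); rewrite mulr1.
Qed.

(** [D] restricts the variable case to variables of [p]; taken as [occurs p], it gives bounds on the
    variables of images of [p]. *)
Lemma mpol_ind_in (D : Z -> Prop) (Q : mpol R Z -> Prop) :
  (forall a, Q (mC a)) -> (forall z, D z -> Q (mX z)) ->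
  (forall p q, Q p -> Q q -> Q (p + q)) ->
  (forall p q, Q p -> Q q -> Q (p * q)) ->
  forall p, (forall z, occurs p z -> D z) -> Q p.
Proof.
move=> QC QX QD QM p pD; have Q0 : Q 0 by rewrite -(rmorph0 (@mC R Z)).
have Q1 : Q 1 by rewrite -(rmorph1 (@mC R Z)).
have Qexp z n : Q (mX z) -> Q (mX z ^+ n).
  by move=> Qz; elim: n => [|n IH]; [rewrite expr0|rewrite exprS; apply: QM].
rewrite [p]mpolE big_seq; elim/big_rec: _ => // m q mp Qq.
apply: (QD) => //; apply: (QM) => //; rewrite -mX_monom big_seq.
elim/big_rec: _ => // z r zm Qr; apply: (QM) => //; apply/Qexp/QX/pD/occursP.
by exists m => //; rewrite cmE_neq0.
Qed.

Lemma mpol_ind (Q : mpol R Z -> Prop) :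
  (forall a, Q (mC a)) -> (forall z, Q (mX z)) ->
  (forall p q, Q p -> Q q -> Q (p + q)) ->
  (forall p q, Q p -> Q q -> Q (p * q)) ->
  forall p, Q p.
Proof. by move=> QC QX QD QM p; apply: (@mpol_ind_in (fun=> True)). Qed.

Lemma mC0 : mC 0 = 0 :> mpol R Z.
Proof. exact: rmorph0. Qed.

Lemma mCD a b : mC (a + b) = mC a + mC b :> mpol R Z.
Proof. exact: rmorphD. Qed.

Lemma mCM a b : mC (a * b) = mC a * mC b :> mpol R Z.
Proof. exact: rmorphM. Qed.

Lemma occursC a z : occurs (mC a : mpol R Z) z = false.
Proof.
rewrite mCE; apply/negP => /occursP[m]; move/(fsubsetP (msuppC_le _)).
by rewrite in_fset1 => /eqP->; rewrite cm1.
Qed.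

Lemma occurs0 z : occurs (0 : mpol R Z) z = false.
Proof. by rewrite -mC0 occursC. Qed.

Lemma occurs1 z : occurs (1 : mpol R Z) z = false.
Proof. by rewrite -(rmorph1 (@mC R Z)) occursC. Qed.

Lemma occursX z w : occurs (mX z : mpol R Z) w = (z == w).
Proof.
apply/occursP/eqP => [[m]|->].
  by rewrite mX.unlock msupp_mU in_fset1 => /eqP->; rewrite cmU eqb0 negbK => /eqP.
by exists (ucm w); rewrite ?mX.unlock ?msupp_mU ?in_fset1 ?cmUU.
Qed.

Lemma occursD p q z : occurs (p + q) z -> occurs p z || occurs q z.
Proof.
move=> /occursP[m]; rewrite rmorphD => /(fsubsetP (msuppD_le _ _)); rewrite in_fsetU.
by case/orP => mp mz; apply/orP; [left|right]; apply/occursP; exists m.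
Qed.

Lemma occursM p q z : occurs (p * q) z -> occurs p z || occurs q z.
Proof.
move=> /occursP[m]; rewrite rmorphM => /msuppM_le[k [l [kp lq ->]]].
rewrite cmM addn_eq0 negb_and.
by case/orP => mz; apply/orP; [left; apply/occursP; exists k|
  right; apply/occursP; exists l].
Qed.

Lemma occursN p z : occurs (- p) z = occurs p z.
Proof. by rewrite !occurs.unlock /pdeg rmorphN msuppN. Qed.

Lemma finite_occurs p : exists s : seq Z, forall z, occurs p z -> z \in s.
Proof.
elim/mpol_ind: p => [a|z|p q [s sp] [t tq]|p q [s sp] [t tq]].
- by exists [::] => z; rewrite occursC.
- by exists [:: z] => w; rewrite occursX inE eq_sym.
- exists (s ++ t) => z /occursD; rewrite mem_cat.
  by case/orP => [/sp->|/tq->]; rewrite ?orbT.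
- exists (s ++ t) => z /occursM; rewrite mem_cat.
  by case/orP => [/sp->|/tq->]; rewrite ?orbT.
Qed.

Lemma not_occurs_const p : (forall z, ~~ occurs p z) -> exists a, p = mC a.
Proof.
move=> np; have : forall z, occurs p z -> False by move=> z; apply/negP.
apply: (mpol_ind_in (D := fun=> False) (Q := fun p => exists a, p = mC a)) => //.
- by move=> a; exists a.
- by move=> _ _ [a ->] [b ->]; exists (a + b); rewrite mCD.
- by move=> _ _ [a ->] [b ->]; exists (a * b); rewrite mCM.
Qed.

End Eval.

Section EvalMorphism.
Variables (R S : comNzRingType) (Z : choiceType).

Section Def.
Variables (c : {rmorphism R -> S}) (g : Z -> S).

Definition meval_monom (m : {cmonom Z}) : S := \prod_(z <- finsupp m) g z ^+ m z.

Lemma meval_monom_mmorphism : mmorphism meval_monom.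
Proof.
split=> [m1 m2|]; last by rewrite /meval_monom mdom1 big_nil.
rewrite /meval_monom.
have E (m : {cmonom Z}) (s : {fset Z}) : (finsupp m `<=` s)%fset ->
    \prod_(z <- finsupp m) g z ^+ m z = \prod_(z <- s) g z ^+ m z.
  move=> ms; apply: big_fset_incl => // z _; rewrite -cmE_eq0 => /eqP->.
  by rewrite expr0.
rewrite (E m1 (finsupp (mmul m1 m2))) ?(E m2 (finsupp (mmul m1 m2))) -?big_split /=.
- by apply: eq_bigr => z _; rewrite cmM exprD.
- by rewrite mdomD fsubsetUr.
- by rewrite mdomD fsubsetUl.
Qed.

HB.instance Definition _ :=
  isMultiplicative.Build _ _ meval_monom meval_monom_mmorphism.

HB.instance Definition _ := GRing.RMorphism.copy (peval c g) (mmap c meval_monom).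
End Def.
End EvalMorphism.

HB.lock Definition mev (R S : comNzRingType) (Z : choiceType)
  (c : {rmorphism R -> S}) (g : Z -> S) : {rmorphism mpol R Z -> S} :=
  peval c g \o @mpol_val R Z.
Arguments mev {R S Z} c g.

Section EvalTheory.
Variables (R S : comNzRingType) (Z : choiceType).
Implicit Types (c : {rmorphism R -> S}) (g : Z -> S).

Lemma mevE c g p : mev c g p = peval c g (mpol_val p).
Proof. by rewrite mev.unlock. Qed.

Lemma mevU c g (m : {cmonom Z}) : mev c g (mU m) = \prod_(z <- finsupp m) g z ^+ m z.
Proof. by rewrite mevE mU.unlock /= /peval mmapU /= rmorph1 mul1r. Qed.

Lemma mevC c g a : mev c g (mC a) = c a.
Proof. by rewrite mevE mCE /= /peval mmapU mdom1 big_nil mulr1. Qed.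

Lemma mevX c g z : mev c g (mX z) = g z.
Proof. by rewrite mX.unlock mevU mdomU big_seq_fset1 cmUU expr1. Qed.

Lemma mpol_hom_eq_in (f h : {rmorphism mpol R Z -> S}) p :
  (forall a, f (mC a) = h (mC a)) ->
  (forall z, occurs p z -> f (mX z) = h (mX z)) -> f p = h p.
Proof.
move=> fhC; apply: (mpol_ind_in (D := fun z => f (mX z) = h (mX z))
  (Q := fun p => f p = h p)) => //.
- by move=> q r fq fr; rewrite !rmorphD fq fr.
- by move=> q r fq fr; rewrite !rmorphM fq fr.
Qed.

Lemma mpol_hom_eq (f h : {rmorphism mpol R Z -> S}) :
  (forall a, f (mC a) = h (mC a)) ->
  (forall z, f (mX z) = h (mX z)) -> f =1 h.
Proof. by move=> fhC fhX p; apply: mpol_hom_eq_in. Qed.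

End EvalTheory.

(** * Reduction to iterated univariate polynomials *)

Section IteratedPolynomials.
Variables (F : fieldType) (Z : choiceType).

(** F[z_1]...[z_k], built one variable at a time so that the theory of univariate polynomials over a
    domain applies. Statements about finitely many elements of [mpol F Z] are transported here along
    a list of their variables. *)
Fixpoint ipoly (k : nat) : idomainType :=
  if k is k'.+1 then {poly (ipoly k')} : idomainType else F : idomainType.

Fixpoint iconst (k : nat) : {rmorphism F -> ipoly k} :=
  if k is k'.+1 then polyC \o iconst k' : {rmorphism F -> {poly ipoly k'}}
  else idfun : {rmorphism F -> F}.

(** The default 0 for variables outside [s] is harmless: [to_ipoly s] is only applied to polynomials
    with all variables in [s]. *)
Fixpoint ivar (s : seq Z) (x : Z) : ipoly (size s) :=
  if s is z :: s' then (if x == z then 'X else (ivar s' x)%:P) : {poly ipoly (size s')}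
  else (0 : F).

Fixpoint of_ipoly (s : seq Z) : {rmorphism ipoly (size s) -> mpol F Z} :=
  if s is z :: s' then
    horner_eval (mX z) \o map_poly (of_ipoly s')
      : {rmorphism {poly ipoly (size s')} -> mpol F Z}
  else @mC F Z : {rmorphism F -> mpol F Z}.

Definition to_ipoly (s : seq Z) : {rmorphism mpol F Z -> ipoly (size s)} :=
  mev (iconst (size s)) (ivar s).

Lemma of_ipoly_const s a : of_ipoly s (iconst (size s) a) = mC a.
Proof.
elim: s => //= z s IH.
by rewrite map_polyC /horner_eval hornerC; exact: IH.
Qed.

Lemma of_ipoly_var s x : x \in s -> of_ipoly s (ivar s x) = mX x.
Proof.
elim: s => //= z s IH; rewrite inE; case: eqP => [->|_ /IH xs].
  by rewrite map_polyX /horner_eval hornerX.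
by rewrite map_polyC /horner_eval hornerC; exact: xs.
Qed.

Lemma to_ipolyK s p : (forall z, occurs p z -> z \in s) -> of_ipoly s (to_ipoly s p) = p.
Proof.
move=> ps; have := @mpol_hom_eq_in _ _ _ (of_ipoly s \o to_ipoly s) idfun p.
apply => [a|z /ps zs] /=; rewrite /to_ipoly /=.
  by rewrite mevC of_ipoly_const.
by rewrite mevX of_ipoly_var.
Qed.

Lemma of_ipoly_agree (S : comNzRingType) s (f g : {rmorphism mpol F Z -> S}) :
  (forall a, f (mC a) = g (mC a)) ->
  (forall z, z \in s -> f (mX z) = g (mX z)) ->
  forall P, f (of_ipoly s P) = g (of_ipoly s P).
Proof.
move=> fgC; elim: s => [|z s IH] fgX P; first exact: fgC.
rewrite /= /horner_eval horner_poly !rmorph_sum; apply: eq_bigr => i _.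
by rewrite !rmorphM !rmorphXn /= fgX ?mem_head // IH // => y ys;
   apply: fgX; rewrite inE ys orbT.
Qed.

(** A repeated variable in [s] would identify two independent indeterminates of the iterated
    ring. *)
Lemma of_ipolyK s : uniq s -> cancel (of_ipoly s) (to_ipoly s).
Proof.
elim: s => [|z s IH] /=; first by move=> _ P; rewrite /to_ipoly /= mevC.
case/andP => zs us P; rewrite /= /horner_eval horner_poly rmorph_sum /=.
rewrite [RHS](_ : P = \sum_(i < size P) (P`_i)%:P * 'X^i); last first.
  by rewrite -[LHS]coefK poly_def; apply: eq_bigr => i _; rewrite mul_polyC.
apply: eq_bigr => i _; rewrite rmorphM rmorphXn /=.
congr (_ * _ ^+ _); last by rewrite /to_ipoly /= mevX /= eqxx.
apply: etrans (congr1 polyC (IH us _)).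
apply: (@of_ipoly_agree _ s (to_ipoly (z :: s)) (polyC \o to_ipoly s)) => [a|x xs].
  by rewrite /to_ipoly /= !mevC.
by rewrite /to_ipoly /= !mevX /=; case: eqP xs zs => // -> ->.
Qed.

Lemma of_ipoly_occurs s P z : occurs (of_ipoly s P) z -> z \in s.
Proof.
elim: s P z => [|y s IH] P z.
  by move=> /=; rewrite (occursC (Z := Z) (P : F)).
rewrite /= /horner_eval horner_poly.
elim/big_rec: _ => [|i p _ IHp]; first by rewrite occurs0.
case/occursD/orP => [/occursM/orP[/IH|]|/IHp//]; first by rewrite inE orbC => ->.
rewrite inE; elim: (i : nat) => [|j IHj]; first by rewrite expr0 occurs1.
by rewrite exprS => /occursM/orP[|//]; rewrite occursX eq_sym => ->.
Qed.

Lemma finite_support2 (p q : mpol F Z) : exists s : seq Z,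
  [/\ uniq s, forall z, occurs p z -> z \in s & forall z, occurs q z -> z \in s].
Proof.
have [s sp] := finite_occurs p; have [t tq] := finite_occurs q.
by exists (undup (s ++ t)); split=> [|z /sp zs|z /tq zt];
   rewrite ?undup_uniq // mem_undup mem_cat ?zs ?zt ?orbT.
Qed.

Lemma mpol_mulf_eq0 (p q : mpol F Z) : p * q = 0 -> (p == 0) || (q == 0).
Proof.
have [s [us sp sq]] := finite_support2 p q => /(congr1 (to_ipoly s)).
rewrite rmorphM rmorph0 => /eqP; rewrite mulf_eq0.
by case/orP => /eqP e; apply/orP; [left; rewrite -(to_ipolyK sp)|
  right; rewrite -(to_ipolyK sq)]; rewrite e rmorph0.
Qed.

End IteratedPolynomials.

Section UnitRing.
Variables (F : fieldType) (Z : choiceType).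

Definition mpol_unit : pred (mpol F Z) := fun p => `[< exists q, q * p = 1 >].

Definition mpol_inv (p : mpol F Z) : mpol F Z :=
  if pselect (exists q, q * p = 1) is left e then projT1 (cid e) else p.

Lemma mpol_mulVr : {in mpol_unit, left_inverse 1 mpol_inv *%R}.
Proof.
move=> p; rewrite /mpol_inv unfold_in => /asboolP ep.
by case: pselect => // e; case: cid.
Qed.

Lemma mpol_unitP (p q : mpol F Z) : q * p = 1 -> mpol_unit p.
Proof. by move=> qp; apply/asboolP; exists q. Qed.

Lemma mpol_inv_out : {in [predC mpol_unit], mpol_inv =1 id}.
Proof.
move=> p; rewrite /mpol_inv inE unfold_in => /asboolP ep.
by case: pselect.
Qed.

HB.instance Definition _ := GRing.ComNzRing_hasMulInverse.Build
  (mpol F Z) mpol_mulVr mpol_unitP mpol_inv_out.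

HB.instance Definition _ := GRing.ComUnitRing_isIntegral.Build
  (mpol F Z) (@mpol_mulf_eq0 F Z).

End UnitRing.

(** * Unique factorization *)

Section Factorization.
Implicit Type R : idomainType.

Definition dvdr R (x y : R) : Prop := exists z, y = z * x.

Definition prime_elt R (x : R) : Prop :=
  [/\ x != 0, x \isn't a GRing.unit
    & forall a b, dvdr x (a * b) -> dvdr x a \/ dvdr x b].

Definition irreducible_elt R (x : R) : Prop :=
  x \isn't a GRing.unit /\
  forall a b, x = a * b -> a \is a GRing.unit \/ b \is a GRing.unit.

(** Existence of factorizations into primes, rather than into irreducibles: uniqueness is then
    automatic, and Gauss's argument carries this form from R to R[X]. *)
Definition factorial R : Prop := forall c : R, c != 0 ->
  exists u s, [/\ u \is a GRing.unit, forall x, x \in s -> prime_elt x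
                & c = u * \prod_(x <- s) x].

Lemma factorial_field (F : fieldType) : factorial F.
Proof. by move=> c c0; exists c, [::]; rewrite unitfE c0 big_nil mulr1. Qed.

Lemma dvdr_mull R (x y z : R) : dvdr x z -> dvdr x (y * z).
Proof. by case=> w ->; exists (y * w); rewrite mulrA. Qed.

Lemma dvdr_mulr R (x y z : R) : dvdr x y -> dvdr x (y * z).
Proof. by rewrite mulrC; apply: dvdr_mull. Qed.

Lemma dvdrD R (x y z : R) : dvdr x y -> dvdr x z -> dvdr x (y + z).
Proof. by move=> [a ->] [b ->]; exists (a + b); rewrite mulrDl. Qed.

Lemma dvdrN R (x y : R) : dvdr x y -> dvdr x (- y).
Proof. by move=> [a ->]; exists (- a); rewrite mulNr. Qed.

Lemma dvdr_trans R (x y z : R) : dvdr x y -> dvdr y z -> dvdr x z.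
Proof. by move=> xy [a ->]; apply: dvdr_mull. Qed.

Lemma dvdr_sum R (x : R) (I : Type) (r : seq I) (P : pred I) (f : I -> R) :
  (forall i, P i -> dvdr x (f i)) -> dvdr x (\sum_(i <- r | P i) f i).
Proof.
move=> xf; apply: (big_ind (dvdr x)) => //; first by exists 0; rewrite mul0r.
exact: dvdrD.
Qed.

Lemma dvdr_unit R (x y : R) : dvdr x y -> y \is a GRing.unit -> x \is a GRing.unit.
Proof. by case=> z ->; rewrite unitrM => /andP[]. Qed.

Lemma dvdr_prod R (x : R) (s : seq R) : prime_elt x ->
  dvdr x (\prod_(y <- s) y) -> exists2 y, y \in s & dvdr x y.
Proof.
case=> _ xu xp; elim: s => [|y s IH].
  by rewrite big_nil => /dvdr_unit; rewrite unitr1 => /(_ isT); rewrite (negbTE xu).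
rewrite big_cons => /xp[xy|/IH[z zs xz]]; first by exists y; rewrite ?mem_head.
by exists z; rewrite // inE zs orbT.
Qed.

Section PolyFactorial.
Variable R : idomainType.
Implicit Types p q f g : {poly R}.

Lemma dvdr_polyCP (x : R) p : dvdr x%:P p <-> forall i, dvdr x p`_i.
Proof.
split=> [[q -> i]|xp]; first by exists q`_i; rewrite coefMC.
rewrite -[p]coefK poly_def; apply: dvdr_sum => i _; have [z ->] := xp i.
by exists (z *: 'X^i); rewrite [RHS]mulrC mul_polyC scalerA mulrC.
Qed.

(** Gauss's lemma: if [x] divides neither [p] nor [q], take in each the first coefficient that it
    does not divide; in the coefficient of the product at the sum of their indices, every other term
    is a multiple of [x]. *)
Lemma prime_polyC (x : R) : prime_elt x -> prime_elt x%:P.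
Proof.
case=> x0 xu xp; split; first by rewrite polyC_eq0.
  by rewrite poly_unitE size_polyC x0 coefC.
move=> p q xpq; apply: contrapT => /not_orP[np nq].
have E r : ~ dvdr x%:P r -> exists i, ~ dvdr x r`_i /\
    forall j, (j < i)%N -> dvdr x r`_j.
  move=> nr; have ei : exists i, `[< ~ dvdr x r`_i >].
    apply: contrapT => ni; apply: nr; apply/dvdr_polyCP => i.
    by apply: contrapT => nd; apply: ni; exists i; apply/asboolP.
  case: (ex_minnP ei) => i /asboolP xi imin; exists i; split=> // j ji.
  by apply: contrapT => /asboolP /imin; rewrite leqNgt ji.
have [i [xpi ip]] := E _ np; have [j [xqj jq]] := E _ nq.
move/dvdr_polyCP/(_ (i + j)%N): xpq; rewrite coefM.
have ij : (i < (i + j).+1)%N by rewrite ltnS leq_addr.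
rewrite (bigD1 (Ordinal ij)) //= addKn => xsum.
suff : dvdr x (p`_i * q`_j) by case/xp.
rewrite -[X in dvdr x X](addrK (\sum_(k < (i + j).+1 | k != Ordinal ij)
  p`_k * q`_(i + j - k))); apply: dvdrD => //; apply/dvdrN/dvdr_sum => k ki.
have {ki} : (k : nat) != i by apply: contraNN ki => /eqP e; apply/eqP/val_inj.
rewrite neq_ltn => /orP[/ip xpk|ik]; first exact: dvdr_mulr.
by apply/dvdr_mull/jq; have := ltn_ord k; lia.
Qed.

Definition primitive f : Prop := forall x, prime_elt x -> ~ dvdr x%:P f.

(** Each prime of [s] divides [q * f] but not the primitive [f], so it can be cancelled from [q]. *)
Lemma primitive_cancel f (s : seq R) p q : primitive f ->
  (forall x, x \in s -> prime_elt x) ->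
  (\prod_(x <- s) x)%:P * p = q * f -> dvdr f p.
Proof.
move=> pf; elim: s p q => [|x s IH] p q sp.
  by rewrite big_nil mul1r => ->; exists q.
have xp : prime_elt x by apply: sp; rewrite mem_head.
rewrite big_cons rmorphM /= -mulrA => e.
have : dvdr x%:P (q * f) by rewrite -e; apply: dvdr_mulr; exists 1; rewrite mul1r.
case: (prime_polyC xp) => x0 _ /[apply] -[[r qr]|/(pf _ xp)//].
apply: (IH _ r) => [y ys|]; first by apply: sp; rewrite inE ys orbT.
by apply: (mulfI x0); rewrite e qr mulrA [r * _]mulrC.
Qed.

(** Each prime of [s] divides [p] or [q]; dividing it out there does not change the degree. *)
Lemma transfer_primes (s : seq R) f p q : f != 0 ->
  (forall x, x \in s -> prime_elt x) ->
  (\prod_(x <- s) x)%:P * f = p * q ->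
  exists p' q', [/\ f = p' * q', size p' = size p & size q' = size q].
Proof.
move=> f0; elim: s p q => [|x s IH] p q sp.
  by rewrite big_nil mul1r => ->; exists p, q.
have xp : prime_elt x by apply: sp; rewrite mem_head.
have [x0 _ xpq] := prime_polyC xp.
have szx r : size (r * x%:P) = size r.
  by rewrite mulrC size_Cmul // -polyC_eq0.
rewrite big_cons rmorphM /= -mulrA => e.
have : dvdr x%:P (p * q) by rewrite -e; apply: dvdr_mulr; exists 1; rewrite mul1r.
have sp' y : y \in s -> prime_elt y by move=> ys; apply: sp; rewrite inE ys orbT.
case/xpq => -[r rE].
  have [|p' [q' [fE s1 s2]]] := IH r q sp'.
    by apply: (mulfI x0); rewrite e rE mulrA [r * _]mulrC.
  by exists p', q'; split; rewrite // s1 rE szx.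
have [|p' [q' [fE s1 s2]]] := IH p r sp'.
  by apply: (mulfI x0); rewrite e rE mulrA mulrC.
by exists p', q'; split; rewrite // s2 rE szx.
Qed.

Lemma irreducible_primitive f :
  (1 < size f)%N -> irreducible_elt f -> primitive f.
Proof.
move=> sf [_ fi] x xp [g fE]; have [x0 xu _] := prime_polyC xp.
case: (fi _ _ fE) => [|xU]; last by rewrite xU in xu.
rewrite poly_unitE => /andP[/eqP sg _]; move: sf.
by rewrite fE mulrC size_Cmul ?sg // -polyC_eq0.
Qed.

Hypothesis factR : factorial R.

Lemma primitive_cancelZ f (c : R) p q :
  primitive f -> c != 0 -> c *: p = q * f -> dvdr f p.
Proof.
move=> pf c0; have [u [s [uu sp ->]]] := factR c0 => e.
apply: (primitive_cancel (s := s) (q := u^-1 *: q)) => //.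
by rewrite -scalerAl -e !scalerA -mul_polyC mulKr.
Qed.

(** If [f] and [p] are coprime over the fraction field, a Bezout identity with cleared denominators
    gives the constant. Otherwise the irreducible [f] is, up to constants, their gcd, and
    primitivity turns divisibility up to constants into divisibility. *)
Lemma irreducible_dichotomy f p : (1 < size f)%N -> irreducible_elt f ->
  dvdr f p \/ exists A B c, c != 0 /\ A * f + B * p = c%:P.
Proof.
move=> sf fi; have f0 : f != 0 by rewrite -size_poly_gt0 ltnW.
have [cp|ncp] := boolP (coprimep f p).
  right; have /Bezout_coprimepP[[A B] /= e] := cp.
  move: e; rewrite eqp_sym => /eqp_size; rewrite size_poly1 => /esym/eqP.
  by case/size_poly1P => c c0 cE; exists A, B, c.
left; have /Pdiv.Idomain.dvdpP[[c s] /= c0 e] := dvdp_gcdl f p.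
set g := gcdp f p in e ncp.
have [u [t [uu tp cE]]] := factR c0.
have [|s' [g' [fE ss sg]]] := @transfer_primes t f (u^-1 *: s) g f0 tp.
  by rewrite -scalerAl -e scalerA -mul_polyC cE mulKr.
have uV : u^-1 \is a GRing.unit by rewrite unitrV.
have {}ss : size s' = size s by rewrite ss size_scale //; apply: contraTneq uV => ->; rewrite unitr0.
have sf1 : size s' = 1%N.
  case: (fi.2 _ _ fE); rewrite poly_unitE => /andP[/eqP // sg1 _].
  by move: ncp; rewrite coprimep_def -sg -/g sg1.
have /size_poly1P[s0 s00 s0E] : size s == 1%N by rewrite -ss sf1.
have /Pdiv.Idomain.dvdpP[[c' q] /= c'0 e'] := dvdp_gcdr f p.
apply: (@primitive_cancelZ f (s0 * c') p (c *: q)).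
- exact: irreducible_primitive.
- by rewrite mulf_neq0.
- have -> : (c *: q) * f = q * (c *: f) by rewrite -scalerAl scalerAr.
  by rewrite e s0E mul_polyC -scalerAr -e' scalerA.
Qed.

(** Multiply the Bezout identity for [f] and [a] by [b]: the constant times [b] is a multiple of the
    primitive [f]. *)
Lemma irreducible_prime f : (1 < size f)%N -> irreducible_elt f -> prime_elt f.
Proof.
move=> sf fi; have f0 : f != 0 by rewrite -size_poly_gt0 ltnW.
split=> // [|a b [g e]]; first by have [] := fi.
case: (irreducible_dichotomy a sf fi) => [|[A [B [c [c0 cE]]]]]; first by left.
right; apply: (@primitive_cancelZ f c b (A * b + B * g)) => //.
  exact: irreducible_primitive.
by rewrite -mul_polyC -cE !mulrDl -[B * a * b]mulrA e; congr (_ + _); rewrite ?mulrA // mulrAC.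
Qed.

(** The content is extracted without gcds in R: the primes of the leading coefficient are tried in
    turn. Those dividing [f] are pulled out, the others are kept in [t]. *)
Lemma extract_content f (s t : seq R) (u : R) : f != 0 ->
  u \is a GRing.unit ->
  (forall x, x \in s -> prime_elt x) ->
  (forall x, x \in t -> prime_elt x /\ ~ dvdr x%:P f) ->
  lead_coef f = u * (\prod_(x <- s) x) * \prod_(x <- t) x ->
  exists r g, [/\ forall x, x \in r -> prime_elt x, primitive g
                & f = (\prod_(x <- r) x)%:P * g].
Proof.
elim: s f t => [|y s IH] f t f0 uu sp tp.
  rewrite big_nil mulr1 => lf; exists [::], f; split=> //.
    move=> x xp xf; have [x0 xu _] := xp.
    (* A prime [x] dividing [f] divides some [z] in [t]. As [z] is prime, either [x] is a unit or
       [z] divides [x], hence [f]; both are excluded. *)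
    have : dvdr x (lead_coef f) by move/dvdr_polyCP: xf; apply.
    case: xp => _ _ xp /[dup] xlf; rewrite lf => /xp[/dvdr_unit/(_ uu)|].
      by rewrite (negbTE xu).
    case/(dvdr_prod (And3 x0 xu xp)) => z /tp[[z0 zu zp] nzf] [w zE].
    apply: nzf; have : dvdr z (w * x) by exists 1; rewrite -zE mul1r.
    case/zp => [[v wE]|[v xE]].
      case/negP: xu; apply: (@dvdr_unit _ _ 1) => //; last exact: unitr1.
      exists v; apply: (mulfI z0).
      by rewrite mulr1 {1}zE wE mulrAC mulrC.
    by case: xf => q ->; exists (q * v%:P); rewrite -mulrA -rmorphM /= -xE.
  by rewrite big_nil mul1r.
have yp : prime_elt y by apply: sp; rewrite mem_head.
have sp' x : x \in s -> prime_elt x by move=> xs; apply: sp; rewrite inE xs orbT.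
rewrite big_cons => lf.
have [[g fE]|nyf] := pselect (dvdr y%:P f); last first.
  apply: (IH f (y :: t)) => // [x|]; last by rewrite lf big_cons !mulrA; congr (_ * _); rewrite mulrAC.
  by rewrite inE => /predU1P[-> //|/tp].
have [y0 _ _] := yp.
have [|x /tp[xp nxf]||r [h [rp hp gE]]] := IH g t _ uu sp'.
- by apply: contraNneq f0 => g0; rewrite fE g0 mul0r.
- split=> // xg; apply: nxf; rewrite fE; exact: dvdr_mulr.
- apply: (mulfI y0); rewrite -(_ : lead_coef f = y * lead_coef g).
    by rewrite lf; rewrite -!mulrA mulrCA.
  by rewrite fE lead_coefM lead_coefC mulrC.
exists (y :: r), h; split=> //; first by move=> x; rewrite inE => /predU1P[->|/rp].
by rewrite big_cons rmorphM /= -mulrA -gE mulrC.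
Qed.

Lemma factorial_mul f g :
  (exists u s, [/\ u \is a GRing.unit, forall x, x \in s -> prime_elt x
                & f = u * \prod_(x <- s) x]) ->
  (exists u s, [/\ u \is a GRing.unit, forall x, x \in s -> prime_elt x
                & g = u * \prod_(x <- s) x]) ->
  exists u s, [/\ u \is a GRing.unit, forall x, x \in s -> prime_elt x
                & f * g = u * \prod_(x <- s) x].
Proof.
move=> [u [s [uu sp ->]]] [v [t [vu tp ->]]]; exists (u * v), (s ++ t).
split; first by rewrite unitrM uu.
  by move=> x; rewrite mem_cat => /orP[/sp|/tp].
by rewrite big_cat /= mulrACA.
Qed.

Lemma factorial_primes (r : seq R) : (forall x, x \in r -> prime_elt x) ->
  exists u s, [/\ u \is a GRing.unit, forall x, x \in s -> prime_elt x
    & (\prod_(x <- r) x)%:P = u * \prod_(x <- s) x].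
Proof.
move=> rp; exists 1, (map polyC r); split; first exact: unitr1.
  by move=> _ /mapP[x /rp xp ->]; apply: prime_polyC.
by rewrite mul1r big_map rmorph_prod.
Qed.

(** Induction on the degree: constant factors of a primitive polynomial are units, so in a
    factorization into nonunits both degrees drop. *)
Lemma primitive_factor n f : (size f <= n)%N -> f != 0 -> primitive f ->
  exists u s, [/\ u \is a GRing.unit, forall x, x \in s -> prime_elt x
                & f = u * \prod_(x <- s) x].
Proof.
elim: n f => [|n IH] f sf f0 fp; first by rewrite leqn0 size_poly_eq0 (negbTE f0) in sf.
have [fu|fnu] := boolP (f \is a GRing.unit).
  by exists f, [::]; rewrite big_nil mulr1.
have nocst c g : dvdr g f -> size g = 1%N -> c = g -> c \is a GRing.unit.
  move=> gf /eqP/size_poly1P[c0 c00 gE] ->; have [u [s [uu sp c0E]]] := factR c00.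
  case: s sp c0E => [|x s] sp c0E.
    by rewrite gE c0E big_nil mulr1 rmorph_unit.
  case: (fp x (sp x (mem_head _ _))); apply: dvdr_trans gf; rewrite gE c0E.
  by rewrite big_cons mulrCA rmorphM /=; apply: dvdr_mulr; exists 1; rewrite mul1r.
have [fi|nfi] := pselect (irreducible_elt f).
  exists 1, [:: f]; split; [exact: unitr1| |by rewrite mul1r big_seq1].
  move=> x; rewrite inE => /eqP->; apply: irreducible_prime => //.
  rewrite ltn_neqAle size_poly_gt0 f0 andbT eq_sym; apply: contraNneq fnu => s1.
  by apply: (nocst f f) => //; exists 1; rewrite mul1r.
have [a [b [fE au bu]]] : exists a b, [/\ f = a * b, a \isn't a GRing.unit & b \isn't a GRing.unit].
  apply: contrapT => nab; apply: nfi; split=> // a b fE.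
  have [|au] := boolP (a \is a GRing.unit); first by left.
  have [|bu] := boolP (b \is a GRing.unit); first by right.
  by case: nab; exists a, b.
have [a0 b0] : a != 0 /\ b != 0 by apply/andP; rewrite -negb_or -mulf_eq0 -fE.
have af : dvdr a f by exists b; rewrite mulrC.
have bf : dvdr b f by exists a.
have sa1 : (1 < size a)%N.
  rewrite ltn_neqAle size_poly_gt0 a0 andbT eq_sym; apply: contraNneq au => s1.
  exact: (nocst a a).
have sb1 : (1 < size b)%N.
  rewrite ltn_neqAle size_poly_gt0 b0 andbT eq_sym; apply: contraNneq bu => s1.
  exact: (nocst b b).
have sfE : size f = (size a + size b).-1 by rewrite fE size_mul.
rewrite fE; apply: factorial_mul; apply: IH => //; try lia.
- by move=> x xp xa; apply: (fp x xp); apply: dvdr_trans af.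
- by move=> x xp xb; apply: (fp x xp); apply: dvdr_trans bf.
Qed.

Theorem factorial_poly : factorial {poly R}.
Proof.
move=> f f0; have lf : lead_coef f != 0 by rewrite lead_coef_eq0.
have [u [s [uu sp e]]] := factR lf.
have [||r [g [rp gp fE]]] := @extract_content f s [::] u f0 uu sp.
- by [].
- by rewrite big_nil mulr1.
have g0 : g != 0 by apply: contraNneq f0 => g0; rewrite fE g0 mulr0.
rewrite fE; apply: factorial_mul; first exact: factorial_primes.
exact: (@primitive_factor (size g)).
Qed.

End PolyFactorial.

Lemma factorial_ipoly (F : fieldType) k : factorial (ipoly F k).
Proof.
elim: k => [|k IH]; first exact: factorial_field.
exact: factorial_poly.
Qed.

End Factorization.

(** * Univariate views, weights and elimination of a variable *)

Section SizeMul.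
Variable R : idomainType.
Implicit Types f g : {poly R}.

Lemma predn_size_mul f g : f != 0 -> g != 0 ->
  (size (f * g)%R).-1 = ((size f).-1 + (size g).-1)%N.
Proof. by move=> f0 g0; rewrite size_mul //; move: f0 g0; rewrite -!size_poly_gt0; lia. Qed.

Lemma size_mul_gt1 f g : f != 0 -> g != 0 ->
  (1 < size (f * g)%R)%N = (1 < size f)%N || (1 < size g)%N.
Proof. by move=> f0 g0; rewrite size_mul //; move: f0 g0; rewrite -!size_poly_gt0; lia. Qed.

End SizeMul.

(** [p] as a polynomial in [z]. The coefficients remain in [mpol F Z], which avoids a separate ring
    in the remaining variables; [upoly_coef_occurs] says that they are free of [z]. *)
HB.lock Definition upoly (F : fieldType) (Z : choiceType) (z : Z) :
  {rmorphism mpol F Z -> {poly mpol F Z}} :=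
  mev (polyC \o @mC F Z) (fun w => if w == z then 'X else (mX w)%:P).
Arguments upoly {F Z} z.

(** The grading with weights [w]: the coefficient of 'X^e is the component of weight e. *)
HB.lock Definition wpoly (F : fieldType) (Z : choiceType) (w : Z -> nat) :
  {rmorphism mpol F Z -> {poly mpol F Z}} :=
  mev (polyC \o @mC F Z) (fun z => (mX z)%:P * 'X^(w z)).
Arguments wpoly {F Z} w.

Section UnivariateView.
Variables (F : fieldType) (Z : choiceType).
Implicit Types (p q g r : mpol F Z) (z : Z).

Lemma upolyC z (a : F) : upoly z (mC a) = (mC a)%:P.
Proof. by rewrite upoly.unlock /= mevC. Qed.

Lemma upolyX z (w : Z) : upoly z (mX w : mpol F Z) = if w == z then 'X else (mX w)%:P.
Proof. by rewrite upoly.unlock /= mevX. Qed.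

Lemma upoly_horner z p : (upoly z p).[mX z] = p.
Proof.
have := @mpol_hom_eq F (mpol F Z) Z (horner_eval (mX z) \o upoly z) idfun.
apply=> [a|w]; rewrite [LHS]/= /horner_eval ?upolyC ?hornerC // upolyX.
by case: eqP => [->|_]; rewrite ?hornerX ?hornerC.
Qed.

Lemma upoly_coef_occurs z p i (w : Z) : occurs (upoly z p)`_i w -> w != z /\ occurs p w.
Proof.
move: i w; apply: (mpol_ind_in (D := occurs p) (Q := fun q =>
  forall i w, occurs (upoly z q)`_i w -> w != z /\ occurs p w)); last by move=> x.
- by move=> a i w; rewrite upolyC coefC; case: eqP; rewrite ?occursC ?occurs0.
- move=> x Dx i w; rewrite upolyX; case: eqP => [_|/eqP xz].
    by rewrite coefX; case: eqP => _; rewrite ?occurs0 ?occurs1.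
  rewrite coefC; case: eqP; rewrite ?occurs0 // occursX => _ /eqP<-.
  by split.
- by move=> q r Hq Hr i w; rewrite rmorphD coefD => /occursD/orP[/Hq|/Hr].
- move=> q r Hq Hr i w; rewrite rmorphM coefM.
  elim/big_rec: _ => [|j s _ IH]; first by rewrite occurs0.
  by case/occursD/orP => // /occursM/orP[/Hq|/Hr].
Qed.

Lemma upoly_not_occurs z p : ~~ occurs p z -> upoly z p = p%:P.
Proof.
move=> pz; apply: (@mpol_hom_eq_in F {poly mpol F Z} Z (upoly z) polyC p) => [a|w pw].
  exact: upolyC.
by rewrite upolyX; case: eqP => // wz; move: pz; rewrite -wz pw.
Qed.

Lemma upoly_inj z p : upoly z p = 0 -> p = 0.
Proof. by move=> p0; rewrite -(upoly_horner z p) p0 horner0. Qed.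

Lemma size_upoly_gt1 z p : (1 < size (upoly z p))%N = occurs p z.
Proof.
apply/idP/idP; last first.
  move=> pz; rewrite ltnNge; apply: contraL pz => /size1_polyC e.
  rewrite -(upoly_horner z p) e hornerC; apply/negP => /upoly_coef_occurs[].
  by rewrite eqxx.
apply: contraLR => /upoly_not_occurs->.
by rewrite size_polyC -leqNgt leq_b1.
Qed.

Lemma occurs_mul z p q : p != 0 -> q != 0 ->
  occurs (p * q) z = occurs p z || occurs q z.
Proof.
have nz r : r != 0 -> upoly z r != 0.
  by move=> r0; apply/eqP => /upoly_inj/eqP; apply/negP.
move=> /nz p0 /nz q0; rewrite -!size_upoly_gt1 rmorphM; exact: (size_mul_gt1 p0 q0).
Qed.

Lemma wpolyC (w : Z -> nat) (a : F) : wpoly w (mC a) = (mC a)%:P.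
Proof. by rewrite wpoly.unlock /= mevC. Qed.

Lemma wpolyX (w : Z -> nat) z : wpoly w (mX z : mpol F Z) = (mX z)%:P * 'X^(w z).
Proof. by rewrite wpoly.unlock /= mevX. Qed.

Lemma wpoly_horner (w : Z -> nat) p : (wpoly w p).[1] = p.
Proof.
have := @mpol_hom_eq F (mpol F Z) Z (horner_eval 1 \o wpoly w) idfun.
apply=> [a|z]; rewrite [LHS]/= /horner_eval ?wpolyC ?hornerC // wpolyX.
by rewrite hornerM hornerXn expr1n mulr1 hornerC.
Qed.

Lemma wpoly_inj (w : Z -> nat) p : wpoly w p = 0 -> p = 0.
Proof. by move=> p0; rewrite -(wpoly_horner w p) p0 horner0. Qed.

Lemma wpoly_coef_occurs (w : Z -> nat) p i z : occurs (wpoly w p)`_i z -> occurs p z.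
Proof.
move: i z; apply: (mpol_ind_in (D := occurs p) (Q := fun q =>
  forall i z, occurs (wpoly w q)`_i z -> occurs p z)); last by move=> x.
- by move=> a i z; rewrite wpolyC coefC; case: eqP; rewrite ?occursC ?occurs0.
- move=> x Dx i z; rewrite wpolyX coefCM coefXn => /occursM/orP[].
    by rewrite occursX => /eqP<-.
  by case: eqP => _; rewrite ?occurs0 ?occurs1.
- by move=> q r Hq Hr i z; rewrite rmorphD coefD => /occursD/orP[/Hq|/Hr].
- move=> q r Hq Hr i z; rewrite rmorphM coefM.
  elim/big_rec: _ => [|j s _ IH]; first by rewrite occurs0.
  by case/occursD/orP => // /occursM/orP[/Hq|/Hr].
Qed.

Definition tdeg p := (size (wpoly (fun _ : Z => 1%N) p)).-1.

Lemma tdegM p q : p != 0 -> q != 0 -> tdeg (p * q) = (tdeg p + tdeg q)%N.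
Proof.
have nz r : r != 0 -> wpoly (fun _ : Z => 1%N) r != 0.
  by move=> r0; apply/eqP => /wpoly_inj/eqP; apply/negP.
move=> /nz p0 /nz q0; rewrite /tdeg rmorphM; exact: (predn_size_mul p0 q0).
Qed.

Lemma tdeg0 p : tdeg p = 0%N -> exists a, p = mC a.
Proof.
have E q : exists a, (wpoly (fun _ : Z => 1%N) q)`_0 = mC a.
  elim/mpol_ind: q => [a|z|q r [a qa] [b rb]|q r [a qa] [b rb]].
  - by exists a; rewrite wpolyC coefC.
  - by exists 0; rewrite wpolyX coefMXn mC0.
  - by exists (a + b); rewrite mCD rmorphD coefD qa rb.
  - by exists (a * b); rewrite mCM rmorphM coef0M qa rb.
move=> p0; have [a pa] := E p; exists a.
rewrite -{1}(wpoly_horner (fun _ : Z => 1%N) p) [wpoly _ p]size1_polyC ?hornerC //.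
by move: p0; rewrite /tdeg; case: (size _) => // -[].
Qed.

End UnivariateView.

Section Dichotomy.
Variables (F : fieldType) (Z : choiceType).
Implicit Types (p q g r : mpol F Z) (z : Z).

Lemma unit_mC (a : F) : a != 0 -> (mC a : mpol F Z) \is a GRing.unit.
Proof. by move=> a0; rewrite (rmorph_unit (@mC F Z)) // unitfE. Qed.

Lemma ring_unitE p : ring_unit p <-> p \is a GRing.unit.
Proof.
split=> [[q pq]|pu]; first by apply/unitrPr; exists q.
by exists p^-1; rewrite divrr.
Qed.

Lemma ring_irreducibleE p : ring_irreducible p -> p != 0 /\ irreducible_elt p.
Proof.
case=> p0 pnu pi; split; first exact/eqP.
split; first by apply/negP => /ring_unitE.
by move=> a b /pi[]/ring_unitE; [left|right].
Qed.

(** The dichotomy for univariate polynomials in [z] over the iterated ring in the other variables;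
    the constant of the Bezout identity is the combination [r] free of [z]. *)
Lemma mpol_dichotomy g p z : irreducible_elt g -> occurs g z ->
  dvdr g p \/ exists A B r, [/\ r != 0, r = A * g + B * p, ~~ occurs r z
    & forall w, occurs r w -> occurs g w || occurs p w].
Proof.
move=> [gnu gi] gz; have [s0 [us0 sg0 sp0]] := finite_support2 g p.
(* Only variables of [g] or [p] are kept, so that [r] has no others. *)
pose s := [seq w <- s0 | (w != z) && (occurs g w || occurs p w)].
have zs : z \notin s by rewrite mem_filter eqxx.
have us : uniq (z :: s) by rewrite /= zs filter_uniq.
have mem_s w : occurs g w || occurs p w -> w \in z :: s.
  rewrite inE mem_filter => gpw; rewrite gpw andbT; case: eqP => //= _.
  by case/orP: gpw => [/sg0|/sp0].
have toK r : (forall w, occurs r w -> occurs g w || occurs p w) ->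
    of_ipoly F (z :: s) (to_ipoly F (z :: s) r) = r.
  by move=> rw; apply: to_ipolyK => w /rw/mem_s.
have gK : of_ipoly F (z :: s) (to_ipoly F (z :: s) g) = g.
  by apply: toK => w ->.
have pK : of_ipoly F (z :: s) (to_ipoly F (z :: s) p) = p.
  by apply: toK => w ->; rewrite orbT.
pose G : {poly ipoly F (size s)} := to_ipoly F (z :: s) g.
pose P : {poly ipoly F (size s)} := to_ipoly F (z :: s) p.
have ofC c : of_ipoly F (z :: s) (c%:P : {poly ipoly F (size s)}) = of_ipoly F s c.
  by rewrite /= map_polyC /horner_eval hornerC.
have sG : (1 < size G)%N.
  rewrite ltnNge; apply/negP => /size1_polyC e; move: gz.
  by rewrite -gK -/G e ofC => /of_ipoly_occurs; apply/negP.
have Gi : irreducible_elt G.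
  split.
    apply: contraNN gnu => Gu; rewrite -gK.
    exact: (rmorph_unit (of_ipoly F (z :: s)) Gu).
  move=> A B e.
  have U (C : ipoly F (size (z :: s))) : of_ipoly F (z :: s) C \is a GRing.unit ->
      C \is a GRing.unit.
    move=> /(rmorph_unit (to_ipoly F (z :: s))); rewrite of_ipolyK //.
  have /gi[/U|/U] : g = of_ipoly F (z :: s) A * of_ipoly F (z :: s) B.
  - by rewrite -gK -rmorphM; congr (of_ipoly F (z :: s) _).
  - by left.
  - by right.
case: (irreducible_dichotomy (@factorial_ipoly F (size s)) P sG Gi) =>
    [[Q QE]|[A [B [c [c0 cE]]]]].
  left; exists (of_ipoly F (z :: s) Q).
  by rewrite -pK -gK -rmorphM; congr (of_ipoly F (z :: s) _).
right; exists (of_ipoly F (z :: s) A), (of_ipoly F (z :: s) B), (of_ipoly F s c).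
split.
- apply: contraNneq c0 => e; have /= us' : uniq s by case/andP: us.
  by rewrite -[c](of_ipolyK us') e rmorph0.
- rewrite -ofC -cE -gK -pK -!rmorphM -rmorphD.
  by congr (of_ipoly F (z :: s) _).
- by apply: contraNN zs => /of_ipoly_occurs.
- by move=> w /of_ipoly_occurs; rewrite mem_filter => /andP[/andP[]].
Qed.

End Dichotomy.

(** * Algebraic dependence *)

Section Subfields.
Variable L : fieldType.

Record subfield := Subfield { sf_set :> L -> Prop; sf_prop : is_subfield sf_set }.

Definition sf_pred (E : subfield) : {pred L} := fun x => `[< E x >].

Lemma sf_predE (E : subfield) x : x \in sf_pred E <-> E x.
Proof. by split=> /asboolP. Qed.

Lemma sf_divring_closed (E : subfield) : divring_closed (sf_pred E).
Proof.
have [E1 EB ED] := sf_prop E.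
split=> [|x y /sf_predE xE /sf_predE yE|x y /sf_predE xE /sf_predE yE].
- exact/sf_predE.
- exact/sf_predE/EB.
- exact/sf_predE/ED.
Qed.

HB.instance Definition _ (E : subfield) :=
  GRing.isDivringClosed.Build L (sf_pred E) (sf_divring_closed E).

(** A subfield given by a predicate becomes a field type, which makes the closure properties of
    algebraic elements over a field embedding available. *)
Record sf_type (E : subfield) := SFType { sf_val : L; _ : sf_val \in sf_pred E }.
HB.instance Definition _ (E : subfield) := [isSub for @sf_val E].
HB.instance Definition _ (E : subfield) := [Choice of sf_type E by <:].
HB.instance Definition _ (E : subfield) :=
  [SubChoice_isSubIntegralDomain of sf_type E by <:].
HB.instance Definition _ (E : subfield) :=
  [SubIntegralDomain_isSubField of sf_type E by <:].

Lemma algebraic_overE (E : subfield) x :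
  algebraic_over E x <-> algebraicOver (val : sf_type E -> L) x.
Proof.
split=> [[p [p0 pE px]]|[p p0 px]].
  pose q := \poly_(i < size p) (SFType (E := E) (introT (asboolP _) (pE i))).
  have e : map_poly val q = p.
    apply/polyP => i; rewrite coef_map coef_poly; case: ltnP => //= ip.
    by rewrite nth_default // rmorph0.
  exists q; last by rewrite e.
  by apply: contra_not_neq p0 => q0; rewrite -e q0 map_poly0.
exists (map_poly val p); split=> // [/eqP|i].
  by rewrite map_poly_eq0; apply/negP.
by rewrite coef_map /=; apply/sf_predE/valP.
Qed.

Lemma algebraic_over_subfield (E : L -> Prop) :
  is_subfield E -> is_subfield (algebraic_over E).
Proof.
move=> hE; pose E' := Subfield hE; rewrite -[E]/(sf_set E').
split=> [|x y /algebraic_overE xa /algebraic_overE ya|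
           x y /algebraic_overE xa /algebraic_overE ya]; apply/algebraic_overE.
- exact: algebraic1.
- exact: algebraic_sub.
- exact: algebraic_div.
Qed.

Lemma algebraic_over_trans (E : L -> Prop) x :
  is_subfield E -> algebraic_over (algebraic_over E) x -> algebraic_over E x.
Proof.
move=> hE; pose E' := Subfield hE; rewrite -[E]/(sf_set E').
move=> [p [/eqP p0 pE px]]; apply/algebraic_overE/integral_algebraic.
apply: (integral_root p0 px) => y /(nthP 0)[i _ <-].
exact/integral_algebraic/algebraic_overE.
Qed.

End Subfields.

Lemma subf_div (L : fieldType) (x y : L) z t : z != 0 -> t != 0 ->
  x / z - y / t = (x * t - y * z) / (z * t).
Proof. by move=> z0 t0; rewrite -mulNr addf_div // mulNr. Qed.

Section AlgebraicClosureOperator.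
Variables (F L : fieldType) (c : {rmorphism F -> L}).
Implicit Types (S : L -> Prop) (x y z : L) (B C D : seq L).

Lemma adjoin_subfield S : is_subfield (adjoin c S).
Proof.
split=> [E hE|x y xS yS E hE cE sE|x y xS yS E hE cE sE].
- by case: hE.
- by case: (hE) => _ + _; apply; [exact: xS|exact: yS].
- by case: (hE) => _ _; apply; [exact: xS|exact: yS].
Qed.

Lemma adjoin_const S a : adjoin c S (c a).
Proof. by move=> E _ cE _. Qed.

Lemma adjoin_mem S x : S x -> adjoin c S x.
Proof. by move=> Sx E _ _; apply. Qed.

(** Relative algebraic closure. It is a closure operator with the exchange property, and all later
    counts of transcendence degrees go through it. *)
Definition acl S x := algebraic_over (adjoin c S) x.

Lemma acl_subfield S : is_subfield (acl S).
Proof. exact/algebraic_over_subfield/adjoin_subfield. Qed.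

Lemma acl_adjoin S x : adjoin c S x -> acl S x.
Proof.
move=> xS; exists ('X - x%:P); rewrite root_XsubC; split=> // [|i].
  by apply/eqP; rewrite polyXsubC_eq0.
apply/(sf_predE (Subfield (adjoin_subfield S))).
have /polyOverP : 'X - x%:P \is a polyOver (sf_pred (Subfield (adjoin_subfield S))).
  by rewrite polyOverXsubC; apply/sf_predE.
exact.
Qed.

Lemma acl_mem S x : S x -> acl S x.
Proof. by move/(@adjoin_mem S)/acl_adjoin. Qed.

Lemma acl_trans S S' x : (forall y, S y -> acl S' y) -> acl S x -> acl S' x.
Proof.
move=> SS' [p [p0 pS px]]; apply: algebraic_over_trans; first exact: adjoin_subfield.
exists p; split=> // i; apply: (pS i); last exact: SS'.
  exact: acl_subfield.
by move=> a; apply: acl_adjoin; apply: adjoin_const.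
Qed.

Lemma acl_sub S S' x : (forall y, S y -> S' y) -> acl S x -> acl S' x.
Proof. by move=> SS'; apply: acl_trans => y /SS'/acl_mem. Qed.

Definition add_elt S x y := S y \/ y = x.

Lemma adjoin_add S x u (E := Subfield (adjoin_subfield S)) :
  adjoin c (add_elt S x) u -> exists f g : {poly L},
  [/\ f \is a polyOver (sf_pred E), g \is a polyOver (sf_pred E), g.[x] != 0
    & u = f.[x] / g.[x]].
Proof.
move=> H; apply: (H (fun u => exists f g : {poly L},
  [/\ f \is a polyOver (sf_pred E), g \is a polyOver (sf_pred E), g.[x] != 0
    & u = f.[x] / g.[x]])).
- split=> [|_ _ [f [g [fE gE gx ->]]] [f' [g' [fE' gE' gx' ->]]]|
          _ _ [f [g [fE gE gx ->]]] [f' [g' [fE' gE' gx' ->]]]].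
  + by exists 1, 1; rewrite rpred1 !hornerC divr1 oner_neq0.
  + exists (f * g' - f' * g), (g * g'); rewrite !hornerE mulf_neq0 //.
    split; [exact: rpredB (rpredM _ _) (rpredM _ _)|exact: rpredM| by []|].
    by rewrite subf_div.
  + have [fx'|fx'] := eqVneq f'.[x] 0.
      exists 0, 1; rewrite fx' mul0r invr0 mulr0 horner0 mul0r hornerC oner_neq0.
      by split=> //; [exact: rpred0|exact: rpred1].
    exists (f * g'), (g * f'); rewrite !hornerE mulf_neq0 //.
    by split=> //; [exact: rpredM|exact: rpredM|rewrite invf_div mulf_div].
- move=> a; exists (c a)%:P, 1; rewrite !hornerC divr1 oner_neq0 rpred1.
  by split=> //; rewrite polyOverC; apply/sf_predE; apply: adjoin_const.
- move=> s [Ss|->].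
    exists s%:P, 1; rewrite !hornerC divr1 oner_neq0 rpred1.
    by split=> //; rewrite polyOverC; apply/sf_predE; apply: adjoin_mem.
  exists 'X, 1; rewrite !hornerE divr1 oner_neq0 rpred1.
  by split=> //; apply: polyOverX.
Qed.

(** An equation of [y] over S(x), with denominators cleared, is a polynomial relation between [x]
    and [y], which is read as an equation for [x] over S(y). *)
Lemma acl_exchange S x y :
  acl (add_elt S x) y -> ~ acl S y -> acl (add_elt S y) x.
Proof.
move=> [p [p0 pS py]] nSy; pose E := Subfield (adjoin_subfield S).
have [g [gE gx [f fP]]] : exists g : {poly L},
    [/\ g \is a polyOver (sf_pred E), g.[x] != 0 & exists f : nat -> {poly L},
    forall i, (i < size p)%N ->
      f i \is a polyOver (sf_pred E) /\ g.[x] * p`_i = (f i).[x]].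
  elim: (size p) => [|n [g [gE gx [f fP]]]].
    by exists 1; rewrite rpred1 hornerC oner_neq0; split=> //; exists (fun=> 0).
  have [f' [g' [fE' gE' gx' e]]] := adjoin_add (pS n).
  exists (g * g'); rewrite hornerM mulf_neq0 // rpredM //; split=> //.
  exists (fun i => if i == n then g * f' else f i * g') => i.
  rewrite ltnS leq_eqVlt; case: eqP => [-> _|_ /= /fP[fE e']].
    split; first exact: rpredM.
    by rewrite hornerM e -mulrA; congr (_ * _); rewrite mulrC divfK.
  by split; [exact: rpredM|rewrite hornerM -e' mulrAC].
(* The cleared equation as a polynomial in [x], with [y] already substituted. If it is zero, each of
   its coefficients is an equation for [y] over [S] (the polynomial [r] below), hence trivial, and
   then [p] is zero. *)
pose q := \sum_(j < size p) f j * (y ^+ j)%:P.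
have [q0|q0] := eqVneq q 0; last first.
  exists q; split; first exact/eqP.
    move=> i; pose E' := Subfield (adjoin_subfield (add_elt S y)).
    have : q \is a polyOver (sf_pred E').
      apply: rpred_sum => j _; apply: rpredM.
        have [/polyOverP fE _] := fP j (ltn_ord j).
        apply/polyOverP => k; apply/sf_predE; move/sf_predE: (fE k).
        by move=> H F' hF cF sF; apply: H => // s Ss; apply: sF; left.
      by rewrite polyOverC rpredX //; apply/sf_predE; apply: adjoin_mem; right.
    by move/polyOverP/(_ i)/sf_predE.
  rewrite rootE horner_sum; under eq_bigr => j _.
    rewrite hornerM hornerC -(fP j (ltn_ord j)).2 -mulrA; over.
  by rewrite -mulr_sumr -horner_coef (rootP py) mulr0.
case: p0; apply/polyP => j; rewrite coef0.
have [jp|/leq_sizeP/(_ _ (leqnn _))//] := ltnP j (size p).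
apply: (mulfI gx); rewrite mulr0 (fP j jp).2.
suff -> : f j = 0 by rewrite horner0.
apply/polyP => i; rewrite coef0; pose r := \poly_(k < size p) (f k)`_i.
have -> : (f j)`_i = r`_j by rewrite coef_poly jp.
suff -> : r = 0 by rewrite coef0.
apply: contrapT => r0; apply: nSy; exists r; split=> // [k|].
  rewrite coef_poly; case: ltnP => [/fP[/polyOverP fE _]|_].
    by move/sf_predE: (fE i).
  have [E1 EB _] := adjoin_subfield S.
  by rewrite -(subrr 1); apply: EB.
rewrite rootE horner_poly; move/(congr1 (fun q : {poly L} => q`_i)): q0.
rewrite coef0 /q coef_sum => q0; apply/eqP; rewrite -[RHS]q0; apply: eq_bigr => k _.
by rewrite coefMC.
Qed.

Definition acls B := acl (fun x => x \in B).

Lemma acls_sub B C x : {subset B <= C} -> acls B x -> acls C x.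
Proof. by move=> BC; apply: acl_sub. Qed.

Lemma acls_mem B x : x \in B -> acls B x.
Proof. exact: acl_mem. Qed.

Lemma acls_trans B C x : (forall y, y \in B -> acls C y) -> acls B x -> acls C x.
Proof. exact: acl_trans. Qed.

Lemma acls_exchange B x y : acls (x :: B) y -> ~ acls B y -> acls (y :: B) x.
Proof.
move=> xBy nBy; apply: (@acl_sub (add_elt (fun x => x \in B) y)).
  by move=> z [zB|->]; rewrite inE ?zB ?eqxx ?orbT.
apply: acl_exchange => //; apply: acl_sub xBy => z.
by rewrite inE => /predU1P[->|]; [right|left].
Qed.

Fixpoint indep_over D B : Prop :=
  if B is x :: B' then ~ acls D x /\ indep_over (x :: D) B' else True.

(** The entry of [C] to be dropped is the one whose presence first makes [x] algebraic; by exchange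
    it is algebraic over [x] and the entries after it. *)
Lemma exchange_one C D x : acls (C ++ D) x -> ~ acls D x ->
  exists2 C', (size C' < size C)%N &
    forall y, acls (C ++ D) y -> acls (C' ++ x :: D) y.
Proof.
elim: C => [|z C IH] //= xCD nDx.
have [xC|nxC] := pselect (acls (C ++ D) x).
  have [C' sC' CC'] := IH xC nDx; exists (z :: C') => //= y.
  apply: acls_trans => w; rewrite inE => /predU1P[->|wC].
    by apply: acls_mem; rewrite mem_head.
  apply: acls_sub (CC' _ (acls_mem wC)) => v vC; by rewrite inE vC orbT.
exists C => // y; apply: acls_trans => w; rewrite inE => /predU1P[->|wC].
  apply: acls_sub (acls_exchange xCD nxC) => v.
  by rewrite !inE !mem_cat inE => /or3P[]->; rewrite ?orbT.
apply: acls_mem; move: wC; rewrite !mem_cat inE => /orP[]->; rewrite ?orbT //.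
Qed.

(** Each entry of [B] in turn moves into [D] and costs at least one entry of [C]. *)
Theorem steinitz C D B : indep_over D B ->
  (forall x, x \in B -> acls (C ++ D) x) -> (size B <= size C)%N.
Proof.
elim: B C D => [|x B IH] C D //= [nDx iB] BC.
have [C' sC' CC'] := exchange_one (BC x (mem_head _ _)) nDx.
apply: leq_ltn_trans sC'; apply: (IH C' (x :: D)) => // y yB.
by apply/CC'/BC; rewrite inE yB orbT.
Qed.

End AlgebraicClosureOperator.

Section PolynomialRelations.
Variables (F L : fieldType) (c : {rmorphism F -> L}) (I : choiceType).
Variable ev : {rmorphism mpol F I -> L}.
Hypothesis evC : forall a, ev (mC a) = c a.
Let b i := ev (mX i).
Implicit Types (p q : mpol F I) (s : seq I).

Lemma adjoin_polyfrac s u :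
  adjoin c (fun x => x \in map b s) u -> exists p q,
  [/\ forall i, occurs p i -> i \in s, forall i, occurs q i -> i \in s,
      ev q != 0 & u = ev p / ev q].
Proof.
move=> H; apply: (H (fun u => exists p q,
  [/\ forall i, occurs p i -> i \in s, forall i, occurs q i -> i \in s,
      ev q != 0 & u = ev p / ev q])).
- split=> [|_ _ [p [q [ps qs q0 ->]]] [p' [q' [ps' qs' q0' ->]]]|
          _ _ [p [q [ps qs q0 ->]]] [p' [q' [ps' qs' q0' ->]]]].
  + by exists 1, 1; rewrite rmorph1 divr1 oner_neq0; split=> // i; rewrite occurs1.
  + exists (p * q' - p' * q), (q * q'); split.
    * move=> i /occursD/orP[/occursM/orP[/ps|/qs']|]; try by apply.
      by rewrite occursN => /occursM/orP[/ps'|/qs].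
    * by move=> i /occursM/orP[/qs|/qs'].
    * by rewrite rmorphM; exact: mulf_neq0.
    * rewrite (subf_div _ _ q0 q0') rmorphB (rmorphM ev p q') (rmorphM ev p' q).
       by rewrite (rmorphM ev q q').
  + have [p0'|p0'] := eqVneq (ev p') 0.
      exists 0, 1; rewrite p0' mul0r invr0 mulr0 rmorph0 rmorph1 mul0r oner_neq0.
      by split=> // i; rewrite ?occurs0 ?occurs1.
    exists (p * q'), (q * p'); split.
    * by move=> i /occursM/orP[/ps|/qs'].
    * by move=> i /occursM/orP[/qs|/ps'].
    * by rewrite rmorphM; exact: mulf_neq0.
    * by rewrite (rmorphM ev p q') (rmorphM ev q p') invf_div mulf_div.
- move=> a; exists (mC a), 1; rewrite evC rmorph1 divr1 oner_neq0.
  by split=> // i; rewrite ?occursC ?occurs1.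
- move=> _ /mapP[i si ->]; exists (mX i), 1; rewrite rmorph1 divr1 oner_neq0.
  by split=> // j; rewrite ?occurs1 // occursX => /eqP<-.
Qed.

(** Clear denominators in an equation for [b i] and put the variable [i] for the unknown. Since [i]
    is not in [s], [upoly i] recovers the coefficients, so the relation is not zero. *)
Lemma acls_relation s i : i \notin s ->
  acls c (map b s) (b i) -> exists p, [/\ p <> 0, ev p = 0
    & forall j, occurs p j -> j \in i :: s].
Proof.
move=> si [P [P0 PE Pb]].
have [g [gs g0 [f fP]]] : exists g,
    [/\ forall j, occurs g j -> j \in s, ev g != 0 & exists f : nat -> mpol F I,
    forall k, (k < size P)%N -> (forall j, occurs (f k) j -> j \in s) /\
      ev g * P`_k = ev (f k)].
  elim: (size P) => [|n [g [gs g0 [f fP]]]].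
    exists 1; rewrite rmorph1 oner_neq0; split=> //; first by move=> j; rewrite occurs1.
    by exists (fun=> 0).
  have [p [q [ps qs q0 e]]] := adjoin_polyfrac (PE n).
  exists (g * q); rewrite rmorphM mulf_neq0 //; split=> //.
    by move=> j /occursM/orP[/gs|/qs].
  exists (fun k => if k == n then g * p else f k * q) => k.
  rewrite ltnS leq_eqVlt; case: eqP => [-> _|_ /= /fP[fs e']].
    split; first by move=> j /occursM/orP[/gs|/ps].
    by rewrite rmorphM e -mulrA; congr (_ * _); rewrite mulrC divfK.
  split; first by move=> j /occursM/orP[/fs|/qs].
  by rewrite rmorphM -e' mulrAC.
pose p := \sum_(k < size P) f k * mX i ^+ k.
exists p; split.
- move=> p0; apply: P0; apply/polyP => k; rewrite coef0.
  have [kP|/leq_sizeP/(_ _ (leqnn _))//] := ltnP k (size P).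
  apply: (mulfI g0); rewrite mulr0 (fP k kP).2.
  suff -> : f k = 0 by rewrite rmorph0.
  have : (upoly i p)`_k = 0 by rewrite p0 rmorph0 coef0.
  rewrite /p rmorph_sum /= coef_sum (bigD1 (Ordinal kP)) //= big1 ?addr0.
    rewrite rmorphM rmorphXn /= upolyX eqxx upoly_not_occurs ?coefCM ?coefXn ?eqxx ?mulr1 //.
    by apply/negP => /((fP k kP).1 i); apply/negP.
  move=> l lk; rewrite rmorphM rmorphXn /= upolyX eqxx upoly_not_occurs.
    rewrite coefCM coefXn; case: eqP => [e|_]; last by rewrite mulr0.
    by case/eqP: lk; apply: val_inj.
  by apply/negP => /((fP l (ltn_ord l)).1 i); apply/negP.
- rewrite rmorph_sum /=; under eq_bigr => k _.
    rewrite rmorphM rmorphXn /= -(fP k (ltn_ord k)).2 -mulrA; over.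
  by rewrite -mulr_sumr -horner_coef (rootP Pb) mulr0.
- move=> j; rewrite /p; elim/big_rec: _ => [|k q _ IH]; first by rewrite occurs0.
  case/occursD/orP => // /occursM/orP[/((fP k (ltn_ord k)).1 j)|].
    by rewrite inE => ->; rewrite orbT.
  elim: (k : nat) => [|m IHm]; first by rewrite expr0 occurs1.
  by rewrite exprS => /occursM/orP[|//]; rewrite occursX inE eq_sym => ->.
Qed.

Lemma indep_over_map t s : uniq (t ++ s) ->
  (forall p, (forall i, occurs p i -> i \in t ++ s) -> ev p = 0 -> p = 0) ->
  indep_over c (map b t) (map b s).
Proof.
elim: s t => [|i s IH] t //= us ind; split.
  move=> /acls_relation[|p [p0 pb pit]].
    by move: us; rewrite cat_uniq /= negb_or => /and3P[_ /andP[]].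
  apply/p0/ind => // j /pit; rewrite mem_cat !inE => /orP[]->; rewrite ?orbT //.
apply: (IH (i :: t)) => [|p pit].
  by rewrite -[_ ++ s]/([:: i] ++ t ++ s) uniq_catCA.
apply: ind => j /pit; rewrite /= inE !mem_cat inE.
by case/or3P => ->; rewrite ?orbT.
Qed.

(** The coefficients of the equation are only algebraic over the list, hence the appeal to
    transitivity. *)
Lemma root_acls s p i n : ev p = 0 -> ev (upoly i p)`_n != 0 ->
  (forall j, occurs p j -> j != i -> acls c (map b s) (b j)) -> acls c (map b s) (b i).
Proof.
move=> p0 pn ps; pose E := Subfield (acl_subfield c (fun x => x \in map b s)).
apply: algebraic_over_trans; first exact: adjoin_subfield.
exists (map_poly ev (upoly i p)); split.
- by move=> /(congr1 (fun q : {poly L} => q`_n)); rewrite coef_map coef0; apply/eqP.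
- move=> k; rewrite coef_map.
  apply: (mpol_ind_in (D := fun j => acls c (map b s) (b j)) (Q := fun q =>
    acl c (fun x => x \in map b s) (ev q))).
  + by move=> a; rewrite evC; apply/acl_adjoin; apply: adjoin_const.
  + by [].
  + by move=> q r qa ra; rewrite rmorphD; apply/(sf_predE E); apply: rpredD; apply/sf_predE.
  + by move=> q r qa ra; rewrite rmorphM; apply/(sf_predE E); apply: rpredM; apply/sf_predE.
  + by move=> j /upoly_coef_occurs[ji pj]; apply: ps.
- by rewrite rootE horner_map upoly_horner p0.
Qed.

(** Look at the last variable. If some coefficient with respect to it has a nonzero value, the
    relation is an equation for this variable; otherwise any nonzero coefficient is a relation among
    the earlier ones. *)
Lemma relation_acls s p : p <> 0 -> ev p = 0 ->
  (forall i, occurs p i -> i \in s) ->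
  exists s1 i s2, s = s1 ++ i :: s2 /\ acls c (map b s1) (b i).
Proof.
elim/last_ind: s p => [|s i IH] p p0 pb ps.
  have [|a e] := @not_occurs_const _ _ p; first by move=> i; apply/negP => /ps.
  case: p0; move: pb; rewrite e evC => /eqP.
  by rewrite fmorph_eq0 => /eqP->; rewrite mC0.
have cs k j : occurs (upoly i p)`_k j -> j \in s.
  move=> /upoly_coef_occurs[/negbTE ji /ps].
  by rewrite mem_rcons inE ji.
have [[k pk]|np] := pselect (exists k, ev (upoly i p)`_k != 0).
  exists s, i, [::]; split; first by rewrite cats1.
  apply: (root_acls pb pk) => j /ps; rewrite mem_rcons inE => /predU1P[->|js _].
    by rewrite eqxx.
  by apply: acls_mem; apply: map_f.
have [k pk] : exists k, (upoly i p)`_k <> 0.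
  apply: contrapT => nk; apply: p0; apply: (@upoly_inj _ _ i); apply/polyP => k.
  by rewrite coef0; apply: contrapT => pk; apply: nk; exists k.
have [|s1 [j [s2 [-> sj]]]] := IH _ pk _ (cs k).
  by apply/eqP/negPn/negP => pk'; apply: np; exists k.
by exists s1, j, (rcons s2 i); rewrite rcons_cat.
Qed.

End PolynomialRelations.

(** * Minimal relations *)

Section DifferencePolynomialRing.
Variables (F : fieldType) (s : {rmorphism F -> F}) (X : choiceType).

Definition mshift : {rmorphism mpol F (X * nat)%type -> mpol F (X * nat)%type} :=
  mev (@mC F (X * nat)%type \o s) (fun v => mX (v.1, v.2.+1)).

Lemma mshiftC a : mshift (mC a) = mC (s a).
Proof. by rewrite /mshift mevC. Qed.

Lemma mshiftX v : mshift (mX v) = mX (v.1, v.2.+1).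
Proof. by rewrite /mshift mevX. Qed.

Lemma occurs_mshift p v : occurs (mshift p) v ->
  exists k, v.2 = k.+1 /\ occurs p (v.1, k).
Proof.
move: v; apply: (mpol_ind_in (D := occurs p) (Q := fun q => forall v,
  occurs (mshift q) v -> exists k, v.2 = k.+1 /\ occurs p (v.1, k))); last by [].
- by move=> a v; rewrite mshiftC occursC.
- by move=> w pw v; rewrite mshiftX occursX => /eqP<-; exists w.2; rewrite /= -surjective_pairing.
- by move=> q r Hq Hr v; rewrite rmorphD => /occursD/orP[/Hq|/Hr].
- by move=> q r Hq Hr v; rewrite rmorphM => /occursM/orP[/Hq|/Hr].
Qed.

Lemma occurs_iter_mshift i p v : occurs (iter i mshift p) v ->
  exists k, v.2 = (k + i)%N /\ occurs p (v.1, k).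
Proof.
elim: i v => [|i IH] v; first by move=> pv; exists v.2; rewrite addn0 -surjective_pairing.
move=> /occurs_mshift[k [vk /IH[j /= [kj pj]]]]; exists j; split=> //.
by rewrite vk kj addnS.
Qed.

Lemma upoly_mshift x k p :
  upoly (x, k.+1) (mshift p) = map_poly mshift (upoly (x, k) p).
Proof.
have := @mpol_hom_eq F {poly mpol F (X * nat)%type} (X * nat)%type
  (upoly (x, k.+1) \o mshift) (map_poly mshift \o upoly (x, k)).
apply=> [a|v] /=; first by rewrite mshiftC !upolyC map_polyC /= mshiftC.
rewrite mshiftX !upolyX; case: v => y l /=; rewrite !xpair_eqE eqSS.
by case: ifP => _; rewrite ?map_polyX // map_polyC /= mshiftX.
Qed.

Lemma upoly_iter_mshift x k i p j : (upoly (x, k + i)%N (iter i mshift p))`_j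
  = iter i mshift (upoly (x, k) p)`_j.
Proof.
by elim: i => [|i IH]; rewrite ?addn0 // addnS /= upoly_mshift coef_map IH.
Qed.

End DifferencePolynomialRing.
Arguments mshift {F} s {X}.

Section MinimalRelation.
Variables (F K : fieldType) (c : {rmorphism F -> K}) (X : choiceType).
Local Notation S := (mpol F (X * nat)%type).
Variables (s : {rmorphism F -> F}) (ev : {rmorphism S -> K}).
Hypothesis evC : forall a, ev (mC a) = c a.
(** With [shift_ev], this says that the kernel of [ev] is a reflexive difference ideal; it is prime
    because [K] is a field. *)
Hypothesis ev_shift : forall p, ev p != 0 -> ev (mshift s p) != 0.
Hypothesis shift_ev : forall p, ev p = 0 -> ev (mshift s p) = 0.
Implicit Types (p g r : S) (x y : X).

Definition order_at p x (q : nat) : Prop :=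
  occurs p (x, q) /\ forall k, occurs p (x, k) -> (k <= q)%N.

(** Equivalently, the transforms of [x] of order below [q] and all transforms of the other
    indeterminates have algebraically independent values. *)
Definition min_order x (q : nat) : Prop :=
  forall r, ev r = 0 -> r != 0 -> exists2 k, (q <= k)%N & occurs r (x, k).

(** Otherwise eliminating the variable (x, q) between [g] and [p] leaves a nonzero relation of order
    below [q] in [x]. *)
Lemma min_order_dvd g p x q : irreducible_elt g -> ev g = 0 ->
  order_at g x q -> min_order x q -> ev p = 0 ->
  (forall k, occurs p (x, k) -> (k <= q)%N) -> dvdr g p.
Proof.
move=> gi g0 [gq gk] minq p0 pk.
have [//|[A [B [r [r0 rE rq rgp]]]]] := mpol_dichotomy p gi gq.
have [|k qk rk] := minq r _ r0; first by rewrite rE rmorphD !rmorphM g0 p0 !mulr0 addr0.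
have kq : (k <= q)%N by case/orP: (rgp _ rk) => [/gk|/pk].
have e : k = q by apply/eqP; rewrite eqn_leq kq qk.
by move: rq; rewrite -e rk.
Qed.

Lemma irreducible_neq0 g z : occurs g z -> g != 0.
Proof. by apply: contraTneq => ->; rewrite occurs0. Qed.

(** If its value were zero, the leading coefficient would be a multiple of [g], which contains [z],
    whereas the coefficient does not. *)
Lemma min_order_lead g x m z : irreducible_elt g -> ev g = 0 ->
  order_at g x m -> min_order x m -> occurs g z ->
  ev (lead_coef (upoly z g)) != 0.
Proof.
move=> gi g0 gx minx gz; apply/eqP => l0.
have gn0 := irreducible_neq0 gz.
have ln0 : lead_coef (upoly z g) != 0.
  by rewrite lead_coef_eq0; apply: contraNneq gn0 => /upoly_inj->.
have [|h hE] := min_order_dvd gi g0 gx minx l0.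
  by move=> k /upoly_coef_occurs[_]; case: gx => _; apply.
have hn0 : h != 0 by apply: contraNneq ln0 => h0; rewrite hE h0 mul0r.
have /upoly_coef_occurs[] : occurs (lead_coef (upoly z g)) z.
  by rewrite hE occurs_mul // gz orbT.
by rewrite eqxx.
Qed.

(* Both lists of variables in the proof have the same length.  The first is
   independent because x has minimal order m, and it is algebraic over the
   second one thanks to the transforms of g; hence so is the second one. *)
Lemma min_order_transfer g x m y q : irreducible_elt g -> ev g = 0 ->
  order_at g x m -> min_order x m -> y != x -> order_at g y q -> min_order y q.
Proof.
move=> gi g0 gx minx yx gy r r0 rn0; apply: contrapT => nr.
have [sg sgP] := finite_occurs g; have [sr srP] := finite_occurs r.
have [T leT] : exists T, forall (z : X) (k : nat),
    occurs g (z, k) || occurs r (z, k) -> (k <= T)%N.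
  exists (\max_(v <- sg ++ sr) v.2)%N => z k vgr.
  have vs : (z, k) \in sg ++ sr; last first.
    exact: (@leq_bigmax_seq _ _ xpredT (fun v : X * nat => v.2) (z, k) vs isT).
  by rewrite mem_cat; case/orP: vgr => [/sgP->|/srP->]; rewrite ?orbT.
pose xs := undup [seq z <- map fst (sg ++ sr) | (z != x) && (z != y)].
have xsP (z : X) (k : nat) :
    occurs g (z, k) || occurs r (z, k) -> z != x -> z != y -> z \in xs.
  move=> vgr vx vy; rewrite mem_undup mem_filter vx vy; apply: (map_f fst (x := (z, k))).
  by rewrite mem_cat; case/orP: vgr => [/sgP->|/srP->]; rewrite ?orbT.
have xsN z : z \in xs -> (z != x) /\ (z != y).
  by rewrite mem_undup mem_filter => /andP[/andP[]].
pose col (z : X) n := [seq (z, k) | k <- iota 0 n].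
have colE (z z' : X) (n k : nat) : ((z', k) \in col z n) = (z' == z) && (k < n)%N.
  apply/mapP/andP => [[k' + [-> ->]]|[/eqP-> kn]].
    by rewrite mem_iota => /andP[_ ->].
  by exists k => //; rewrite mem_iota.
(* [T] bounds the orders of [g] and [r], so the transforms of [g] up to the [T]-th have orders at
   most T + T. The extra [T.+1] transforms of [x] in [B2] make room for [r]. *)
pose O := [seq (z, k) | z <- xs, k <- iota 0 (T + T + 1)].
have OE (z : X) (k : nat) : ((z, k) \in O) = (z \in xs) && (k < T + T + 1)%N.
  apply/allpairsP/andP => /= [[[z' k'] /= [zx + [-> ->]]]|[zx kT]].
    by rewrite mem_iota => /andP[_ ?].
  by exists (z, k); rewrite mem_iota.
pose B1 := O ++ col x m ++ col y (q + T.+1)%N.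
pose B2 := O ++ col x (m + T.+1)%N ++ col y q.
have sB : size B1 = size B2 by rewrite !size_cat !size_map !size_iota; lia.
have uB1 : uniq B1.
  rewrite !cat_uniq allpairs_uniq ?undup_uniq ?iota_uniq //; last first.
    by move=> [z k] [z' k'] _ _ [-> ->].
  rewrite !map_inj_uniq ?iota_uniq; try by move=> ? ? [].
  rewrite !andbT /=; apply/andP; split; apply/hasPn => -[z k].
    rewrite mem_cat !colE OE => /orP[]/andP[/eqP-> _];
      apply/negP => /andP[/xsN[]]; by rewrite eqxx.
  by rewrite !colE => /andP[/eqP-> _]; rewrite (negbTE yx).
pose b v := ev (mX v).
have iB1 : indep_over c [::] (map b B1).
  apply: (@indep_over_map _ _ c _ ev evC [::]) => // p pB1 p0.
  apply/eqP/negPn/negP => pn0; have [k mk pk] := minx p p0 pn0.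
  have := pB1 _ pk; rewrite /= !mem_cat OE !colE eqxx [x == y]eq_sym (negbTE yx).
  by case/or3P => [/andP[/xsN[]]||//]; rewrite ?eqxx // ltnNge mk.
have rB2 (z : X) (k : nat) : occurs r (z, k) -> (z, k) \in B2.
  move=> rv; have vgr : occurs g (z, k) || occurs r (z, k) by rewrite rv orbT.
  rewrite !mem_cat OE !colE; have kT := leT _ _ vgr.
  case: (eqVneq z x) => [vx|vx].
    by apply/or3P/Or32 => /=; clear -kT; lia.
  case: (eqVneq z y) => [vy|vy]; last first.
    by apply/or3P/Or31; rewrite (xsP _ _ vgr vx vy) /=; clear -kT; lia.
  apply/or3P/Or33 => /=; rewrite ltnNge; apply/negP => qv; apply: nr; exists k => //.
  by rewrite -vy.
have rB2' v : occurs r v -> v \in B2 by case: v => z k; apply: rB2.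
have [s1 [w [s2 [B2E ws1]]]] := relation_acls evC (elimN eqP rn0) r0 rB2'.
(* The relation [r] makes one entry of [B2] redundant; the rest still generates [B1] algebraically
   but is shorter than this independent list. *)
pose D := s1 ++ s2.
have B2D v : v \in B2 -> acls c (map b D) (b v).
  have s1D w' : acls c (map b s1) w' -> acls c (map b D) w'.
    by apply: acls_sub => ?; rewrite map_cat mem_cat => ->.
  rewrite B2E mem_cat inE => /or3P[vs|/eqP->|vs].
  - by apply: acls_mem; apply: map_f; rewrite mem_cat vs.
  - exact: s1D.
  - by apply: acls_mem; apply: map_f; rewrite mem_cat vs orbT.
(* The i-th transform of [g] is an equation for (y, q + i) over [D] and lower transforms of [y]. Its
   leading coefficient is the i-th transform of that of [g], so its value is nonzero. *)
have colD i : (i <= T)%N -> acls c (map b D) (b (y, (q + i)%N)).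
  elim/ltn_ind: i => i IH iT.
  apply: (@root_acls _ _ c _ ev evC D (iter i (mshift s) g) (y, q + i)%N
    (size (upoly (y, q) g)).-1).
  - by elim: (i) => [|j]; rewrite //= => /shift_ev.
  - rewrite upoly_iter_mshift.
    have := min_order_lead gi g0 gx minx gy.1.
    by rewrite lead_coefE; elim: (i) => [|j] //= IHj /IHj /ev_shift.
  - move=> [z k'] /occurs_iter_mshift[k [/= -> gk]] vy.
    have vgr : occurs g (z, k) || occurs r (z, k) by rewrite gk.
    have kT := leT _ _ vgr.
    have [zx|zx] := eqVneq z x.
      apply: B2D; rewrite !mem_cat OE !colE zx eqxx /=.
      have km : (k <= m)%N by apply: gx.2; rewrite -zx.
      by apply/or3P/Or32 => /=; clear -km iT; lia.
    have [zy|zy] := eqVneq z y; last first.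
      apply: B2D; rewrite !mem_cat OE !colE (xsP _ _ vgr zx zy).
      by apply/or3P/Or31 => /=; clear -kT iT; lia.
    have kq : (k <= q)%N by apply: gy.2; rewrite -zy.
    have {}kq : (k < q)%N.
      rewrite ltn_neqAle kq andbT; apply: contraNneq vy => ->.
      by rewrite zy.
    have [kiq|qki] := ltnP (k + i) q.
      by apply: B2D; rewrite !mem_cat !colE zy eqxx kiq !orbT.
    rewrite zy -(subnKC qki); apply: IH; clear -kq qki iT; lia.
have : (size (map b B1) <= size (map b D))%N.
  apply: (steinitz iB1) => _ /mapP[[z k] vB1 ->]; rewrite cats0.
  move: vB1; rewrite !mem_cat OE !colE => /or3P[vO|/andP[/eqP vx vm]|/andP[/eqP vy vq]].
  - by apply: B2D; rewrite !mem_cat OE vO.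
  - by apply: B2D; rewrite !mem_cat !colE vx eqxx ltn_addr ?orbT.
  - have [vq'|vq'] := ltnP k q.
      by apply: B2D; rewrite !mem_cat !colE vy eqxx vq' !orbT.
    rewrite vy -(subnKC vq'); apply: colD; clear -vq vq'; lia.
by rewrite !size_map sB B2E !size_cat /=; clear; lia.
Qed.

(** Take the least order in [x], then the least total degree. One factor of a product in the prime
    kernel is again in the kernel, with no larger order, so by minimality of the degree the other
    factor is constant. *)
Lemma exists_minimal x : (exists2 p, ev p = 0 & p != 0) ->
  (forall p, ev p = 0 -> p != 0 -> exists k, occurs p (x, k)) ->
  exists g m, [/\ irreducible_elt g, ev g = 0, order_at g x m & min_order x m].
Proof.
move=> [p0 evp0 p0n] xP.
pose le_order p m := forall k, occurs p (x, k) -> (k <= m)%N.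
have em : exists m, `[< exists p, [/\ ev p = 0, p != 0 & le_order p m] >].
  have [t tP] := finite_occurs p0; exists (\max_(v <- t) v.2)%N.
  apply/asboolP; exists p0; split=> // k /tP kt.
  exact: (@leq_bigmax_seq _ _ xpredT (fun v : X * nat => v.2) (x, k) kt isT).
case: (ex_minnP em) => m /asboolP[p1 [evp1 p1n p1m]] mmin.
have et : exists t, `[< exists p, [/\ ev p = 0, p != 0, le_order p m & tdeg p = t] >].
  by exists (tdeg p1); apply/asboolP; exists p1.
case: (ex_minnP et) => t /asboolP[g [g0 gn0 gm gt]] tmin.
have minx : min_order x m.
  move=> r r0 rn0; apply: contrapT => nr; have [k rk] := xP r r0 rn0.
  have km : (k < m)%N by rewrite ltnNge; apply/negP => mk; apply: nr; exists k.
  have /mmin : `[< exists p, [/\ ev p = 0, p != 0 & le_order p m.-1] >].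
    apply/asboolP; exists r; split=> // l rl; rewrite -ltnS prednK; last by lia.
    by rewrite ltnNge; apply/negP => ml; apply: nr; exists l.
  by lia.
exists g, m; split=> //; last first.
  by split=> //; have [k mk gk] := minx g g0 gn0; have := gm _ gk; move=> km;
     have -> : m = k by apply/eqP; rewrite eqn_leq mk km.
split=> [|a b gE].
  by apply/negP => /(rmorph_unit ev); rewrite g0 unitr0.
have [an0 bn0] : a != 0 /\ b != 0 by apply/andP; rewrite -negb_or -mulf_eq0 -gE.
have factor_unit u v : g = u * v -> u != 0 -> v != 0 -> ev u = 0 -> v \is a GRing.unit.
  move=> guv un0 vn0 u0.
  have /tmin : `[< exists p, [/\ ev p = 0, p != 0, le_order p m & tdeg p = tdeg u] >].
    apply/asboolP; exists u; split=> // k uk; apply: gm.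
    by rewrite guv occurs_mul // uk.
  rewrite -gt guv tdegM // -{2}[tdeg u]addn0 leq_add2l leqn0 => /eqP/tdeg0[d dE].
  rewrite dE; apply: unit_mC; apply: contraNneq vn0 => d0.
  by rewrite dE d0 mC0.
move: g0; rewrite gE rmorphM => /eqP; rewrite mulf_eq0 => /orP[]/eqP e0.
  by right; apply: (factor_unit a).
by left; apply: (factor_unit b) => //; rewrite mulrC.
Qed.

End MinimalRelation.

(** * Divisibility by the lowest relation, and weights *)

Section LowestRelation.
Variables (F K : fieldType) (c : {rmorphism F -> K}) (X : choiceType).
Local Notation S := (mpol F (X * nat)%type).
Variables (s : {rmorphism F -> F}) (ev : {rmorphism S -> K}).
Hypothesis evC : forall a, ev (mC a) = c a.
Hypothesis ev_shift : forall p, ev p != 0 -> ev (mshift s p) != 0.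
Hypothesis shift_ev : forall p, ev p = 0 -> ev (mshift s p) = 0.

Lemma exists_greatest (T : eqType) (lt : rel T) (r : seq T) :
  transitive lt -> (forall v w, v != w -> lt v w || lt w v) -> r != [::] ->
  exists2 v, v \in r & forall w, w \in r -> w = v \/ lt w v.
Proof.
move=> tr tot; elim: r => // v [|u r] IH _.
  by exists v; rewrite ?mem_head // => w; rewrite inE => /eqP; left.
have [//|w wr wP] := IH; have [vw|vw] := eqVneq v w.
  exists v; rewrite ?mem_head // => w'; rewrite inE => /predU1P[|/wP]; first by left.
  by rewrite vw.
case/orP: (tot _ _ vw) => [vltw|wltv].
  exists w; first by rewrite inE wr orbT.
  by move=> w'; rewrite inE => /predU1P[->|/wP//]; right.
exists v; rewrite ?mem_head // => w'; rewrite inE => /predU1P[|/wP[->|w'w]]; first by left.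
  by right.
by right; apply: tr wltv.
Qed.

Lemma ranking_ltn (lt : rel (X * nat)) x (k l : nat) :
  ranking lt -> (k < l)%N -> lt (x, k) (x, l).
Proof.
move=> [[_ tr] _ succ _]; elim: l => // l IH; rewrite ltnS leq_eqVlt.
by case/predU1P => [->|/IH kl]; [exact: succ (x, l)|apply: tr kl (succ (x, l))].
Qed.

(** [G] is lowest for the ranking, whereas divisibility needs minimal order in an indeterminate. A
    relation [g] of minimal order in [x] has minimal order in all its indeterminates; it turns out
    to have the leader of [G] and to be associated with it. *)
Lemma lowest_relation_dvd (lt : rel (X * nat)) G v x p y q :
  ranking lt -> irreducible_elt G -> ev G = 0 ->
  occurs G v -> (forall w, occurs G w -> w = v \/ lt w v) ->
  (forall r, ev r = 0 -> r != 0 -> exists2 w, occurs r w & ~~ lt w v) ->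
  (forall r, ev r = 0 -> r != 0 -> exists k, occurs r (x, k)) ->
  order_at G y q -> ev p = 0 -> (forall k, occurs p (y, k) -> (k <= q)%N) ->
  dvdr G p.
Proof.
move=> lt_r Gi G0 Gv vmax low xP [Gq Gmax] p0 pq.
have [[irr tr] tot _ _] := lt_r.
have Gn0 := irreducible_neq0 Gv.
have [|g [m [gi g0 gx minx]]] := exists_minimal _ xP; first by exists G.
have gn0 := irreducible_neq0 gx.1.
have min_g z k : order_at g z k -> min_order ev z k.
  move=> gz; have [zx|zx] := eqVneq z x; last exact: (min_order_transfer evC ev_shift shift_ev gi g0 gx).
  have -> : k = m; last by rewrite zx.
  apply/eqP; rewrite eqn_leq; case: gx gz => [gm mm]; rewrite zx => -[gk kk].
  by rewrite (mm _ gk) (kk _ gm).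
have [w0 gw0 w0v] := low g g0 gn0.
have [l lP] := finite_occurs g.
have [|[b o] + wP] := @exists_greatest _ lt [seq w <- l | occurs g w] tr tot.
  have : w0 \in [seq w <- l | occurs g w] by rewrite mem_filter gw0 lP.
  by case: [seq w <- l | occurs g w].
rewrite mem_filter => /andP[gbo _].
have wmax w : occurs g w -> w = (b, o) \/ lt w (b, o).
  by move=> gw; apply: wP; rewrite mem_filter gw lP.
have bo_top : order_at g b o.
  split=> // k /wmax[[->//]|kb]; rewrite leqNgt; apply/negP => /(ranking_ltn b lt_r) ok.
  by move: (tr _ _ _ kb ok); rewrite irr.
(* By minimality [G] contains a transform of [b] of order at least [o], so the leader (b, o) of [g]
   is not above [v]; by [low] it is not below [v] either. *)
have [k ok Gk] := min_g _ _ bo_top G G0 Gn0.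
have bk : (b, o) = (b, k) \/ lt (b, o) (b, k).
  by move: ok; rewrite leq_eqVlt => /predU1P[->|/(ranking_ltn b lt_r)]; [left|right].
have vbo : v = (b, o).
  have nvb : ~~ lt (b, o) v.
    apply: contraNN w0v => bov; case: (wmax _ gw0) => [->//|w0b].
    exact: tr bov.
  case: (vmax _ Gk) => [e|kv].
    by case: bk => [bk|bk]; [rewrite -e -bk|move: nvb; rewrite -e bk].
  case: bk => [bk|bk]; first by move: nvb; rewrite bk kv.
  by move: nvb; rewrite (tr _ _ _ bk kv).
have gG : dvdr g G.
  apply: (min_order_dvd gi g0 bo_top (min_g _ _ bo_top) G0) => j Gj.
  rewrite leqNgt; apply/negP => /(ranking_ltn b lt_r) oj.
  case: (vmax _ Gj) => [e|jv]; first by move: oj; rewrite e vbo irr.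
  by move: (tr _ _ _ oj jv); rewrite vbo irr.
case: gG => h GE; have hu : h \is a GRing.unit.
  by case: (Gi.2 _ _ GE) => // gu; case: gi; rewrite gu.
have hn0 : h != 0 by apply: contraNneq Gn0 => h0; rewrite GE h0 mul0r.
(* A unit contains no variable, since the variables of a factor survive in the product
   [h * h^-1 = 1]. *)
have hocc z : occurs h z = false.
  apply/negP => hz; have : occurs (h * h^-1) z by rewrite occurs_mul ?invr_eq0 // hz.
  by rewrite divrr // occurs1.
have GEo z : occurs G z = occurs g z by rewrite GE occurs_mul // hocc.
have gy : order_at g y q by split=> [|j]; rewrite -GEo //; apply: Gmax.
have [e ->] := min_order_dvd gi g0 gy (min_g _ _ gy) p0 pq.
by exists (e * h^-1); rewrite GE mulrA mulrVK.
Qed.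

End LowestRelation.

(** * Homogeneous components, derivatives and Euler's formula *)

Section Weights.
Variables (F : fieldType) (Z : choiceType).
Implicit Types (p q : mpol F Z) (z : Z) (w : Z -> nat).

(** Components are homogeneous: weighing twice with two markers is weighing once with their product
    as marker, which is the substitution [psi]. *)
Lemma wpoly_coefK w p e :
  wpoly w (wpoly w p)`_e = ((wpoly w p)`_e)%:P * 'X^e.
Proof.
pose psi : {rmorphism {poly mpol F Z} -> {poly {poly mpol F Z}}} :=
  horner_eval ('X%:P * 'X) \o map_poly (polyC \o polyC).
have psiE (q : {poly mpol F Z}) i : (psi q)`_i = (q`_i)%:P * 'X^i.
  rewrite /psi /= /horner_eval horner_poly coef_sum.
  under eq_bigr => j _ do rewrite /= exprMn -rmorphXn /= mulrA -rmorphM /= coefCM coefXn.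
  have [iq|iq] := ltnP i (size q); last first.
    rewrite nth_default // polyC0 mul0r big1 // => j _; case: eqP => [e'|]; last by rewrite mulr0.
    by move: (ltn_ord j); rewrite -e' ltnNge iq.
  rewrite (bigD1 (Ordinal iq)) //= eqxx mulr1 big1 ?addr0 // => j ji.
  by case: eqP => [e'|]; rewrite ?mulr0 //; case/eqP: ji; apply: val_inj.
have H : map_poly (wpoly w) \o wpoly w =1 psi \o wpoly w.
  apply: mpol_hom_eq => [a|z]; rewrite /psi /= /horner_eval.
    by rewrite !wpolyC !map_polyC /= hornerC !wpolyC.
  rewrite wpolyX !rmorphM /= !map_polyC /= !map_polyXn hornerM hornerC hornerXn wpolyX.
  by rewrite exprMn mulrA rmorphM -rmorphXn.
by rewrite -coef_map (H p : map_poly _ _ = _) psiE.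
Qed.

(** A nonzero multiple of [p] has at least the top weight of [p], so only the top component of [p]
    can be nonzero. *)
Lemma homogeneous_of_dvd w p : p != 0 ->
  (forall e, dvdr p (wpoly w p)`_e) -> exists r, wpoly w p = p%:P * 'X^r.
Proof.
move=> p0 pd; set f := wpoly w p.
have f0 : f != 0 by apply: contraNneq p0 => /wpoly_inj->.
have top e : f`_e != 0 -> (size f <= e.+1)%N.
  move=> fe; have [h hE] := pd e; have := wpoly_coefK w p e.
  rewrite -/f hE rmorphM -/f -hE => /(congr1 (size : {poly _} -> nat)).
  have h0 : wpoly w h != 0.
    by apply: contraNneq fe => /wpoly_inj h0; rewrite /f hE h0 mul0r.
  rewrite size_mul // size_mulXn ?polyC_eq0 // size_polyC fe.
  move: h0; rewrite -size_poly_gt0; move: (size _) (size f) => a b; lia.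
exists (size f).-1.
have fE : f = (f`_(size f).-1)%:P * 'X^((size f).-1).
  apply/polyP => i; rewrite coefCM coefXn; case: eqP => [->|ni]; first by rewrite mulr1.
  rewrite mulr0; apply/eqP/negPn/negP => fi; have si := top _ fi.
  have il : (i < size f)%N.
    by rewrite ltnNge; apply/negP => ?; move: fi; rewrite nth_default ?eqxx.
  by apply: ni; move: si il; move: (size f) => a; lia.
have pE : p = f`_(size f).-1.
  rewrite -[LHS](wpoly_horner w) -/f [in LHS]fE.
  by rewrite hornerM hornerC hornerXn expr1n mulr1.
exact: (etrans fE (congr1 (fun q => q%:P * 'X^((size f).-1)) (esym pE))).
Qed.

(** Computed in the univariate view, so that the product rule is inherited; [Mpol_dpartial]
    identifies it with the formal derivative of the statement. *)
Definition mder z p : mpol F Z := (upoly z p)^`().[mX z].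

Lemma mderC z a : mder z (mC a) = 0.
Proof. by rewrite /mder upolyC derivC horner0. Qed.

Lemma mderX z v : mder z (mX v) = (v == z)%:R.
Proof.
by rewrite /mder upolyX; case: eqP => _; rewrite ?derivX ?derivC ?hornerC ?horner0.
Qed.

Lemma mderD z p q : mder z (p + q) = mder z p + mder z q.
Proof. by rewrite /mder rmorphD derivD hornerD. Qed.

Lemma mderM z p q : mder z (p * q) = mder z p * q + p * mder z q.
Proof. by rewrite /mder rmorphM derivM hornerD !hornerM !upoly_horner. Qed.

Lemma mder0 z : mder z 0 = 0.
Proof. by rewrite -[X in mder z X]mC0 mderC. Qed.

Lemma mder_sum z (I : Type) (r : seq I) (f : I -> mpol F Z) :
  mder z (\sum_(i <- r) f i) = \sum_(i <- r) mder z (f i).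
Proof. exact: (big_morph _ (mderD z) (mder0 z)). Qed.

Lemma mder_occurs z p v : occurs (mder z p) v -> occurs p v.
Proof.
have [_ H] : (forall u, occurs p u -> occurs p u) /\
  (forall u, occurs (mder z p) u -> occurs p u); last exact: H.
apply: (mpol_ind_in (D := occurs p) (Q := fun q =>
  (forall u, occurs q u -> occurs p u) /\
  (forall u, occurs (mder z q) u -> occurs p u)));
  [move=> a|move=> u pu|move=> q r [Hq Hq'] [Hr Hr']|move=> q r [Hq Hq'] [Hr Hr']|by []].
- by rewrite mderC; split=> u; rewrite ?occursC ?occurs0.
- rewrite mderX; split=> u'; first by rewrite occursX => /eqP<-.
  by case: eqP => _; rewrite ?occurs1 ?occurs0.
- by rewrite mderD; split=> u /occursD/orP[]; auto.
- rewrite mderM; split=> u; first by case/occursM/orP; auto.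
  by case/occursD/orP => /occursM/orP[]; auto.
Qed.

Definition coef_mder z (f : {poly mpol F Z}) := \poly_(i < size f) mder z f`_i.

Lemma coef_mderE z f i : (coef_mder z f)`_i = mder z f`_i.
Proof. by rewrite coef_poly; case: ltnP => // si; rewrite nth_default // mder0. Qed.

Lemma coef_mderM z f g :
  coef_mder z (f * g) = coef_mder z f * g + f * coef_mder z g.
Proof.
apply/polyP => i; rewrite coef_mderE coefD !coefM mder_sum -big_split /=.
by apply: eq_bigr => j _; rewrite mderM !coef_mderE.
Qed.

(** Differentiation by a variable of weight one lowers the weight by one; the factor 'X avoids
    negative exponents. *)
Lemma wpoly_mder w z p : w z = 1%N ->
  'X * wpoly w (mder z p) = coef_mder z (wpoly w p).
Proof.
move=> wz; elim/mpol_ind: p => [a|v|p q IHp IHq|p q IHp IHq].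
- rewrite mderC rmorph0 mulr0; apply/polyP => i; rewrite coef0 coef_mderE wpolyC coefC.
  by case: eqP => _; rewrite ?mderC ?mder0.
- apply/polyP => i; rewrite coef_mderE mderX wpolyX coefCM coefXn.
  case: eqP => [->|/eqP vz]; rewrite ?rmorph1 ?rmorph0 ?mulr1 ?mulr0 ?coefX ?coef0 ?wz.
    by case: eqP; rewrite ?mulr0 ?mulr1 ?mder0 ?mderX ?eqxx.
  by case: eqP; rewrite ?mulr0 ?mulr1 ?mder0 ?mderX ?(negbTE vz).
- rewrite mderD !rmorphD mulrDr IHp IHq; apply/polyP => i.
  by rewrite coefD !coef_mderE coefD mderD.
- rewrite mderM rmorphD !rmorphM mulrDr mulrA IHp mulrCA IHq.
  by rewrite coef_mderM.
Qed.

Lemma homogeneous_mder w z p r : w z = 1%N -> wpoly w p = p%:P * 'X^r ->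
  'X * wpoly w (mder z p) = (mder z p)%:P * 'X^r.
Proof.
move=> wz pr; rewrite (wpoly_mder _ wz) pr; apply/polyP => i.
rewrite [RHS]coefCM [LHS]coef_mderE [X in mder z X = _]coefCM coefXn.
by case: eqP => _; rewrite ?mulr1 ?mulr0 ?mder0.
Qed.

(* A nonzero multiple of p has weight at least that of p, whereas D lowers the
   weight by one. *)
Lemma homogeneous_dvd_eq0 w p q r : p != 0 -> wpoly w p = p%:P * 'X^r ->
  'X * wpoly w q = q%:P * 'X^r -> dvdr p q -> q = 0.
Proof.
move=> p0 pr qr [h qE]; apply/eqP/negPn/negP => q0.
have h0 : wpoly w h != 0.
  by apply: contraNneq q0 => /wpoly_inj h0; rewrite qE h0 mul0r.
move: qr => /(congr1 (size : {poly _} -> nat)).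
rewrite {1}qE rmorphM pr mulrA size_mulXn ?polyC_eq0 // size_polyC q0.
rewrite mulrA size_mulXn; last by rewrite !mulf_neq0 ?polyX_eq0 ?polyC_eq0.
rewrite mulrC size_Cmul // mulrC size_mulX //.
by move: h0; rewrite -size_poly_gt0; move: (size _) => a; lia.
Qed.

(** Differentiate [wpoly w p] with respect to the marker and set the marker to 1: on any polynomial
    this gives the Euler operator. *)
Lemma euler w (I : finType) (b : I -> Z) p r : injective b ->
  (forall z, w z = [exists i, b i == z]) ->
  wpoly w p = p%:P * 'X^r -> \sum_i mX (b i) * mder (b i) p = p *+ r.
Proof.
move=> bI wb pr.
have E q : ((wpoly w q)^`()).[1] = \sum_i mX (b i) * mder (b i) q.
  elim/mpol_ind: q => [a|z|q q' IHq IHq'|q q' IHq IHq'].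
  - rewrite wpolyC derivC horner0 big1 // => i _; by rewrite mderC mulr0.
  - rewrite wpolyX derivM derivC mul0r add0r derivXn hornerM hornerC hornerMn hornerXn.
    rewrite expr1n wb; case: existsP => [[i /eqP bi]|nb].
      rewrite (bigD1 i) //= -bi mderX eqxx mulr1n big1 ?addr0 // => j ji.
      by rewrite mderX (inj_eq bI) eq_sym (negbTE ji) mulr0.
    rewrite mulr0n mulr0 big1 // => i _; rewrite mderX; case: eqP => [e|]; last by rewrite mulr0.
    by case: nb; exists i; rewrite e.
  - by rewrite rmorphD derivD hornerD IHq IHq' -big_split; apply: eq_bigr => i _; rewrite mderD mulrDr.
  - rewrite rmorphM derivM hornerD !hornerM !wpoly_horner IHq IHq' mulr_suml mulr_sumr -big_split.
    by apply: eq_bigr => i _; rewrite mderM mulrDr mulrA mulrCA.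
rewrite -E pr derivM derivC mul0r add0r derivXn hornerM hornerC hornerMn hornerXn.
by rewrite expr1n mulr_natr.
Qed.

(** The substitution z -> z + t y_z, with t the variable of the target; its part linear in t is the
    derivation sending z to y_z. *)
Definition perturb (y : Z -> mpol F Z) : {rmorphism mpol F Z -> {poly mpol F Z}} :=
  mev (polyC \o @mC F Z) (fun z => (mX z)%:P + (y z)%:P * 'X).

Lemma perturb_coef0 y p : (perturb y p)`_0 = p.
Proof.
rewrite -horner_coef0.
apply: (@mpol_hom_eq F _ Z (horner_eval 0 \o perturb y) idfun) => [a|z] /=.
  by rewrite /perturb mevC /= /horner_eval hornerC.
by rewrite /perturb mevX /horner_eval hornerD hornerMX mulr0 addr0 hornerC.
Qed.

Lemma perturb_coef1 (I : finType) (b : I -> Z) (t : I -> mpol F Z) y p :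
  (forall z, y z = \sum_i (z == b i)%:R * t i) ->
  (perturb y p)`_1 = \sum_i t i * mder (b i) p.
Proof.
move=> yE; elim/mpol_ind: p => [a|z|p q IHp IHq|p q IHp IHq].
- by rewrite /perturb mevC coefC /= big1 // => i _; rewrite mderC mulr0.
- rewrite /perturb mevX coefD coefC coefCM coefX /= add0r mulr1 yE.
  by apply: eq_bigr => i _; rewrite mderX mulrC.
- by rewrite rmorphD coefD IHp IHq -big_split; apply: eq_bigr => i _; rewrite mderD mulrDr.
- rewrite rmorphM coefM big_ord_recr big_ord1 /= subn0 subnn !perturb_coef0 IHp IHq.
  rewrite mulr_suml mulr_sumr -big_split; apply: eq_bigr => i _.
  by rewrite mderM mulrDr mulrA mulrCA addrC.
Qed.

(** [f k.+1] is [wpoly (w k)] followed by [f k] on coefficients and by t -> l k, so each step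
    contributes one power of [l k]. *)
Lemma homogeneous_prod (S : comNzRingType) (f : nat -> {rmorphism mpol F Z -> S})
    (w : nat -> Z -> nat) (l : nat -> S) (r : nat -> nat) p n :
  (forall k a, f k (mC a) = f 0%N (mC a)) ->
  (forall k z, f k.+1 (mX z) = f k (mX z) * l k ^+ w k z) ->
  (forall k, wpoly (w k) p = p%:P * 'X^(r k)) ->
  f n p = (\prod_(k < n) l k ^+ r k) * f 0%N p.
Proof.
move=> fC fX pr; elim: n => [|n IH]; first by rewrite big_ord0 mul1r.
have -> : f n.+1 p = (horner_eval (l n) \o map_poly (f n) \o wpoly (w n)) p.
  apply: mpol_hom_eq => [a|z] /=.
    by rewrite wpolyC map_polyC /horner_eval hornerC fC -(fC n).
  by rewrite wpolyX rmorphM /= map_polyC map_polyXn /horner_eval hornerM hornerC hornerXn fX.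
rewrite /= pr rmorphM /= map_polyC map_polyXn /horner_eval hornerM hornerC hornerXn.
by rewrite /= IH big_ord_recr /= mulrAC.
Qed.

End Weights.

(** * Transformal transcendence degree *)

Section MoreEval.

Lemma mev_coef (R S : comNzRingType) (Z : choiceType) (f : {rmorphism R -> S})
    (p : mpol R Z) (m : {cmonom Z}) :
  (mpol_val (mev (@mC S Z \o f) mX p))@_m = f ((mpol_val p)@_m).
Proof.
have E (a : S) (k : {cmonom Z}) : (mpol_val (mC a * mU k))@_m = a *+ (k == m).
  rewrite mCE mU.unlock rmorphM /= mcoeffCM mcoeffU.
  by rewrite mulrnAr mulr1.
rewrite [X in mev _ _ X]mpolE !rmorph_sum /= raddf_sum /=.
under eq_bigr => k _ do rewrite rmorphM mevC mevU mX_monom E.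
have [mp|mp] := boolP (m \in msupp (mpol_val p)).
  rewrite (big_fsetD1 m) //= eqxx mulr1n big1_seq ?addr0 // => k.
  by rewrite !inE => /andP[_ /andP[/negbTE-> _]].
rewrite (mcoeff_outdom mp) rmorph0 big1_seq // => k /andP[_ kp].
by case: eqP => // km; move: mp; rewrite -km kp.
Qed.

(** Coefficients with respect to a shifted variable are shifts of coefficients, so the variables can
    be removed one by one down to constants. *)
Lemma mshift_inj (F : fieldType) (s : {rmorphism F -> F}) (X : choiceType)
  (p : mpol F (X * nat)%type) : mshift s p = 0 -> p = 0.
Proof.
have [l] := finite_occurs p; elim: l p => [|[x k] l IH] p pl p0.
  have [|a e] := @not_occurs_const _ _ p; first by move=> z; apply/negP => /pl.
  move: p0; rewrite e mshiftC => /(congr1 (fun q => (mpol_val q)@_mone)).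
  rewrite mCE /= mcoeffC eqxx mulr1n rmorph0 mcoeff0 => /eqP.
  by rewrite fmorph_eq0 => /eqP->; rewrite mC0.
apply: (@upoly_inj _ _ (x, k)); apply/polyP => i; rewrite coef0.
apply: IH => [z /upoly_coef_occurs[zx /pl]|]; first by rewrite inE (negbTE zx).
by rewrite -coef_map -upoly_mshift p0 rmorph0 coef0.
Qed.

Lemma iter_mshiftX (F : fieldType) (s : {rmorphism F -> F}) (X : choiceType)
  (x : X) i k : iter i (mshift s) (mX (x, k)) = mX (x, k + i)%N.
Proof. by elim: i => [|i IH] /=; rewrite ?addn0 // IH mshiftX addnS. Qed.

Lemma mpol_hom_congr (R S : comNzRingType) (Z : choiceType) (I : S -> Prop)
    (f g : {rmorphism mpol R Z -> S}) :
  (forall p q, I p -> I q -> I (p + q)) -> (forall p q, I q -> I (p * q)) -> I 0 ->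
  (forall a, f (mC a) = g (mC a)) -> (forall z, I (f (mX z) - g (mX z))) ->
  forall p, I (f p - g p).
Proof.
move=> ID IM I0 fgC fgX; elim/mpol_ind => [a|//|p q IHp IHq|p q IHp IHq].
- by rewrite fgC subrr.
- by rewrite !rmorphD opprD addrACA; apply: ID.
- have -> : f (p * q) - g (p * q) = f p * (f q - g q) + g q * (f p - g p).
    by rewrite !rmorphM !mulrBr addrA [g q * f p]mulrC subrK [g q * _]mulrC.
  by apply: ID; apply: IM.
Qed.

End MoreEval.

Section TransformalDimension.
Variables (F L : fieldType) (c : {rmorphism F -> L}).
Variables (s : {rmorphism F -> F}) (sL : {rmorphism L -> L}).
Hypothesis cs : forall a, c (s a) = sL (c a).

Lemma acls_shift B x : acls c B x -> acls c (map sL B) (sL x).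
Proof.
move=> [p [p0 pB px]]; exists (map_poly sL p); split.
- by move/eqP; rewrite map_poly_eq0 => /eqP.
- move=> i; rewrite coef_map; apply: (pB i (fun y => adjoin c (fun z => z \in map sL B) (sL y))).
  + have [E1 EB ED] := adjoin_subfield c (fun z => z \in map sL B).
    by split=> [|y z yE zE|y z yE zE]; rewrite ?rmorph1 ?rmorphB ?fmorph_div //; auto.
  + by move=> a; rewrite -cs; apply: adjoin_const.
  + by move=> y yB; apply: adjoin_mem; apply: map_f.
- by rewrite rootE horner_map (rootP px) rmorph0.
Qed.

Lemma acls_iter_shift i B x : acls c B x -> acls c (map (iter i sL) B) (iter i sL x).
Proof.
move=> xB; elim: i => [|i IH]; first by rewrite map_id.
rewrite (_ : map _ B = map sL (map (iter i sL) B)); first exact: acls_shift.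
by rewrite -map_comp.
Qed.

Variables (n : nat) (eta : 'I_n -> L).
Let y (v : 'I_n * nat) := iter v.2 sL (eta v.1).
Let ev : {rmorphism mpol F ('I_n * nat)%type -> L} := mev c y.

Let evC a : ev (mC a) = c a. Proof. exact: mevC. Qed.
Let evX v : ev (mX v) = y v. Proof. exact: mevX. Qed.
Let y_shift i j k : iter i sL (y (j, k)) = y (j, k + i)%N.
Proof. by rewrite /y /= -iterD addnC. Qed.

Definition transf_indep (M : {set 'I_n}) : Prop :=
  forall p, (forall v, occurs p v -> v.1 \in M) -> ev p = 0 -> p = 0.

Section Count.
Variable M : {set 'I_n}.
Hypothesis indM : transf_indep M.
Hypothesis maxM : forall j, j \notin M -> ~ transf_indep (j |: M).

Let col (A : {set 'I_n}) o := [seq y (j, k) | j <- enum A, k <- iota 0 o].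

Let col_mem (A : {set 'I_n}) o j k : j \in A -> (k < o)%N -> y (j, k) \in col A o.
Proof.
by move=> jA ko; apply/allpairsP; exists (j, k); rewrite mem_enum mem_iota.
Qed.

(** Maximality of [M] gives a relation between transforms of coordinates in [M] and of the
    coordinate [j]. The former are listed first, so that the dependent entry has to be a transform
    of [j]. *)
Lemma coordinate_relation j : exists o k, (k < o)%N /\
  acls c (col M o ++ [seq y (j, l) | l <- iota 0 k]) (y (j, k)).
Proof.
have [jM|jM] := boolP (j \in M).
  by exists 1%N, 0%N; split=> //; apply: acls_mem; rewrite mem_cat col_mem.
have /existsNP[p /not_implyP[pM /not_implyP[p0 pn0]]] := maxM jM.
have [o pk] : exists o, forall (i : 'I_n) (k : nat), occurs p (i, k) -> (k < o)%N.
  have [l lP] := finite_occurs p; exists (\max_(v <- l) v.2).+1 => i k /lP vl.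
  rewrite ltnS.
  exact: (@leq_bigmax_seq _ _ xpredT (fun v : 'I_n * nat => v.2) (i, k) vl isT).
pose A := [seq (i, k) | i <- enum M, k <- iota 0 o].
have AP (i : 'I_n) (k : nat) : ((i, k) \in A) = (i \in M) && (k < o)%N.
  apply/allpairsP/andP => [[[i' k'] [/= iM + [-> ->]]]|[iM ko]].
    by rewrite mem_iota -mem_enum => /andP[_ ?].
  by exists (i, k); rewrite mem_enum mem_iota.
have uA : uniq A.
  by rewrite allpairs_uniq ?enum_uniq ?iota_uniq // => -[? ?] [? ?] _ _ [-> ->].
have pA v : occurs p v -> v \in A ++ [seq (j, k) | k <- iota 0 o].
  case: v => i k pv; have ko := pk _ _ pv; rewrite mem_cat AP ko andbT.
  have := pM _ pv; rewrite !inE /= => /predU1P[->|->//].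
  by apply/orP; right; apply: map_f; rewrite mem_iota.
have [s1 [v [s2 [e vs1]]]] := relation_acls evC pn0 p0 pA.
have usA : uniq (A ++ [seq (j, k) | k <- iota 0 o]).
  rewrite cat_uniq uA map_inj_uniq ?iota_uniq; last by move=> ? ? [].
  by rewrite andbT; apply/hasPn => _ /mapP[k _ ->]; rewrite AP (negbTE jM).
have vs1N : v \notin s1.
  by move: usA; rewrite e cat_uniq /= negb_or => /and3P[_ /andP[]].
have /= := congr1 (fun t => nth v t (size s1)) e.
rewrite nth_cat [in RHS]nth_cat ltnn subnn /=.
(* A dependent entry in the first part of the list would contradict the independence of [M]. *)
have [s1A|As1] := ltnP (size s1) (size A).
  move=> vA.
  have [q [qn0 q0 qs]] := acls_relation evC vs1N vs1.
  have s1E : take (size s1) A = s1.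
    by rewrite -[RHS](take_size_cat (v :: s2) (erefl (size s1))) -e takel_cat // ltnW.
  case: qn0; apply: indM q0 => -[i k] /qs; rewrite inE.
  have inA u : u \in v :: s1 -> u \in A.
    rewrite inE => /predU1P[->|]; first by rewrite -vA mem_nth.
    by rewrite -s1E; apply: mem_take.
  by move=> /(inA (i, k)); rewrite AP => /andP[].
set r := (size s1 - size A)%N => vr.
have ro : (r < o)%N.
  have := congr1 size e; rewrite !size_cat size_map size_iota /= => se.
  by rewrite /r ltn_subLR // se -addSnnS leq_addr.
exists o, r; split=> //.
have vE : v = (j, r).
  by rewrite -vr (nth_map 0%N) ?size_iota // nth_iota.
have s1E : s1 = A ++ [seq (j, k) | k <- iota 0 r].
  have := take_size_cat (v :: s2) (erefl (size s1)); rewrite -e.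
  rewrite take_cat ltnNge As1 /= -/r -map_take take_iota.
  by rewrite (minn_idPl (ltnW ro)) => ->.
move: vs1; rewrite vE evX; apply: acls_sub => u; rewrite s1E map_cat !mem_cat.
case/orP => [/mapP[[i k]]|/mapP[w /mapP[k kr ->] ->]].
  by rewrite AP evX => /andP[iM ko] ->; rewrite col_mem.
by rewrite evX; apply/orP; right; apply: (map_f (fun l => y (j, l))).
Qed.

Let B o o' t := col M (o + t) ++ col setT o'.

(** Applying [sL] repeatedly to the relations of the preceding lemma shows that a fixed initial part
    of all columns, with the growing columns of [M], generates every transform algebraically. *)
Lemma coordinates_acl : exists o, forall j t, acls c (B o o t) (y (j, t)).
Proof.
have [o oP] : exists o, forall j, exists2 k, (k < o)%N &
    acls c (col M o ++ [seq y (j, l) | l <- iota 0 k]) (y (j, k)).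
  have /choice[f fP] := coordinate_relation.
  exists (\max_j f j)%N => j; have [k [kf ka]] := fP j; exists k.
    by rewrite (leq_trans kf) // leq_bigmax.
  apply: acls_sub ka => u; rewrite !mem_cat => /orP[|->]; last by rewrite orbT.
  move=> /allpairsP[[i l] [/= iM li ->]]; rewrite col_mem //; first by rewrite -mem_enum.
  by move: li; rewrite mem_iota => /andP[_ lf]; apply: leq_trans lf (leq_bigmax _).
exists o => j t; elim/ltn_ind: t => t IH.
have [to|ot] := ltnP t o; first by apply: acls_mem; rewrite mem_cat orbC col_mem // inE.
have [k ko ka] := oP j; have kt : (k <= t)%N by lia.
have := acls_iter_shift (t - k) ka; rewrite y_shift subnKC //.
apply: acls_trans => _ /mapP[u + ->]; rewrite mem_cat => /orP[|/mapP[l + ->]].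
  move=> /allpairsP[[i l] [/= iM + ->]]; rewrite mem_iota => /andP[_ lo].
  rewrite y_shift; apply: acls_mem; rewrite mem_cat col_mem //; first by rewrite -mem_enum.
  by move: lo; rewrite add0n => lo; lia.
rewrite mem_iota add0n => /andP[_ lk]; rewrite y_shift.
have lt : (l + (t - k) < t)%N by lia.
apply: acls_sub (IH _ lt) => u'; rewrite !mem_cat => /orP[|->]; last by rewrite orbT.
move=> /allpairsP[[i m] [/= iM + ->]]; rewrite mem_iota => /andP[_ mo].
by rewrite col_mem //; [rewrite -mem_enum|lia].
Qed.

(** A comparison of growth: N transforms of each [b i] are d N independent elements, algebraic over
    |M| N plus a bounded number of elements. *)
Lemma transf_dim_le d (b : 'I_d -> L) :
  (forall E : L -> Prop, is_subfield E -> (forall x, E x -> E (sL x)) ->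
    (forall a, E (c a)) -> (forall j, E (eta j)) -> forall i, E (b i)) ->
  alg_indep c (fun v : 'I_d * nat => iter v.2 sL (b v.1)) -> (d <= #|M|)%N.
Proof.
move=> bE bI; have [o oP] := coordinates_acl.
(* The second [o] is for [B'shift]: shifting the fixed part gives transforms of order at most [o],
   which need the columns of [M] up to length o + o. *)
pose B' := B (o + o) o.
have B'S t u x : (t <= u)%N -> acls c (B' t) x -> acls c (B' u) x.
  move=> tu; apply: acls_sub => z; rewrite !mem_cat => /orP[|->]; last by rewrite orbT.
  move=> /allpairsP[[i m] [/= iM + ->]]; rewrite mem_iota => /andP[_ mo].
  by rewrite col_mem //; [rewrite -mem_enum|lia].
have B'sub t : is_subfield (acls c (B' t)) by exact: acl_subfield.
have B'shift t x : acls c (B' t) x -> acls c (B' t.+1) (sL x).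
  move/acls_shift; apply: acls_trans => _ /mapP[u + ->].
  rewrite mem_cat => /orP[] /allpairsP[[i m] [/= iM + ->]]; rewrite mem_iota => /andP[_ mo].
    rewrite -[sL _]/(iter 1 sL _) y_shift; apply: acls_mem; rewrite mem_cat col_mem //; last by lia.
    by rewrite -mem_enum.
  rewrite -[sL _]/(iter 1 sL _) y_shift; apply: acls_sub (oP i (m + 1)%N) => u'.
  rewrite !mem_cat => /orP[|->]; last by rewrite orbT.
  move=> /allpairsP[[i' m'] [/= iM' + ->]]; rewrite mem_iota => /andP[_ mo'].
  by rewrite col_mem //; [rewrite -mem_enum|lia].
(* The union of the closures of the [B' t] is a difference subfield containing eta, hence it
   contains every [b i]. *)
have bB i : exists t, acls c (B' t) (b i).
  apply: (bE (fun x => exists t, acls c (B' t) x)).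
  - split=> [|x z [t xt] [u zu]|x z [t xt] [u zu]].
    + by exists 0%N; have [] := B'sub 0%N.
    + exists (maxn t u); have [_ + _] := B'sub (maxn t u); apply.
        by apply: B'S xt; rewrite leq_maxl.
      by apply: B'S zu; rewrite leq_maxr.
    + exists (maxn t u); have [_ _] := B'sub (maxn t u); apply.
        by apply: B'S xt; rewrite leq_maxl.
      by apply: B'S zu; rewrite leq_maxr.
  - by move=> x [t /B'shift xt]; exists t.+1.
  - by move=> a; exists 0%N; apply: acl_adjoin; apply: adjoin_const.
  - move=> j; exists 0%N; apply: acls_sub (oP j 0%N) => u.
    rewrite !mem_cat => /orP[|->]; last by rewrite orbT.
    move=> /allpairsP[[i' m'] [/= iM' + ->]]; rewrite mem_iota => /andP[_ mo'].
    by rewrite col_mem //; [rewrite -mem_enum|lia].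
have /choice[f fP] := bB; pose t := (\max_i f i)%N.
(* One more than the part of the size of [B' (t + N)] that does not depend on N, so that (|M| + 1) N
   exceeds this size. *)
pose N := (#|M| * (o + o + t) + n * o).+1.
pose evb : {rmorphism mpol F ('I_d * nat)%type -> L} :=
  mev c (fun v => iter v.2 sL (b v.1)).
have evbC a : evb (mC a) = c a by exact: mevC.
pose l := [seq (i, k) | i <- enum 'I_d, k <- iota 0 N].
have ul : uniq l.
  by rewrite allpairs_uniq ?enum_uniq ?iota_uniq // => -[? ?] [? ?] _ _ [-> ->].
have : (size (map (fun v => evb (mX v)) l) <= size (B' (t + N)%N))%N.
  apply: (@steinitz _ _ c _ [::]).
    apply: (@indep_over_map _ _ c _ evb evbC [::]) => // p _ p0.
    have -> : p = Mpol (mpol_val p) by case: p {p0}.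
    by rewrite (bI (mpol_val p)) ?rmorph0 // -[LHS](mevE c).
  move=> _ /mapP[[i k] /allpairsP[[i' k'] [_ + [-> ->]]] ->].
  rewrite mem_iota cats0 /evb mevX /= add0n => kN.
  have kB : acls c (B' (f i' + k'))%N (iter k' sL (b i')).
    elim: (k') => [|m IH]; first by rewrite addn0.
    by rewrite addnS; apply: B'shift.
  apply: B'S kB; rewrite leq_add ?leq_bigmax //; exact: ltnW.
rewrite size_map size_cat !size_allpairs !size_iota -!cardE cardsT !card_ord => H.
rewrite leqNgt; apply/negP => Md; move: H; rewrite leqNgt => /negP; apply.
apply: (@leq_trans ((#|M|).+1 * N)); last by rewrite leq_mul2r Md orbT.
have : N = (#|M| * (o + o + t) + n * o).+1 by [].
rewrite mulSn !mulnDr; clearbody N; move: (#|M| * o)%N (#|M| * t)%N (#|M| * N)%N (n * o)%N.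
by clear; lia.
Qed.

End Count.

(** A maximal transformally independent set of coordinates has at least [d] elements, and any
    injection of 'I_d into it serves as [f]. *)
Theorem exists_coordinates d (b : 'I_d -> L) :
  (forall E : L -> Prop, is_subfield E -> (forall x, E x -> E (sL x)) ->
    (forall a, E (c a)) -> (forall j, E (eta j)) -> forall i, E (b i)) ->
  alg_indep c (fun v : 'I_d * nat => iter v.2 sL (b v.1)) ->
  exists f : 'I_d -> 'I_n, forall p : mpol F ('I_d * nat)%type,
    mev c (fun v => y (f v.1, v.2)) p = 0 -> p = 0.
Proof.
move=> bE bI.
have [M /maxsetP[/asboolP indM maxM]] :
    {M | maxset (fun M : {set 'I_n} => `[< transf_indep M >]) M}.
  apply: ex_maxset; exists set0; apply/asboolP => p p0.
  have [|a ->] := @not_occurs_const _ _ p; first by move=> z; apply/negP => /p0; rewrite inE.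
  by rewrite evC => /eqP; rewrite fmorph_eq0 => /eqP->; rewrite mC0.
have dM : (d <= #|M|)%N.
  apply: (transf_dim_le indM _ bE bI) => j jM /asboolP jMi.
  by move: jM; rewrite -(maxM _ jMi (subsetUr _ _)) setU11.
pose f i := enum_val (widen_ord dM i); have fI : injective f.
  by move=> i i' /enum_val_inj/(congr1 val)/= ii; apply: val_inj.
exists f => p p0.
pose ren : {rmorphism mpol F ('I_d * nat)%type -> mpol F ('I_n * nat)%type} :=
  mev (@mC F _) (fun v => mX (f v.1, v.2)).
have renM v : occurs (ren p) v -> v.1 \in M.
  move: v; elim/mpol_ind: p {p0} => [a|w|p q IHp IHq|p q IHp IHq] v.
  - by rewrite /ren mevC occursC.
  - by rewrite /ren mevX occursX => /eqP<-; apply: enum_valP.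
  - by rewrite rmorphD => /occursD/orP[/IHp|/IHq].
  - by rewrite rmorphM => /occursM/orP[/IHp|/IHq].
pose g j := [pick i | f i == j].
pose back : {rmorphism mpol F ('I_n * nat)%type -> mpol F ('I_d * nat)%type} :=
  mev (@mC F _) (fun v => if g v.1 is Some i then mX (i, v.2) else 0).
have renK : back (ren p) = p.
  apply: (@mpol_hom_eq F _ _ (back \o ren) idfun) => [a|[i k]] /=.
    by rewrite /ren mevC /back mevC.
  rewrite /ren mevX /back mevX /= /g; case: pickP => [i' /eqP/fI->//|/(_ i)].
  by rewrite eqxx.
rewrite -renK (indM _ renM) ?rmorph0 // -[RHS]p0.
apply: (@mpol_hom_eq F _ _ (ev \o ren) (mev c (fun v => y (f v.1, v.2)))) => [a|v] /=.
  by rewrite /ren mevC /ev !mevC.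
by rewrite /ren mevX /ev !mevX.
Qed.

End TransformalDimension.

(** * Translation of the definitions to [mpol] *)

Section MonomialDerivative.
Variables (F : fieldType) (Z : choiceType).

Lemma cmonom_ind (Q : {cmonom Z} -> Prop) :
  Q mone -> (forall v m, Q m -> Q (mmul (ucm v) m)) -> forall m, Q m.
Proof.
move=> Q1 QM m; have [N] := ubnP (mdeg m); elim: N m => // N IH m mN.
have [/mdeg_eq0I->//|m0] := eqVneq (mdeg m) 0%N.
have [v mv] : exists v, m v != 0%N.
  apply: contrapT => nv; case/eqP: m0; rewrite mdegE big1 // => v _.
  by apply/eqP/negPn/negP => mv; apply: nv; exists v.
have mE : m = mmul (ucm v) (divcm m (ucm v)).
  apply/eqP/cmP => i; rewrite cmM divcmE cmU.
  by case: eqP => [<-|_]; rewrite ?add0n ?subn0 // subnKC // lt0n.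
rewrite mE; apply: QM; apply: IH; move: mN.
by rewrite {1}mE mdegM mdegU add1n ltnS.
Qed.

(** If [z] does not occur in [m], the truncated quotient is just [m], but the multiplicity [m z] is
    then zero. *)
Lemma mder_mU z (m : {cmonom Z}) :
  mder z (mU m) = mU (divcm m (ucm z)) *+ m z :> mpol F Z.
Proof.
elim/cmonom_ind: m => [|v m IH].
  by rewrite mU1 -(rmorph1 (@mC F Z)) mderC cm1 mulr0n.
rewrite -mU_mul mderM IH cmM cmU.
have -> : mU (ucm v) = mX v :> mpol F Z by rewrite mX.unlock.
rewrite mderX; have [->|vz] := eqVneq v z.
  have -> : divcm (mmul (ucm z) m) (ucm z) = m.
    by apply/eqP/cmP => i; rewrite divcmE cmM cmU addKn.
  rewrite mul1r add1n mulrS; congr (_ + _).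
  have [->|mz] := eqVneq (m z) 0%N; first by rewrite !mulr0n mulr0.
  rewrite mulrnAr mX.unlock mU_mul; congr (mU _ *+ _); apply/eqP/cmP => i.
  rewrite cmM divcmE cmU; case: eqP => [<-|_]; rewrite ?add0n ?subn0 //.
  by rewrite subnKC // lt0n.
rewrite mul0r !add0r mulrnAr mX.unlock mU_mul; congr (mU _ *+ _); apply/eqP/cmP => i.
rewrite divcmE !cmM divcmE !cmU; have [zi|_] := eqVneq z i; last by rewrite !subn0.
by rewrite -zi (negbTE vz).
Qed.

End MonomialDerivative.

Section RawPolynomials.
Variables (F : diffField) (X : choiceType).

Lemma mpolK (p : {malg F[{cmonom (X * nat)%type}]}) : mpol_val (Mpol p) = p.
Proof. by []. Qed.

Lemma Mpol_dvar (x : X) k : Mpol (dvar F x k) = mX (x, k).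
Proof. by rewrite /dvar mX.unlock mU.unlock. Qed.

Lemma Mpol_dshift (p : dpoly F X) : Mpol (dshift p) = mshift (sigma F) (Mpol p).
Proof.
pose sh : {rmorphism dpoly F X -> dpoly F X} :=
  peval (@malgC {cmonom (X * nat)%type} F \o sigma F)
        (fun v : X * nat => dvar F v.1 v.2.+1).
pose shM : {rmorphism mpol F (X * nat)%type -> mpol F (X * nat)%type} :=
  @Mpol F _ \o sh \o @mpol_val F _.
have shE q : sh (mpol_val q) = mev (@malgC {cmonom (X * nat)%type} F \o sigma F)
    (fun v : X * nat => dvar F v.1 v.2.+1) q by rewrite mevE.
apply: (@mpol_hom_eq F _ _ shM (mshift (sigma F)) _ _ (Mpol p)) => [a|v].
  by rewrite /shM /= shE mevC mshiftC mCE.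
by rewrite /shM /= shE mevX mshiftX Mpol_dvar.
Qed.

Lemma Mpol_iter_dshift i (p : dpoly F X) :
  Mpol (iter i (@dshift F X) p) = iter i (mshift (sigma F)) (Mpol p).
Proof. by elim: i => //= i <-; rewrite Mpol_dshift. Qed.

Lemma Mpol_dpartial (x : X) k (p : dpoly F X) :
  Mpol (dpartial x k p) = mder (x, k) (Mpol p).
Proof.
rewrite [in RHS](mpolE (Mpol p)) mder_sum /dpartial /pderiv rmorph_sum /=.
apply: eq_bigr => m _; rewrite mderM mderC mul0r add0r mder_mU.
rewrite mulrnAr monalgUMn (raddfMn (@Mpol F _)); congr (_ *+ _).
rewrite mCE mU.unlock -rmorphM /=; congr Mpol.
by rewrite malgM_def fgmulUU mul1m; congr (mkmalgU _ _); rewrite mulr1.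
Qed.

End RawPolynomials.

Section RawSubstitution.
Variables (F : diffField) (X : choiceType).

Lemma Mpol_dsubst (Y : choiceType) (f : X -> dpoly F Y) (p : dpoly F X) :
  Mpol (dsubst f p) =
  mev (@mC F _) (fun v => iter v.2 (mshift (sigma F)) (Mpol (f v.1))) (Mpol p).
Proof.
pose fs : {rmorphism dpoly F X -> dpoly F Y} :=
  peval (@malgC {cmonom (Y * nat)%type} F)
        (fun v : X * nat => iter v.2 (@dshift F Y) (f v.1)).
pose fsM : {rmorphism mpol F (X * nat)%type -> mpol F (Y * nat)%type} :=
  @Mpol F _ \o fs \o @mpol_val F _.
have fsE q : fs (mpol_val q) = mev (@malgC {cmonom (Y * nat)%type} F)
    (fun v : X * nat => iter v.2 (@dshift F Y) (f v.1)) q by rewrite mevE.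
apply: (@mpol_hom_eq F _ _ fsM (mev _ _) _ _ (Mpol p)) => [a|v].
  by rewrite /fsM /= fsE !mevC mCE.
by rewrite /fsM /= fsE !mevX; apply: Mpol_iter_dshift.
Qed.

Lemma deval_mev (L : diffExt F) (eta : X -> L) (p : dpoly F X) :
  deval eta p = mev (ext_emb L) (fun v => iter v.2 (sigma L) (eta v.1)) (Mpol p).
Proof. by rewrite mevE. Qed.

End RawSubstitution.

(** * The Chow ideal as a kernel *)

Section ChowPoint.
Variables (F : diffField) (L : diffExt F) (n d : nat) (eta : 'I_n -> L).
Local Notation UN := (Xu n d * nat)%type.
Local Notation em := (ext_emb L).

Definition hyper (i : 'I_d.+1) (k : nat) : mpol L UN :=
  \sum_(j < n) mX ((i, lift ord0 j), k) * mC (iter k (sigma L) (eta j)).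

Definition chow_var (v : UN) : mpol L UN :=
  if v.1.2 == ord0 then - hyper v.1.1 v.2 else mX v.

Definition eps : {rmorphism mpol F UN -> mpol L UN} := mev (@mC L UN \o em) chow_var.

Lemma epsC a : eps (mC a) = mC (em a).
Proof. by rewrite /eps mevC. Qed.

Lemma epsX v : eps (mX v) = chow_var v.
Proof. by rewrite /eps mevX. Qed.

Lemma mshift_hyper i k : mshift (sigma L) (hyper i k) = hyper i k.+1.
Proof.
rewrite /hyper rmorph_sum; apply: eq_bigr => j _.
by rewrite rmorphM mshiftX mshiftC.
Qed.

Lemma eps_shift p : eps (mshift (sigma F) p) = mshift (sigma L) (eps p).
Proof.
apply: (@mpol_hom_eq F _ _ (eps \o mshift (sigma F)) (mshift (sigma L) \o eps)) => [a|v] /=.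
  by rewrite mshiftC !epsC mshiftC ext_sigma.
rewrite mshiftX !epsX /chow_var /=; case: ifP => _; last by rewrite mshiftX.
by rewrite rmorphN mshift_hyper.
Qed.

Let YU := (XYu n d * nat)%type.

(** The extension of [eps] to F{Y, u} by y_j -> eta_j. *)
Let epsY : {rmorphism mpol F YU -> mpol L UN} :=
  mev (@mC L UN \o em) (fun v => match v.1 with
    | inl j => mC (iter v.2 (sigma L) (eta j))
    | inr u => chow_var (u, v.2)
    end).

Let epsYX (v : YU) : epsY (mX v) = match v.1 with
    | inl j => mC (iter v.2 (sigma L) (eta j))
    | inr u => chow_var (u, v.2)
    end.
Proof. by rewrite /epsY mevX. Qed.

Let epsYC a : epsY (mC a) = mC (em a).
Proof. by rewrite /epsY mevC. Qed.

Let epsY_shift p : epsY (mshift (sigma F) p) = mshift (sigma L) (epsY p).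
Proof.
apply: (@mpol_hom_eq F _ _ (epsY \o mshift (sigma F)) (mshift (sigma L) \o epsY)) => [a|[[j|u] k]] /=.
- by rewrite mshiftC !epsYC mshiftC ext_sigma.
- by rewrite mshiftX !epsYX /= mshiftC.
- by rewrite mshiftX !epsYX /=; have := eps_shift (mX (u, k)); rewrite mshiftX !epsX.
Qed.

Lemma Mpol_hyperplane i : Mpol (generic_hyperplane F n i) =
  mX (inr (i, ord0), 0%N) +
  \sum_(j < n) mX (inr (i, lift ord0 j), 0%N) * mX (inl j, 0%N) :> mpol F YU.
Proof.
rewrite /generic_hyperplane (rmorphD (@Mpol F YU)) /= Mpol_dvar; congr (_ + _).
rewrite (rmorph_sum (@Mpol F YU)); apply: eq_bigr => j _.
by rewrite -!Mpol_dvar; apply: (rmorphM (@Mpol F YU)).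
Qed.

Lemma Mpol_dsubst_var (X : choiceType) (f : X -> XYu n d) (p : dpoly F X) :
  Mpol (dsubst (fun x => dvar F (f x) 0) p) =
  mev (@mC F YU) (fun v => mX (f v.1, v.2)) (Mpol p).
Proof.
rewrite Mpol_dsubst; apply: mpol_hom_eq => [a|v]; rewrite ?mevC // !mevX.
by rewrite Mpol_dvar iter_mshiftX.
Qed.

Variables (U : univ_domain F) (V : dpoint U n -> Prop).
Hypothesis eta_generic : generic_zero (vanishing_ideal V) eta.

(** The kernel of [epsY] is a difference ideal and contains the generators: elements of I(V) vanish
    at eta, and the images of the two parts of a hyperplane cancel. *)
Lemma chow_ideal_eps p : chow_ideal V p -> eps (Mpol p) = 0.
Proof.
move/(_ (fun q => epsY (Mpol q) = 0)) => H.
have -> : eps (Mpol p) = epsY (Mpol (dsubst (fun u => dvar F (inr u : XYu n d) 0) p)).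
  rewrite Mpol_dsubst_var; apply: (@mpol_hom_eq F _ _ eps (epsY \o mev _ _)) => [a|[u k]] /=.
    by rewrite epsC mevC epsYC.
  by rewrite epsX mevX epsYX.
apply: H; first split.
- by rewrite (rmorph0 (@Mpol F YU)) rmorph0.
- by move=> q r q0 r0; rewrite (rmorphD (@Mpol F YU)) rmorphD q0 r0 addr0.
- by move=> q r r0; rewrite (rmorphM (@Mpol F YU)) rmorphM r0 mulr0.
- by move=> q q0; rewrite Mpol_dshift epsY_shift q0 rmorph0.
move=> q [[r Vr ->]|[i ->]].
  rewrite Mpol_dsubst_var; have /eta_generic := Vr; rewrite deval_mev => r0.
  transitivity (mC (mev em (fun v => iter v.2 (sigma L) (eta v.1)) (Mpol r)) : mpol L UN);
    last by rewrite r0 rmorph0.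
  apply: (@mpol_hom_eq F _ _ (epsY \o mev _ _) (@mC L UN \o mev _ _)) => [a|[j k]] /=.
    by rewrite !mevC.
  by rewrite !mevX.
rewrite Mpol_hyperplane rmorphD rmorph_sum epsYX /= /chow_var /= addrC.
apply/eqP; rewrite subr_eq0 /hyper; apply/eqP/eq_bigr => j _.
by rewrite rmorphM !epsYX /= /chow_var /=.
Qed.

Let R := mpol F ('I_n * nat)%type.

Let hat : {rmorphism mpol F UN -> mpol R UN} :=
  mev (@mC R UN \o @mC F ('I_n * nat)%type)
    (fun v => if v.1.2 == ord0
      then - \sum_(j < n) mX ((v.1.1, lift ord0 j), v.2) * mC (mX (j, v.2)) else mX v).

Let flat : {rmorphism mpol R UN -> mpol F YU} :=
  mev (mev (@mC F YU) (fun v => mX (inl v.1, v.2))) (fun v => mX (inr v.1, v.2)).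

(* Modulo the hyperplanes, u_i0 may be replaced by - Sum_j u_ij y_j; the
   resulting polynomial in the remaining u_ij has its coefficients in I(V). *)
Lemma eps_chow_ideal p : eps (Mpol p) = 0 -> chow_ideal V p.
Proof.
move=> p0 I [I0 ID IM IS] gI; pose I' (q : mpol F YU) := I (mpol_val q).
pose iy : {rmorphism R -> mpol F YU} := mev (@mC F YU) (fun v => mX (inl v.1, v.2)).
pose evy : {rmorphism R -> L} := mev em (fun v => iter v.2 (sigma L) (eta v.1)).
have I'0 : I' 0 by rewrite /I' (rmorph0 (@mpol_val F YU)).
have I'D q r : I' q -> I' r -> I' (q + r).
  by move=> Iq Ir; rewrite /I' (rmorphD (@mpol_val F YU)); apply: ID.
have I'M q r : I' r -> I' (q * r).
  by move=> Ir; rewrite /I' (rmorphM (@mpol_val F YU)); apply: IM.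
have I'S q : I' q -> I' (mshift (sigma F) q).
  move=> Iq; have -> : mshift (sigma F) q = Mpol (dshift (mpol_val q)).
    by rewrite Mpol_dshift; congr (mshift _ _); case: (q).
  exact: IS.
have I'N q : I' q -> I' (- q) by rewrite -mulN1r; apply: I'M.
have I'sum (J : Type) (r : seq J) (f : J -> mpol F YU) :
    (forall j, I' (f j)) -> I' (\sum_(j <- r) f j).
  by move=> If; elim/big_rec: _ => // j q _ Iq; apply: I'D.
have Iiy q : evy q = 0 -> I' (iy q).
  move=> q0; have /gI : chow_generators V (dsubst (fun j => dvar F (inl j : XYu n d) 0) (mpol_val q)).
    left; exists (mpol_val q) => //; apply/eta_generic; rewrite deval_mev.
    by rewrite -[RHS]q0; congr (mev _ _ _); case: (q).
  rewrite -[X in I X](mpolK (X := XYu n d)) Mpol_dsubst_var.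
  by congr (I (mpol_val (mev _ _ _))); case: (q).
have flat0 q : (forall m, evy ((mpol_val q)@_m) = 0) -> I' (flat q).
  move=> q0; rewrite [q]mpolE rmorph_sum; apply: I'sum => m.
  by rewrite rmorphM mulrC; apply: I'M; rewrite /flat mevC; apply: Iiy.
(* Evaluating the coefficients of [hat (Mpol p)] at eta gives [eps (Mpol p)], which is zero; hence
   each coefficient lies in I(V). *)
have hat0 : I' (flat (hat (Mpol p))).
  apply: flat0 => m; rewrite -mev_coef.
  suff -> : mev (@mC L UN \o evy) mX (hat (Mpol p)) = 0.
    by rewrite (rmorph0 (@mpol_val L UN)) mcoeff0.
  rewrite -[RHS]p0; apply: (@mpol_hom_eq F _ _ (mev (@mC L UN \o evy) mX \o hat) eps) => [a|v] /=.
    by rewrite /hat mevC /= mevC /= /evy mevC epsC.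
  rewrite /hat mevX epsX /chow_var; case: ifP => _; last by rewrite mevX.
  rewrite rmorphN rmorph_sum; congr (- _); apply: eq_bigr => j _.
  by rewrite rmorphM mevX mevC /= /evy mevX.
pose sub : {rmorphism mpol F UN -> mpol F YU} := mev (@mC F YU) (fun v => mX (inr v.1, v.2)).
have congr_hat : I' (sub (Mpol p) - (flat \o hat) (Mpol p)).
  apply: (mpol_hom_congr (I := I')) => // [a|[[i j] k]].
    by rewrite /sub mevC /= /hat mevC /= /flat mevC /= mevC.
  rewrite /sub mevX /= /hat mevX /=; case: eqP => [->|_]; last first.
    by rewrite /flat mevX subrr.
  (* The variable u_i0^(k) and its replacement differ by the k-th transform of the hyperplane. *)
  have -> : mX (inr (i, ord0), k) - flat (- \sum_(j < n) mX ((i, lift ord0 j), k) * mC (mX (j, k)))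
      = iter k (mshift (sigma F)) (Mpol (generic_hyperplane F n i)).
    rewrite rmorphN opprK rmorph_sum Mpol_hyperplane.
    have iterD m (a b : mpol F YU) : iter m (mshift (sigma F)) (a + b) =
        iter m (mshift (sigma F)) a + iter m (mshift (sigma F)) b.
      by elim: m => //= m ->; rewrite rmorphD.
    have iterM m (a b : mpol F YU) : iter m (mshift (sigma F)) (a * b) =
        iter m (mshift (sigma F)) a * iter m (mshift (sigma F)) b.
      by elim: m => //= m ->; rewrite rmorphM.
    have iter0 m : iter m (mshift (sigma F)) 0 = 0 :> mpol F YU.
      by elim: m => //= m ->; rewrite rmorph0.
    rewrite iterD iter_mshiftX (big_morph _ (iterD k) (iter0 k)); congr (_ + _).
    apply: eq_bigr => j' _; rewrite iterM !iter_mshiftX rmorphM /flat mevX mevC /=.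
    by rewrite mevX.
  by elim: k => [|k IH] /=; [apply: gI; right; exists i|apply: I'S].
have : I' (sub (Mpol p)) by rewrite -(subrK ((flat \o hat) (Mpol p)) (sub _)); apply: I'D.
by rewrite /I' -[X in I X -> _]/(mpol_val (mev _ _ (Mpol p))) -Mpol_dsubst_var.
Qed.

End ChowPoint.

(** * Every nonzero element of the kernel involves u_00 *)

Section Injectivity.
Variables (F : diffField) (L : diffExt F) (n d : nat) (eta : 'I_n -> L).
Local Notation UN := (Xu n d * nat)%type.
Local Notation em := (ext_emb L).
Variable f : 'I_d -> 'I_n.
Let x (v : 'I_d * nat) : L := iter v.2 (sigma L) (eta (f v.1)).
Hypothesis x_indep : forall p : mpol F ('I_d * nat)%type, mev em x p = 0 -> p = 0.

Let R := mpol F ('I_d * nat)%type.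

(** Marks the coefficients that tend to -1: in the limit the hyperplane of index [lift ord0 i]
    becomes its constant coefficient minus the coordinate [f i]. *)
Let delta (v : UN) : bool :=
  if unlift ord0 v.1.1 is Some i then v.1.2 == lift ord0 (f i) else false.

Let eps0 : {rmorphism mpol F UN -> mpol L UN} := mev (@mC L UN \o em)
  (fun v => if (v.1.2 == ord0, unlift ord0 v.1.1) is (true, Some i)
    then mC (x (i, v.2)) else mX v).

(** Read the image as a polynomial in the remaining variables: its coefficients are polynomials
    evaluated at the independent elements [x]. *)
Let eps0_inj p : eps0 p = 0 -> p = 0.
Proof.
pose split : {rmorphism mpol F UN -> mpol R UN} :=
  mev (@mC R UN \o @mC F ('I_d * nat)%type)
    (fun v => if (v.1.2 == ord0, unlift ord0 v.1.1) is (true, Some i)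
      then mC (mX (i, v.2)) else mX v).
pose join : {rmorphism mpol R UN -> mpol F UN} :=
  mev (mev (@mC F UN) (fun v => mX ((lift ord0 v.1, ord0), v.2))) mX.
have splitK : join (split p) = p.
  apply: (@mpol_hom_eq F _ _ (join \o split) idfun) => [a|[[i j] k]] /=.
    by rewrite /split mevC /= /join mevC mevC.
  rewrite /split mevX /=; case: eqP => [->|_]; last by rewrite /join mevX.
  case: unliftP => [i' ->|_]; last by rewrite /join mevX.
  by rewrite /join mevC mevX.
have E : mev (@mC L UN \o mev em x) mX (split p) = eps0 p.
  apply: (@mpol_hom_eq F _ _ (mev (@mC L UN \o mev em x) mX \o split) eps0) => [a|[[i j] k]] /=.
    by rewrite /split mevC /= mevC /= mevC /eps0 mevC.
  rewrite /split /eps0 !mevX /=; case: eqP => _; last by rewrite mevX.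
  by case: unlift => [i'|]; [rewrite mevC /= mevX|rewrite mevX].
move=> p0; rewrite -splitK (_ : split p = 0) ?rmorph0 //.
rewrite [LHS]mpolE big1 // => m _; rewrite (x_indep (p := (mpol_val (split p))@_m)).
  by rewrite rmorph0 mul0r.
by rewrite -mev_coef E p0 (rmorph0 (@mpol_val L UN)) mcoeff0.
Qed.

(** It agrees with [eps] on polynomials without transforms of u_00. Leaving u_00 fixed makes the
    specialization [eps0] at t = 0 injective on the whole ring. *)
Let eps' : {rmorphism mpol F UN -> mpol L UN} := mev (@mC L UN \o em)
  (fun v => if v.1 == (ord0, ord0) then mX v else chow_var eta v).

Let eps'C a : eps' (mC a) = mC (em a).
Proof. exact: (mevC (@mC L UN \o em)). Qed.

Let eps'X v : eps' (mX v) = if v.1 == (ord0, ord0) then mX v else chow_var eta v.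
Proof. exact: (mevX (@mC L UN \o em)). Qed.

Let translate (K : fieldType) : {rmorphism mpol K UN -> {poly mpol K UN}} :=
  mev (polyC \o @mC K UN) (fun v => if v.1.2 == ord0 then (mX v)%:P
    else 'X * (mX v)%:P - (delta v)%:R).

Let eps_t : {rmorphism mpol F UN -> {poly mpol L UN}} :=
  mev (polyC \o (@mC L UN \o em)) (fun v =>
    if (v.1.2 == ord0, unlift ord0 v.1.1) is (true, Some i)
    then (mC (x (i, v.2)))%:P - 'X * (hyper eta v.1.1 v.2)%:P else (mX v)%:P).

Let eps_tC a : eps_t (mC a) = (mC (em a))%:P.
Proof. exact: (mevC (polyC \o (@mC L UN \o em))). Qed.

Let eps_tX v : eps_t (mX v) =
    if (v.1.2 == ord0, unlift ord0 v.1.1) is (true, Some i)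
    then (mC (x (i, v.2)))%:P - 'X * (hyper eta v.1.1 v.2)%:P else (mX v)%:P.
Proof. exact: (mevX (polyC \o (@mC L UN \o em))). Qed.

Let eps_h : {rmorphism {poly mpol F UN} -> {poly mpol L UN}} :=
  horner_eval 'X \o map_poly eps_t.

Let translateC (K : fieldType) a : translate K (mC a) = (mC a)%:P.
Proof. exact: (mevC (polyC \o @mC K UN)). Qed.

Let translateX (K : fieldType) v : translate K (mX v) =
  if v.1.2 == ord0 then (mX v)%:P else 'X * (mX v)%:P - (delta v)%:R.
Proof. exact: (mevX (polyC \o @mC K UN)). Qed.

Let eps_hC q : eps_h q%:P = eps_t q.
Proof. by rewrite /eps_h /= map_polyC /horner_eval hornerC. Qed.

Let eps_hX : eps_h 'X = 'X.
Proof. by rewrite /eps_h /= map_polyX /horner_eval hornerX. Qed.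

(** Conjugating by the translation replaces [eps'] by [eps_t], which is polynomial in t and becomes
    [eps0] at t = 0. *)
Let translate_eps p : translate L (eps' p) = eps_h (translate F p).
Proof.
have HC a : translate L (eps' (mC a)) = eps_h (translate F (mC a)).
  by rewrite eps'C !translateC eps_hC eps_tC.
apply: (@mpol_hom_eq F _ _ (translate L \o eps') (eps_h \o translate F)).
  exact: HC.
suff HX v : translate L (eps' (mX v)) = eps_h (translate F (mX v)) by exact: HX.
have v1E : (v.1 == (ord0, ord0)) = (v.1.1 == ord0) && (v.1.2 == ord0) by case: v.1.
rewrite eps'X /chow_var v1E [in RHS]translateX.
have [j0|j0] := eqVneq v.1.2 ord0; last first.
  rewrite andbF translateX (negbTE j0) (rmorphB eps_h) (rmorphM eps_h).
  by rewrite (rmorph_nat eps_h) eps_hX eps_hC eps_tX (negbTE j0).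
rewrite andbT eps_hC eps_tX j0 eqxx; move: (v.2) => k.
case: unliftP => [i' ->|->]; last by rewrite eqxx translateX j0 eqxx.
have -> : (lift ord0 i' == ord0) = false by [].
rewrite /hyper (rmorphN (translate L)) (rmorph_sum (translate L)) (rmorph_sum polyC) mulr_sumr.
rewrite (_ : (mC (x (i', k)))%:P = \sum_(j < n)
  (delta ((lift ord0 i', lift ord0 j), k))%:R * (mC (iter k (sigma L) (eta j)))%:P).
  rewrite -sumrB -[LHS]sumrN; apply: eq_bigr => j' _.
  have tX : translate L (mX ((lift ord0 i', lift ord0 j'), k)) =
      'X * (mX ((lift ord0 i', lift ord0 j'), k))%:P -
      (delta ((lift ord0 i', lift ord0 j'), k))%:R by exact: translateX.
  set A := mX _ in tX *; set B := mC _.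
  have -> : translate L (A * B) = ('X * A%:P - (delta ((lift ord0 i', lift ord0 j'), k))%:R) * B%:P.
    by rewrite (rmorphM (translate L)) tX translateC.
  rewrite mulrBl opprB -mulrA; congr (_ - 'X * _); exact: (esym (polyCM A B)).
rewrite (bigD1 (f i')) //= /delta /= liftK eqxx mul1r big1 ?addr0 // => j' jf.
by rewrite (inj_eq lift_inj) (negbTE jf) mul0r.
Qed.

(** Setting t = 1 and translating back recovers [p]. *)
Let translate_neq0 p : translate F p = 0 -> p = 0.
Proof.
pose back : {rmorphism mpol F UN -> mpol F UN} := mev (@mC F UN)
  (fun v => if v.1.2 == ord0 then mX v else mX v + (delta v)%:R).
have E : (horner_eval 1 \o map_poly back) (translate F p) = p.
  apply: (@mpol_hom_eq F _ _ (horner_eval 1 \o map_poly back \o translate F) idfun) => [a|v] /=.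
    by rewrite translateC map_polyC /horner_eval hornerC /= /back mevC.
  rewrite translateX; case: ifP => v0.
    by rewrite map_polyC /horner_eval hornerC /= /back mevX v0.
  rewrite rmorphB rmorphM rmorph_nat /= map_polyX map_polyC /horner_eval.
  rewrite hornerD hornerM hornerX hornerC mul1r hornerN hornerMn hornerC.
  by rewrite /= /back mevX v0 addrK.
by move=> p0; rewrite -E p0 rmorph0.
Qed.

(* After the translation u_ij -> t u_ij - delta_ij, divide by the largest power
   of t and set t = 0: then u_i0 specializes to the independent eta_(f i). *)
Lemma eps_inj p : eps d eta p = 0 -> p <> 0 ->
  exists k, occurs p ((ord0, ord0), k).
Proof.
move=> p0 pn0; apply: contrapT => np.
have {}p0 : eps' p = 0.
  rewrite -p0; apply: mpol_hom_eq_in => [a|[u k] pk]; first by rewrite eps'C epsC.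
  rewrite eps'X epsX; case: eqP => // /= e.
  by case: np; exists k; rewrite -e.
have [m [q q0 qE]] := multiplicity_XsubC (translate F p) 0.
have tn0 : translate F p != 0 by apply/eqP => /translate_neq0.
have epsX0 : eps_h ('X - 0%:P) = 'X.
  by rewrite polyC0 subr0 eps_hX.
have hq0 : eps_h q = 0.
  have := translate_eps p; rewrite p0 rmorph0 qE (rmorphM eps_h) (rmorphXn eps_h) epsX0 => /esym/eqP.
  by rewrite mulf_eq0 expf_eq0 polyX_eq0 andbF orbF => /eqP.
move: q0; rewrite tn0 /= => /negP; apply; apply/rootP; apply: eps0_inj.
pose at0 : {rmorphism {poly mpol L UN} -> mpol L UN} := horner_eval 0.
have at0E r : at0 r = r.[0] by [].
have H1 a : at0 (eps_t (mC a)) = eps0 (mC a).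
  by rewrite eps_tC at0E hornerC; exact: (esym (mevC (@mC L UN \o em) _ a)).
have H2 v : at0 (eps_t (mX v)) = eps0 (mX v).
  have -> : eps0 (mX v) = if (v.1.2 == ord0, unlift ord0 v.1.1) is (true, Some i)
    then mC (x (i, v.2)) else mX v by exact: (mevX (@mC L UN \o em)).
  rewrite eps_tX at0E; case: eqP => _; last by rewrite hornerC.
  case: unlift => [i'|]; last by rewrite hornerC.
  by rewrite hornerD hornerN hornerM hornerX mul0r oppr0 addr0 hornerC.
have at0_eps r : at0 (eps_t r) = eps0 r.
  exact: (@mpol_hom_eq F _ _ (at0 \o eps_t) eps0 H1 H2).
have -> : eps0 q.[0] = at0 (eps_h q).
  have -> : eps_h q = (map_poly eps_t q).['X] by [].
  have -> : at0 (map_poly eps_t q).['X] = (map_poly at0 (map_poly eps_t q)).[at0 'X].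
    by rewrite horner_map.
  have -> : eps0 q.[0] = (map_poly eps0 q).[0] by rewrite -(rmorph0 eps0) horner_map.
  rewrite -map_poly_comp (_ : at0 'X = 0); last by rewrite at0E hornerX.
  by congr (_.[0]); apply: eq_map_poly => r; exact: (esym (at0_eps r)).
by rewrite hq0 rmorph0.
Qed.

End Injectivity.

(** * Divisibility by the Chow form *)

Section ChowDivisibility.
Variables (F : diffField) (U : univ_domain F) (n d : nat).
Variables (V : dpoint U n -> Prop) (G : dpoly F (Xu n d)).
Local Notation UN := (Xu n d * nat)%type.

Lemma Mpol_irreducible : ring_irreducible G -> irreducible_elt (Mpol G).
Proof.
have MK (p : mpol F UN) : Mpol (mpol_val p) = p by case: p.
have unitE (p : mpol F UN) : ring_unit p <-> ring_unit (mpol_val p).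
  split=> -[b pb].
    by exists (mpol_val b); rewrite -(rmorphM (@mpol_val F UN) p b) pb rmorph1.
  exists (Mpol b); rewrite -[p]MK -(rmorphM (@Mpol F UN) (mpol_val p) b) pb.
  exact: (rmorph1 (@Mpol F UN)).
move=> [G0 Gu Gi]; have [] := @ring_irreducibleE _ _ (Mpol G) _; last by [].
split=> [e|/unitE//|a b e].
  by apply: G0; rewrite -[G]mpolK e; exact: (rmorph0 (@mpol_val F UN)).
have {}e : G = mpol_val a * mpol_val b.
  by rewrite -(rmorphM (@mpol_val F UN) a b) -e.
by case: (Gi _ _ e) => /unitE; [left|right].
Qed.

Lemma leader_occurs (lt : rel UN) (p : dpoly F (Xu n d)) v : leader lt p v <->
  occurs (Mpol p) v /\ forall w, occurs (Mpol p) w -> w = v \/ lt w v.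
Proof.
by rewrite /leader occurs.unlock.
Qed.

Lemma chow_form_dvd : ideal_dim (vanishing_ideal V) d -> is_chow_form V G ->
  exists (L : diffExt F) (eta : 'I_n -> L),
    [/\ Mpol G != 0, eps d eta (Mpol G) = 0 & forall p y q,
      order_at (Mpol G) y q -> eps d eta p = 0 ->
      (forall k, occurs p (y, k) -> (k <= q)%N) -> dvdr (Mpol G) p].
Proof.
move=> [L [eta [gz [b [bE bI _]]]]] [Girr [lt [A [lt_r [[Anz Aasc] AI Ared]]]]].
have [[irr tr] tot succ _] := lt_r.
have [|f fP] := @exists_coordinates F L (ext_emb L) (sigma F) (sigma L) (@ext_sigma F L) n eta d b _ bI.
  by move=> E Es Esh Ec Eeta i; apply: (bE i E) => // _ [j ->].
have Gi := Mpol_irreducible Girr.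
have G0 : Mpol G != 0.
  apply/eqP => e; have [+ _ _] := Girr; apply.
  by rewrite -[G]mpolK e; exact: (rmorph0 (@mpol_val F UN)).
have epsG : eps d eta (Mpol G) = 0.
  by apply: (chow_ideal_eps gz); apply: AI; rewrite mem_head.
exists L, eta; split=> // p y q.
(* Algebraic dependence is a matter of values in a field, so [eps] is continued into the fraction
   field. *)
pose ev : {rmorphism mpol F UN -> {fraction mpol L UN}} := @tofrac _ \o eps d eta.
pose c : {rmorphism F -> {fraction mpol L UN}} := @tofrac _ \o @mC L UN \o ext_emb L.
have evC a : ev (mC a) = c a by rewrite /ev /c /= epsC.
have ev0 r : (ev r == 0) = (eps d eta r == 0) by exact: tofrac_eq0.
have ev_shift r : ev r != 0 -> ev (mshift (sigma F) r) != 0.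
  rewrite !ev0 eps_shift; apply: contraNN => /eqP/mshift_inj/eqP; exact.
have shift_ev r : ev r = 0 -> ev (mshift (sigma F) r) = 0.
  by move/eqP; rewrite ev0 => /eqP r0; apply/eqP; rewrite ev0 eps_shift r0 rmorph0.
have ker r : ev r = 0 <-> eps d eta r = 0.
  by split=> /eqP; rewrite ?ev0 => /eqP// r0; apply/eqP; rewrite ev0; apply/eqP.
(* A leader exists because [eps] kills no nonzero constant. *)
have [v [Gv vmax]] : exists v, leader lt G v.
  have [l lP] := finite_occurs (Mpol G).
  have [|v] := @exists_greatest _ lt [seq w <- l | occurs (Mpol G) w] tr tot.
    apply/eqP => l0; have [|a e] := @not_occurs_const _ _ (Mpol G).
      move=> z; apply/negP => Gz; have := lP _ Gz => zl.
      have : z \in [seq w <- l | occurs (Mpol G) w] by rewrite mem_filter Gz.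
      by rewrite l0.
    move/eqP: epsG; rewrite e epsC; apply/negP.
    have a0 : a != 0 by apply: contraNneq G0 => a0; rewrite e a0 mC0.
    have /(rmorph_unit (@mC L UN)) : ext_emb L a \is a GRing.unit.
      by rewrite unitfE fmorph_eq0.
    by apply: contraTneq => ->; rewrite unitr0.
  rewrite mem_filter => /andP[Gv _] vP; exists v; apply/leader_occurs.
  by split=> // w Gw; apply: vP; rewrite mem_filter Gw lP.
have Gl : leader lt G v by [].
have /leader_occurs[{}Gv {}vmax] := Gl.
(* A kernel element with all variables below the leader [v] of [G] would be reduced with respect to
   [G] and to all later members of the chain, whose leaders are not below [v]. *)
have low r : ev r = 0 -> r != 0 -> exists2 w, occurs r w & ~~ lt w v.
  move=> /ker r0 rn0; apply: contrapT => nlow.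
  have rlt w : occurs r w -> lt w v.
    by move=> rw; apply/negPn/negP => wv; apply: nlow; exists w.
  have red a v' : leader lt a v' -> v = v' \/ lt v v' -> reduced lt (mpol_val r) a.
    move=> av' vv'; exists v'; split=> // l; have [av'0 _] := av'.
    suff : ~~ occurs r (v'.1, v'.2 + l)%N.
      by rewrite occurs.unlock -eqn0Ngt => /eqP->.
    apply/negP => /rlt.
    have vl : v' = (v'.1, v'.2 + l)%N \/ lt v' (v'.1, v'.2 + l)%N.
      case: l => [|l]; first by left; rewrite addn0 -surjective_pairing.
      by right; rewrite [X in lt X _]surjective_pairing; apply: ranking_ltn => //;
        rewrite addnS ltnS leq_addr.
    have nv : ~~ lt v' v.
      case: vv' => [->|vv']; first by rewrite irr.
      by apply/negP => /(tr _ _ _ vv'); rewrite irr.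
    by case: vl => [<-|vl lv]; [move=> lv; rewrite lv in nv|move: nv; rewrite (tr _ _ _ vl lv)].
  apply: (Ared (mpol_val r)) => [||a].
  - by apply: (eps_chow_ideal gz); rewrite -[RHS]r0; congr (eps _ _ _); case: (r).
  - move=> e; case/eqP: rn0; have -> : r = Mpol (mpol_val r) by case: (r).
    by rewrite e; exact: (rmorph0 (@Mpol F UN)).
  rewrite inE => /predU1P[->|aA]; first by apply: (red _ v) => //; left.
  have [|[v' [av' hv]] _] := Aasc 0%N (index a A).+1.
    by rewrite /= ltnS index_mem.
  have vv' := hv v Gl; apply: (red _ v'); first by move: av'; rewrite /= nth_index.
  by case: vv' => [|[-> _]]; [right|left].
have xP r : ev r = 0 -> r != 0 -> exists k, occurs r ((ord0, ord0), k).
  by move=> /ker r0 /eqP; apply: eps_inj fP _ r0.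
move=> Gy p0 pq.
have {}epsG : ev (Mpol G) = 0 by apply/ker.
have {}p0 : ev p = 0 by apply/ker.
exact: (lowest_relation_dvd evC ev_shift shift_ev lt_r Gi epsG Gv vmax low xP Gy p0 pq).
Qed.

End ChowDivisibility.

(** * Differential relations *)

Lemma commutator_leibniz (R : comNzRingType) (D1 D2 : R -> R) :
  {morph D1 : p q / p + q} -> {morph D2 : p q / p + q} ->
  (forall p q, D1 (p * q) = D1 p * q + p * D1 q) ->
  (forall p q, D2 (p * q) = D2 p * q + p * D2 q) ->
  forall p q, D1 (D2 (p * q)) - D2 (D1 (p * q)) =
    (D1 (D2 p) - D2 (D1 p)) * q + p * (D1 (D2 q) - D2 (D1 q)).
Proof. by move=> D1D D2D D1M D2M p q; rewrite D2M D1M D1D D2D !D1M !D2M; ring. Qed.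

Section Polarization.
Variables (F : fieldType) (n d k : nat).
Local Notation UN := (('I_d.+1 * 'I_n.+1) * nat)%type.
Implicit Types (p q : mpol F UN) (a b : 'I_d.+1).

(** For [a = b] this is the Euler operator of the block. *)
Definition polar a b p : mpol F UN :=
  \sum_(j < n.+1) mX ((a, j), k) * mder ((b, j), k) p.

Lemma polarC a b x : polar a b (mC x) = 0.
Proof. by rewrite /polar big1 // => j _; rewrite mderC mulr0. Qed.

Lemma polar0 a b : polar a b 0 = 0.
Proof. by rewrite -[X in polar _ _ X](mC0 F UN) polarC. Qed.

Lemma polarX a b v : polar a b (mX v) =
  if (v.1.1 == b) && (v.2 == k) then mX ((a, v.1.2), k) else 0.
Proof.
case: v => [[i j] l] /=; rewrite /polar; case: ifP => [/andP[/eqP-> /eqP->]|il].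
  rewrite (bigD1 j) //= mderX eqxx mulr1 big1 ?addr0 // => j' jj.
  by rewrite mderX !xpair_eqE eqxx [j == _]eq_sym (negbTE jj) mulr0.
rewrite big1 // => j' _; rewrite mderX !xpair_eqE.
by case: eqP il => _ /=; rewrite ?mulr0 // => ->; rewrite andbF mulr0.
Qed.

Lemma polarD a b : {morph polar a b : p q / p + q}.
Proof.
by move=> p q; rewrite /polar -big_split; apply: eq_bigr => j _; rewrite mderD mulrDr.
Qed.

Lemma polarM a b p q : polar a b (p * q) = polar a b p * q + p * polar a b q.
Proof.
rewrite /polar mulr_suml mulr_sumr -big_split; apply: eq_bigr => j _.
by rewrite mderM mulrDr mulrA mulrCA.
Qed.

(** Both sides are derivations that kill constants, so comparing them on variables is enough. *)
Lemma polar_commutator a b p : a != b ->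
  polar a b (polar b a p) - polar b a (polar a b p) = polar a a p - polar b b p.
Proof.
move=> ab; elim/mpol_ind: p => [x|[[i j] l]|p q IHp IHq|p q IHp IHq].
- by rewrite !polarC !polar0.
- rewrite !polarX /=; have [_|il] := eqVneq l k; last by rewrite !andbF !polar0.
  rewrite !andbT; have [->|ia] := eqVneq i a.
    by rewrite (negbTE ab) polar0 polarX /= !eqxx.
  have [_|ib] := eqVneq i b; last by rewrite !polar0.
  by rewrite polar0 polarX /= !eqxx.
- by rewrite !polarD opprD addrACA IHp IHq opprD addrACA.
- rewrite (commutator_leibniz (polarD a b) (polarD b a) (polarM a b) (polarM b a)).
  by rewrite IHp IHq !polarM !mulrBl !mulrBr opprD addrACA.
Qed.

End Polarization.

Section ChowRelations.
Variables (F : diffField) (L : diffExt F) (n d : nat) (eta : 'I_n -> L).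
Local Notation UN := (Xu n d * nat)%type.
Variable g : mpol F UN.
Hypothesis g_neq0 : g != 0.
Hypothesis g_eps : eps d eta g = 0.
Hypothesis g_dvd : forall p y q, order_at g y q -> eps d eta p = 0 ->
  (forall k, occurs p (y, k) -> (k <= q)%N) -> dvdr g p.

Definition block (i : 'I_d.+1) (k : nat) (v : UN) : nat := (v.1.1 == i) && (v.2 == k).

Lemma exists_order y k : occurs g (y, k) -> exists q, order_at g y q.
Proof.
move=> gk; have [l lP] := finite_occurs g.
have kP m : occurs g (y, m) -> (m <= \max_(v <- l) v.2)%N.
  move=> /lP vl.
  exact: (@leq_bigmax_seq _ _ xpredT (fun v : UN => v.2) (y, m) vl isT).
have [m gm mP] := ex_maxnP (ex_intro _ k gk) kP.
by exists m.
Qed.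

(** A polynomial in the variables of [g] has no larger order than [g] in any indeterminate, and [g]
    has one since it is not constant. *)
Lemma relation_dvd p : eps d eta p = 0 -> (forall z, occurs p z -> occurs g z) ->
  dvdr g p.
Proof.
move=> p0 pg; have [y [k gk]] : exists y k, occurs g (y, k).
  apply: contrapT => ng; have [|a e] := @not_occurs_const _ _ g.
    by move=> [y k]; apply/negP => gz; apply: ng; exists y, k.
  have a0 : a != 0 by apply: contraNneq g_neq0 => a0; rewrite e a0 mC0.
  have /(rmorph_unit (@mC L UN)) : ext_emb L a \is a GRing.unit.
    by rewrite unitfE fmorph_eq0.
  by rewrite -(@epsC F L n d eta) -e g_eps unitr0.
have [q gq] := exists_order gk.
by apply: (g_dvd gq p0) => l /pg; apply: gq.2.
Qed.

(** [eps] replaces u_i0^(k) by a linear form in the same block, so it preserves the weight of the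
    block. *)
Lemma wpoly_eps i k p : wpoly (block i k) (eps d eta p) =
  map_poly (eps d eta) (wpoly (block i k) p).
Proof.
have HC a : wpoly (block i k) (eps d eta (mC a)) =
    map_poly (eps d eta) (wpoly (block i k) (mC a)).
  by rewrite epsC !wpolyC map_polyC /= epsC.
have HX v : wpoly (block i k) (eps d eta (mX v)) =
    map_poly (eps d eta) (wpoly (block i k) (mX v)).
  rewrite [in RHS]wpolyX rmorphM /= map_polyC map_polyXn /= epsX /chow_var.
  case: eqP => _; last by rewrite wpolyX.
  rewrite /hyper !rmorphN rmorph_sum mulNr; congr (- _).
  rewrite (rmorph_sum polyC) mulr_suml; apply: eq_bigr => j _.
  have -> : block i k v = block i k ((v.1.1, lift ord0 j), v.2) by [].
  rewrite (rmorphM (wpoly (block i k))) wpolyX wpolyC.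
  by rewrite mulrAC -polyCM.
exact: (@mpol_hom_eq F _ _ (wpoly (block i k) \o eps d eta)
  (map_poly (eps d eta) \o wpoly (block i k)) HC HX).
Qed.

Lemma chow_homogeneous i k : exists r, wpoly (block i k) g = g%:P * 'X^r.
Proof.
apply: homogeneous_of_dvd => // e; apply: relation_dvd; last exact: wpoly_coef_occurs.
by rewrite -coef_map -wpoly_eps g_eps rmorph0 coef0.
Qed.

Lemma chow_euler i k r : wpoly (block i k) g = g%:P * 'X^r -> polar k i i g = g *+ r.
Proof.
apply: euler => [j j' []//|[[i' j] l]]; rewrite /block /=; congr nat_of_bool.
apply/andP/existsP => [[/eqP-> /eqP->]|[j' /eqP[-> _ ->]]]; last by [].
by exists j.
Qed.

(** The linear forms replacing u_a0^(k) and u_b0^(k) have the same coefficients, the k-th transforms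
    of the eta_j. Hence moving block [b] in the direction of block [a] commutes with [eps], and so
    does the part linear in the parameter. *)
Lemma eps_polar k a b p : eps d eta p = 0 -> eps d eta (polar k a b p) = 0.
Proof.
move=> p0; pose yF v : mpol F UN := if (v.1.1 == b) && (v.2 == k) then mX ((a, v.1.2), k) else 0.
have yFE v : yF v = \sum_(j < n.+1) (v == ((b, j), k))%:R * mX ((a, j), k).
  rewrite /yF; case: v => [[i j] l] /=; case: ifP => [/andP[/eqP-> /eqP->]|il].
    rewrite (bigD1 j) //= eqxx mul1r big1 ?addr0 // => j' jj.
    by rewrite !xpair_eqE eqxx [j == _]eq_sym (negbTE jj) mul0r.
  rewrite big1 // => j' _; rewrite !xpair_eqE.
  by case: eqP il => _ /=; rewrite ?mul0r // => ->; rewrite andbF mul0r.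
rewrite /polar -(@perturb_coef1 _ _ _ (fun j => ((b, j), k)) _ _ p yFE).
pose yL v : mpol L UN := if (v.1.1 == b) && (v.2 == k) then mX ((a, v.1.2), k) else 0.
pose PL : {rmorphism mpol L UN -> {poly mpol L UN}} := perturb yL.
rewrite -coef_map.
suff -> : map_poly (eps d eta) (perturb yF p) = PL (eps d eta p) by rewrite p0 rmorph0 coef0.
have PLC c : PL (mC c) = (mC c)%:P by exact: (mevC (polyC \o @mC L UN)).
have PLX v : PL (mX v) = (mX v)%:P + (yL v)%:P * 'X by exact: (mevX (polyC \o @mC L UN)).
have PFC c : perturb yF (mC c) = (mC c)%:P by exact: (mevC (polyC \o @mC F UN)).
have PFX v : perturb yF (mX v) = (mX v)%:P + (yF v)%:P * 'X
  by exact: (mevX (polyC \o @mC F UN)).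
have HC c : map_poly (eps d eta) (perturb yF (mC c)) = PL (eps d eta (mC c)).
  by rewrite PFC epsC PLC map_polyC /= epsC.
have mapX (q r : mpol F UN) : map_poly (eps d eta) (q%:P + r%:P * 'X) =
    (eps d eta q)%:P + (eps d eta r)%:P * 'X.
  by rewrite rmorphD rmorphM /= !map_polyC map_polyX.
have HX v : map_poly (eps d eta) (perturb yF (mX v)) = PL (eps d eta (mX v)).
  rewrite PFX mapX epsX; case: v => [[i j] l].
  have -> : eps d eta (yF ((i, j), l)) =
      if (i == b) && (l == k) then chow_var eta ((a, j), k) else 0.
    by rewrite /yF /=; case: ifP => _; rewrite ?epsX ?rmorph0.
  rewrite /chow_var /=; have [_|j0] := eqVneq j ord0; last by rewrite PLX.
  have -> : (if (i == b) && (l == k) then - hyper eta a k else 0) =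
      - \sum_(j' < n) yL ((i, lift ord0 j'), l) * mC (iter l (sigma L) (eta j')).
    rewrite /yL /=; case: ifP => [/andP[_ /eqP->]|_]; first by [].
    by rewrite big1 ?oppr0 // => j' _; rewrite mul0r.
  rewrite (rmorphN PL) /hyper (rmorph_sum PL) !polyCN mulNr -opprD; congr (- _).
  rewrite !(rmorph_sum polyC) mulr_suml -big_split; apply: eq_bigr => j' _ /=.
  rewrite (rmorphM PL) PLX PLC mulrDl; congr (_ + _).
    exact: polyCM.
  rewrite [RHS]mulrAC; congr (_ * _); exact: polyCM.
exact: (@mpol_hom_eq F _ _ (map_poly (eps d eta) \o perturb yF) (PL \o eps d eta) HC HX).
Qed.

Lemma polar_eq0 k a b : a != b -> polar k a b g = 0.
Proof.
move=> ab; have [r gr] := chow_homogeneous b k.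
have [[j gj]|nj] := pselect (exists j, occurs g ((b, j), k)); last first.
  rewrite /polar big1 // => j _.
  suff -> : mder ((b, j), k) g = 0 by rewrite mulr0.
  rewrite /mder upoly_not_occurs ?derivC ?horner0 //.
  by apply/negP => gj; apply: nj; exists j.
apply: (homogeneous_dvd_eq0 g_neq0 gr).
  rewrite /polar rmorph_sum mulr_sumr (rmorph_sum polyC) mulr_suml.
  apply: eq_bigr => j' _; rewrite (rmorphM (wpoly (block b k))) wpolyX.
  have -> : block b k ((a, j'), k) = 0%N by rewrite /block /= (negbTE ab).
  rewrite expr0 mulr1 mulrCA (homogeneous_mder _ gr); last by rewrite /block /= !eqxx.
  rewrite mulrA; congr (_ * _); exact: (esym (polyCM _ _)).
(* The order is measured in an indeterminate of block [b], since the polarization may bring in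
   variables of block [a] that [g] lacks. *)
have [q gq] := exists_order gj.
apply: (g_dvd gq); first exact: eps_polar.
move=> l; rewrite /polar => Hl.
have : exists j', occurs (mX ((a, j'), k) * mder ((b, j'), k) g) ((b, j), l).
  apply: contrapT => nl; have : forall j', ~~ occurs (mX ((a, j'), k) * mder ((b, j'), k) g) ((b, j), l).
    by move=> j'; apply/negP => o; apply: nl; exists j'.
  move=> {}nl; move: Hl; apply/negP; elim/big_rec: _ => [|j' p _ np]; first by rewrite occurs0.
  by apply/negP => /occursD; rewrite (negbTE (nl j')) (negbTE np).
move=> [j' /occursM/orP[|/mder_occurs]]; last exact: gq.2.
by rewrite occursX => /eqP[e]; move: ab; rewrite e eqxx.
Qed.

(** The commutator of the polarizations kills [g], so the two Euler operators agree on [g]. This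
    compares the degrees modulo the characteristic, which is all that multiples of [g] can see. *)
Lemma chow_degree_eq k a b r s : wpoly (block a k) g = g%:P * 'X^r ->
  wpoly (block b k) g = g%:P * 'X^s -> g *+ r = g *+ s.
Proof.
have [->|ab] := eqVneq a b; first by move=> /chow_euler <- /chow_euler <-.
move=> /chow_euler <- /chow_euler <-; apply/eqP; rewrite -subr_eq0.
rewrite -polar_commutator // !polar_eq0 ?polar0 ?subrr //.
by rewrite eq_sym.
Qed.

End ChowRelations.

Lemma homogeneous_transformally (F : diffField) (X : choiceType) (B : pred X)
    (p : dpoly F X) (r : nat -> nat) :
  (forall k, wpoly (fun v : X * nat => (B v.1 && (v.2 == k) : nat)) (Mpol p) =
     (Mpol p)%:P * 'X^(r k)) ->
  transformally_homogeneous B p.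
Proof.
move=> pr; have [l lP] := finite_occurs (Mpol p).
pose N := (\max_(v <- l) v.2).+1.
have vN x k : occurs (Mpol p) (x, k) -> (k < N)%N.
  move=> /lP vl; rewrite ltnS.
  exact: (@leq_bigmax_seq _ _ xpredT (fun v : X * nat => v.2) (x, k) vl isT).
exists (mkseq r N); set y := fun x => _; pose Y x := dvar F (Some x : option X) 0.
pose R := mpol F (option X * nat)%type.
pose lam k : R := mX (None, k).
(* [f k] inserts lambda only in transforms of order below [k]. It starts from plain renaming at 0
   and reaches the full substitution on [p] at [N], which exceeds all orders in [p]. *)
pose f k : {rmorphism mpol F (X * nat)%type -> R} := mev (@mC F _)
  (fun v => if B v.1 && (v.2 < k)%N then lam v.2 * mX (Some v.1, v.2) else mX (Some v.1, v.2)).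
have fC k a : f k (mC a) = mC a by exact: mevC.
have fX k v : f k (mX v) = if B v.1 && (v.2 < k)%N then lam v.2 * mX (Some v.1, v.2)
  else mX (Some v.1, v.2) by exact: mevX.
have iterM m (a b : R) : iter m (mshift (sigma F)) (a * b) =
    iter m (mshift (sigma F)) a * iter m (mshift (sigma F)) b.
  by elim: m => //= m ->; rewrite rmorphM.
have yE : Mpol (dsubst y p) = f N (Mpol p).
  rewrite Mpol_dsubst; apply: mpol_hom_eq_in => [a|[x k] /vN kN].
    by rewrite mevC fC.
  rewrite mevX fX /y /= kN andbT; case: ifP => _; last by rewrite Mpol_dvar iter_mshiftX.
  have -> : Mpol (dvar F None 0 * dvar F (Some x) 0) = mX (None, 0%N) * mX (Some x, 0%N) :> R.
    by rewrite -!Mpol_dvar; apply: (rmorphM (@Mpol F _)).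
  by rewrite iterM !iter_mshiftX.
have YE : Mpol (dsubst Y p) = f 0%N (Mpol p).
  rewrite Mpol_dsubst; apply: mpol_hom_eq => [a|[x k]]; first by rewrite mevC fC.
  by rewrite mevX fX /Y /= andbF Mpol_dvar iter_mshiftX.
have fXS k v : f k.+1 (mX v) = f k (mX v) * lam k ^+ (B v.1 && (v.2 == k) : nat).
  rewrite !fX ltnS; case: (B v.1) => /=; last by rewrite mulr1.
  case: (ltngtP v.2 k) => [_|_|<-]; rewrite ?mulr1 //.
  by rewrite mulrC.
pose M : dpoly F (option X) :=
  \prod_(k < size (mkseq r N)) dvar F None k ^+ nth 0%N (mkseq r N) k.
have ME : Mpol M = \prod_(k < N) lam k ^+ r k.
  rewrite /M (rmorph_prod (@Mpol F _)) size_mkseq; apply: eq_bigr => k _.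
  by rewrite (rmorphXn (@Mpol F _)) /= Mpol_dvar nth_mkseq.
have fN : f N (Mpol p) = (\prod_(k < N) lam k ^+ r k) * f 0%N (Mpol p).
  by apply: (homogeneous_prod _ _ fXS pr) => k a; rewrite !fC.
have E : Mpol (dsubst y p) = Mpol M * Mpol (dsubst Y p).
  exact: (etrans yE (etrans fN (congr2 *%R (esym ME) (esym YE)))).
exact: (congr1 (@mpol_val F _) (etrans E (esym (rmorphM (@Mpol F _) M (dsubst Y p))))).
Qed.

Theorem theorem6p16 (F : diffField) (U : univ_domain F) (n d h : nat)
    (V : dpoint U n -> Prop) (G : dpoly F (Xu n d)) :
  irreducible_variety V -> variety_dim V d -> variety_order V h ->
  is_chow_form V G ->
  (exists r : 'I_h.+1 -> nat,
     forall (k : 'I_h.+1) (rho tau : 'I_d.+1),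
       \sum_(j < n.+1) dvar F ((tau, j) : Xu n d) k *
                       dpartial ((rho, j) : Xu n d) k G =
       if rho == tau then G *+ r k else 0) /\
  (forall i : 'I_d.+1,
     transformally_homogeneous (fun u : Xu n d => u.1 == i) G).
Proof.
move=> _ dimV _ GV; have [L [eta [G0 epsG Gdvd]]] := chow_form_dvd dimV GV.
have homog := chow_homogeneous G0 epsG Gdvd.
have /choice[r rP] : forall i, exists r, forall k,
    wpoly (block i k) (Mpol G) = (Mpol G)%:P * 'X^(r k).
  by move=> i; have /choice[r rP] := homog i; exists r.
split=> [|i]; last exact: (homogeneous_transformally (rP i)).
(* Block 0 serves as reference; [chow_degree_eq] relates the other blocks to it. *)
exists (fun k => r ord0 k) => k rho tau.
have inj (p q : dpoly F (Xu n d)) : Mpol p = Mpol q -> p = q.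
  by move/(congr1 (@mpol_val F _)).
apply: inj.
have -> : Mpol (\sum_(j < n.+1) dvar F ((tau, j) : Xu n d) k *
    dpartial ((rho, j) : Xu n d) k G) = polar k tau rho (Mpol G).
  rewrite (rmorph_sum (@Mpol F _)); apply: eq_bigr => j _.
  by rewrite -Mpol_dvar -Mpol_dpartial; apply: (rmorphM (@Mpol F _)).
case: eqVneq => [->|rt].
  rewrite (raddfMn (@Mpol F _)) (chow_euler (rP tau k)).
  exact: (chow_degree_eq G0 epsG Gdvd (rP tau k) (rP ord0 k)).
rewrite (polar_eq0 G0 epsG Gdvd); last by rewrite eq_sym.
exact: (esym (rmorph0 (@Mpol F _))).
Qed.
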